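(* Let $(w,F)\in C^2(\overline R)\times\mathbb R$, with $w$ of finite $C^2$ norm, be a solution of the height equation such that $w>0$ in $R\cup T$, $F>F_{\mathrm{cr}}$, and $w,Dw,D^2w\to0$ uniformly as $q\to-\infty$ (or as $q\to+\infty$). Then there exists $q_*\in\mathbb R$ such that $q\mapsto w(q,\cdot)$ is even about $q=q_*$ and $$\pm w_q>0\quad\text{for }\pm(q_*-q)>0,\ -1<p\le0.$$
   Context: Fix $\alpha\in(0,1)$, $\rho\in C^{2+\alpha}([-1,0])$ with $\rho>0$, $\rho_p\le0$, and $H\in C^{3+\alpha}([-1,0])$ with $H(-1)=0$, $H(0)=1$, $H_p>0$. Let $R=\mathbb R\times(-1,0)$ (coordinates $(q,p)$), $T=\mathbb R\times\{0\}$, $B=\mathbb R\times\{-1\}$. For $F>0$, $(w,F)$ solves the height equation if $h=H+w$ satisfies $\big(-\frac{1+h_q^2}{2h_p^2}+\frac1{2H_p^2}\big)_p+\big(\frac{h_q}{h_p}\big)_q-\frac1{F^2}\rho_p(h-H)=0$ in $R$, $\frac{1+h_q^2}{2h_p^2}-\frac1{2H_p^2}+\frac1{F^2}\rho(h-1)=0$ on $T$, $h=0$ on $B$, and $0<\inf_R(H_p+w_p)<\infty$. $\mu_{\mathrm{cr}}$ is the smallest positive $\mu$ for which $(\phi_p/H_p^3)_p-\mu\rho_p\phi=0$ on $(-1,0)$, $\phi(-1)=0$, $-\phi_p(0)/H_p(0)^3+\mu\rho(0)\phi(0)=0$ has a nontrivial solution, and $F_{\mathrm{cr}}=\mu_{\mathrm{cr}}^{-1/2}$.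 *)

(* Defs.v *)
From Stdlib Require Import Reals Lra.
From Coquelicot Require Import Coquelicot.
Open Scope R_scope.

(* f is C^k on the whole real line (functions on [-1,0] are represented by a
   C^k extension to R). *)
Definition Ck_R (k : nat) (f : R -> R) : Prop :=
  (forall n x, (n <= k)%nat -> ex_derive_n f n x) /\
  (forall x, continuous (Derive_n f k) x).

Definition Holder_on (alpha a b : R) (g : R -> R) : Prop :=
  exists C : R, forall x y, a <= x <= b -> a <= y <= b ->
    Rabs (g x - g y) <= C * Rpower (Rabs (x - y)) alpha.

Definition Ckalpha (k : nat) (alpha : R) (f : R -> R) : Prop :=
  Ck_R k f /\ Holder_on alpha (-1) 0 (Derive_n f k).

Definition Dq (f : R -> R -> R) : R -> R -> R :=
  fun q p => Derive (fun x => f x p) q.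
Definition Dp (f : R -> R -> R) : R -> R -> R :=
  fun q p => Derive (fun y => f q y) p.

Definition C2_plane (f : R -> R -> R) : Prop :=
  (forall q p,
      ex_derive (fun x => f x p) q /\ ex_derive (fun y => f q y) p /\
      ex_derive (fun x => Dq f x p) q /\ ex_derive (fun y => Dq f q y) p /\
      ex_derive (fun x => Dp f x p) q /\ ex_derive (fun y => Dp f q y) p) /\
  (forall q p,
      continuity_2d_pt f q p /\
      continuity_2d_pt (Dq f) q p /\ continuity_2d_pt (Dp f) q p /\
      continuity_2d_pt (Dq (Dq f)) q p /\ continuity_2d_pt (Dp (Dq f)) q p /\
      continuity_2d_pt (Dq (Dp f)) q p /\ continuity_2d_pt (Dp (Dp f)) q p).

Definition C2_data_all (P : R -> Prop) (f : R -> R -> R) (q p : R) : Prop :=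
  P (f q p) /\ P (Dq f q p) /\ P (Dp f q p) /\ P (Dq (Dq f) q p) /\
  P (Dp (Dq f) q p) /\ P (Dq (Dp f) q p) /\ P (Dp (Dp f) q p).

Definition finite_C2_norm (f : R -> R -> R) : Prop :=
  exists M : R, forall q p, -1 <= p <= 0 ->
    C2_data_all (fun v => Rabs v <= M) f q p.

Definition decays_minus_infty (f : R -> R -> R) : Prop :=
  forall eps, 0 < eps -> exists Q : R, forall q p, q < Q -> -1 <= p <= 0 ->
    C2_data_all (fun v => Rabs v < eps) f q p.

Definition decays_plus_infty (f : R -> R -> R) : Prop :=
  forall eps, 0 < eps -> exists Q : R, forall q p, Q < q -> -1 <= p <= 0 ->
    C2_data_all (fun v => Rabs v < eps) f q p.

Definition height_h (H : R -> R) (w : R -> R -> R) : R -> R -> R :=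
  fun q p => H p + w q p.

Definition height_equation (rho H : R -> R) (w : R -> R -> R) (F : R) : Prop :=
  let h := height_h H w in
  let Hp := Derive H in
  let A := fun q p => - (1 + (Dq h q p)^2) / (2 * (Dp h q p)^2) + 1 / (2 * (Hp p)^2) in
  let B := fun q p => Dq h q p / Dp h q p in
  0 < F /\
  (forall q p, -1 < p < 0 ->
     Dp A q p + Dq B q p - 1 / F^2 * Derive rho p * (h q p - H p) = 0) /\
  (forall q, (1 + (Dq h q 0)^2) / (2 * (Dp h q 0)^2) - 1 / (2 * (Hp 0)^2)
             + 1 / F^2 * rho 0 * (h q 0 - 1) = 0) /\
  (forall q, h q (-1) = 0) /\
  (exists c : R, 0 < c /\ forall q p, -1 < p < 0 -> c <= Hp p + Dp w q p).

Definition SL_eigen (rho H : R -> R) (mu : R) : Prop :=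
  exists phi : R -> R,
    Ck_R 2 phi /\
    (exists p0, -1 <= p0 <= 0 /\ phi p0 <> 0) /\
    (forall p, -1 < p < 0 ->
       Derive (fun y => Derive phi y / (Derive H y)^3) p
       - mu * Derive rho p * phi p = 0) /\
    phi (-1) = 0 /\
    - Derive phi 0 / (Derive H 0)^3 + mu * rho 0 * phi 0 = 0.

Definition is_mu_cr (rho H : R -> R) (mu : R) : Prop :=
  0 < mu /\ SL_eigen rho H mu /\
  (forall mu', 0 < mu' -> SL_eigen rho H mu' -> mu <= mu').

Definition is_F_cr (rho H : R -> R) (Fcr : R) : Prop :=
  exists mu, is_mu_cr rho H mu /\ Fcr = / sqrt mu.

(* Main.v *)
(** Moving planes, starting from the end where w decays.  Put v(q,p) = w(2l-q,p) - w(q,p) on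
    q <= l.  Subtracting the equations at mirror points gives a linear elliptic equation for v
    whose zeroth-order coefficient has a sign (rho' <= 0) that is harmless as soon as v >= 0, so
    the strong maximum principle, Hopf's lemma and Serrin's corner lemma apply to v without it.
    Far out in the decaying end the sign is wrong for a comparison argument; there
    F > F_cr provides a positive strict supersolution ps(p) of the linearised problem, and
    v / ps cannot have a negative minimum.  The profile ps is found by shooting: the shooting
    function is entire in mu = 1/F^2 and has no zero below mu_cr.

    Either the plane stops at some l, and then w is even about l and strictly monotone before it,
    or w is nondecreasing in q.  In the second case w is a front: its slope w_p tends to a
    positive profile u(p) while w_q -> 0, and the flow force, which is independent of q, is
    zero because w vanishes at the other end.  Then the derivative in q of the integral of
    w w_q / h_p tends to minus the integral of u^3 / (2 H_p^2 (H_p + u)^2), which is impossible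
    for a bounded quantity. *)
Require Import Defs.
From Stdlib Require Import Reals Lra Lia Psatz Classical FunctionalExtensionality.
From Stdlib Require Import PSeries_reg Factorial.
From Coquelicot Require Import Coquelicot.
Open Scope R_scope.

(** * Calculus in one and two variables *)

(** The axis of reflection meets the boundary of the strip at right angles. No interior ball of the
    half strip touches these two corners, so Hopf's lemma is silent there and second-order
    information takes its place: v_qp has a strict sign at a corner, provided that the mixed
    coefficient of the operator vanishes linearly there. It does, being proportional to the mirror
    value of w_q. On the bottom w_q is zero; at the surface a zero of w_q forces w_qp = 0 through
    the tangential derivative of the surface condition, against that sign. The quotient v / ps also
    supplies compactness: the bound to the left of which it has no negative minimum does not depend
    on l, so negative minima for nearby planes accumulate at a finite point. A front is excluded
    without constructing its limit: w is bounded and monotone in q, and bounds on second derivatives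
    make w_q small and w_p Cauchy. Multiplying the equation by w and subtracting twice the flow
    force cancels the surface terms and the potential energy; what remains is a cubic in the slope,
    of one sign, up to terms in w_q^2. *)

Lemma cluster_point (a b : R) (Q : R -> R -> Prop) :
  (forall e e' x, 0 < e -> e <= e' -> Q e x -> Q e' x) ->
  (forall e, 0 < e -> exists x, a <= x <= b /\ Q e x) ->
  exists x, a <= x <= b /\
    forall e, 0 < e -> exists y, a <= y <= b /\ Rabs (y - x) < e /\ Q e y.
Proof.
intros mono ex.
apply NNPP; intros no.
assert (loc : forall x, a <= x <= b -> exists e, 0 < e /\
          forall y, a <= y <= b -> Rabs (y - x) < e -> ~ Q e y).
{ intros x Hx; apply NNPP; intros H; apply no; exists x; split; [exact Hx|].
  intros e He; apply NNPP; intros H'; apply H; exists e; split; [exact He|].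
  intros y Hy Hyx HQ; apply H'; exists y; auto. }
assert (Hab : a <= b).
{ destruct (ex 1 Rlt_0_1) as [x [Hx _]]; lra. }
(* Creeping along the interval: [t] belongs to [E] when a single [e] excludes [Q e] on all of
   [a, t]. At the supremum, [loc] pushes the set further, up to [b], against [ex]. *)
set (E := fun t => a <= t <= b /\ exists e, 0 < e /\ forall x, a <= x <= t -> ~ Q e x).
assert (Ea : E a).
{ destruct (loc a) as [e [He Hl]]; [lra|].
  split; [lra|]. exists e; split; [exact He|].
  intros x Hx; apply Hl; [lra|]. replace (x - a) with 0 by lra. rewrite Rabs_R0; exact He. }
destruct (completeness E) as [s [Hs1 Hs2]].
- exists b; intros t [Ht _]; lra.
- exists a; exact Ea.
- assert (Has : a <= s) by (apply Hs1; exact Ea).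
  assert (Hsb : s <= b) by (apply Hs2; intros t [Ht _]; lra).
  destruct (loc s) as [e [He Hl]]; [lra|].
  assert (Ht : exists t, E t /\ s - e < t).
  { apply NNPP; intros H.
    assert (s <= s - e); [|lra].
    apply Hs2; intros t Et. apply Rnot_lt_le; intros Hlt; apply H; exists t; auto. }
  destruct Ht as [t [[Ht [e' [He' Ht']]] Hst]].
  set (t2 := Rmin b (s + e / 2)).
  assert (Hm : 0 < Rmin e e') by (apply Rmin_glb_lt; assumption).
  assert (E2 : E t2).
  { unfold t2; split; [split; [apply Rmin_glb; lra|apply Rmin_l]|].
    exists (Rmin e e'); split; [exact Hm|].
    intros x Hx HQ.
    assert (x <= b) by (generalize (Rmin_l b (s + e / 2)); lra).
    assert (x <= s + e / 2) by (generalize (Rmin_r b (s + e / 2)); lra).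
    destruct (Rle_lt_dec x t) as [Hxt|Hxt].
    - apply (Ht' x); [lra|]. apply mono with (3 := HQ); [exact Hm|apply Rmin_r].
    - apply (Hl x); [lra| |apply mono with (3 := HQ); [exact Hm|apply Rmin_l]].
      apply Rabs_def1; lra. }
  assert (Hb2 : t2 <= s) by (apply Hs1; exact E2).
  unfold t2, Rmin in *; destruct (Rle_dec b (s + e / 2)).
  + destruct E2 as [_ [e2 [He2 H2]]].
    destruct (ex e2 He2) as [x [Hx HQ]]. exact (H2 x Hx HQ).
  + lra.
Qed.

Lemma cluster_point_2d (a b c d : R) (Q : R -> R -> R -> Prop) :
  (forall e e' x y, 0 < e -> e <= e' -> Q e x y -> Q e' x y) ->
  (forall e, 0 < e -> exists x y, a <= x <= b /\ c <= y <= d /\ Q e x y) ->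
  exists x y, a <= x <= b /\ c <= y <= d /\
    forall e, 0 < e -> exists x' y', a <= x' <= b /\ c <= y' <= d /\
      Rabs (x' - x) < e /\ Rabs (y' - y) < e /\ Q e x' y'.
Proof.
intros mono ex.
destruct (cluster_point a b (fun e x => exists y, c <= y <= d /\ Q e x y)) as [x [Hx Hx']].
- intros e e' x H0 He [y [Hy HQ]]; exists y; split; [exact Hy|exact (mono _ _ _ _ H0 He HQ)].
- intros e He; destruct (ex e He) as [x [y [Hx [Hy HQ]]]]; exists x; split; eauto.
- destruct (cluster_point c d (fun e y => exists x', a <= x' <= b /\ Rabs (x' - x) < e /\ Q e x' y))
    as [y [Hy Hy']].
  + intros e e' y H0 He [x' [Hx1 [Hx2 HQ]]]; exists x'; repeat split; try lra.
    exact (mono _ _ _ _ H0 He HQ).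
  + intros e He; destruct (Hx' e He) as [x' [H1 [H2 [y [H3 H4]]]]]; exists y; split; eauto.
  + exists x, y; split; [exact Hx|split; [exact Hy|]].
    intros e He; destruct (Hy' e He) as [y' [H1 [H2 [x' [H3 [H4 H5]]]]]].
    exists x', y'; tauto.
Qed.

Lemma min_attained_2d (a b c d : R) (D : R -> R -> Prop) (f : R -> R -> R) (x0 y0 : R) :
  (forall x y, D x y -> a <= x <= b /\ c <= y <= d) ->
  (forall x y, (forall e, 0 < e -> exists x' y', D x' y' /\ Rabs (x' - x) < e /\ Rabs (y' - y) < e)
     -> D x y) ->
  (forall x y, D x y -> continuity_2d_pt f x y) ->
  D x0 y0 ->
  exists x y, D x y /\ forall x' y', D x' y' -> f x y <= f x' y'.
Proof.
intros bnd clo cont D0.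
assert (low : exists m, forall x y, D x y -> m <= f x y).
{ apply NNPP; intros no.
  (* [- / e] tends to minus infinity as [e] tends to 0, so the cluster point would be a point of [D]
     near which [f] is unbounded below. *)
  destruct (cluster_point_2d a b c d (fun e x y => D x y /\ f x y < - / e)) as [x [y [Hx [Hy H]]]].
  - intros e e' x y H0 He [HD Hf]; split; [exact HD|].
    apply Rlt_le_trans with (1 := Hf). apply Ropp_le_contravar.
    apply Rinv_le_contravar; lra.
  - intros e He; apply NNPP; intros H; apply no; exists (- / e).
    intros x y HD; apply Rnot_lt_le; intros Hlt; apply H; exists x, y.
    destruct (bnd x y HD); auto.
  - assert (HD : D x y).
    { apply clo; intros e He; destruct (H e He) as [x' [y' H']]; exists x', y'; tauto. }
    destruct (cont x y HD (mkposreal 1 Rlt_0_1)) as [del Hdel]; simpl in Hdel.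
    set (e := Rmin del (/ (Rabs (f x y) + 1))).
    assert (Hp : 0 < Rabs (f x y) + 1) by (generalize (Rabs_pos (f x y)); lra).
    assert (He : 0 < e).
    { apply Rmin_glb_lt; [apply cond_pos|apply Rinv_0_lt_compat; exact Hp]. }
    destruct (H e He) as [x' [y' [_ [_ [H1 [H2 [_ H3]]]]]]].
    assert (Hd : e <= del) by apply Rmin_l.
    assert (Hr : e <= / (Rabs (f x y) + 1)) by apply Rmin_r.
    specialize (Hdel x' y' ltac:(lra) ltac:(lra)).
    apply Rinv_le_contravar in Hr; [|exact He]. rewrite Rinv_inv in Hr.
    apply Rabs_def2 in Hdel. generalize (Rle_abs (- f x y)); rewrite Rabs_Ropp; lra. }
destruct low as [m0 Hm0].
destruct (completeness (fun z => exists x y, D x y /\ z = - f x y)) as [s [Hs1 Hs2]].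
{ exists (- m0); intros z [x [y [HD ->]]]; generalize (Hm0 x y HD); lra. }
{ exists (- f x0 y0), x0, y0; auto. }
destruct (cluster_point_2d a b c d (fun e x y => D x y /\ - f x y > s - e)) as [x [y [Hx [Hy H]]]].
- intros e e' x y H0 He [HD Hf]; split; [exact HD|lra].
- intros e He; apply NNPP; intros H.
  assert (s <= s - e); [|lra].
  apply Hs2; intros z [x [y [HD ->]]]. apply Rnot_lt_le; intros Hlt; apply H; exists x, y.
  destruct (bnd x y HD); auto.
- assert (HD : D x y).
  { apply clo; intros e He; destruct (H e He) as [x' [y' H']]; exists x', y'; tauto. }
  exists x, y; split; [exact HD|].
  intros x' y' HD'. apply Rnot_lt_le; intros Hlt.
  assert (Hs : - f x' y' <= s) by (apply Hs1; exists x', y'; auto).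
  set (g := (f x y - f x' y') / 2).
  assert (Hg : 0 < g) by (unfold g; lra).
  destruct (cont x y HD (mkposreal g Hg)) as [del Hdel]; simpl in Hdel.
  set (e := Rmin del g).
  assert (He : 0 < e) by (apply Rmin_glb_lt; [apply cond_pos|exact Hg]).
  assert (Hd : e <= del) by apply Rmin_l.
  assert (Hr : e <= g) by apply Rmin_r.
  destruct (H e He) as [x2 [y2 [_ [_ [H1 [H2 [_ H3]]]]]]].
  specialize (Hdel x2 y2 ltac:(lra) ltac:(lra)).
  apply Rabs_def2 in Hdel. unfold g in *; lra.
Qed.

Lemma is_derive_cst (c x : R) : is_derive (fun _ => c) x 0.
Proof. exact (is_derive_const (K := R_AbsRing) (V := R_NormedModule) c x). Qed.

Lemma is_derive_neg_local (f : R -> R) (x l : R) :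
  is_derive f x l -> l < 0 ->
  exists d, 0 < d /\ forall h, 0 < h < d -> f (x + h) < f x /\ f x < f (x - h).
Proof.
intros Hf Hl. apply is_derive_Reals in Hf.
destruct (Hf (- l / 2)) as [d Hd]; [lra|].
exists d; split; [apply cond_pos|].
intros h Hh; split.
- specialize (Hd h ltac:(lra)). rewrite Rabs_pos_eq in Hd by lra.
  specialize (Hd ltac:(lra)). apply Rabs_def2 in Hd.
  assert ((f (x + h) - f x) / h < 0) by lra.
  apply Rmult_lt_compat_r with (r := h) in H; [|lra].
  unfold Rdiv in H; rewrite Rmult_assoc, Rinv_l in H; lra.
- specialize (Hd (- h) ltac:(lra)). rewrite Rabs_Ropp, Rabs_pos_eq in Hd by lra.
  specialize (Hd ltac:(lra)). apply Rabs_def2 in Hd.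
  assert ((f (x + - h) - f x) / - h < 0) by lra.
  replace ((f (x + - h) - f x) / - h) with ((f x - f (x - h)) / h) in H by (unfold Rminus; field; lra).
  apply Rmult_lt_compat_r with (r := h) in H; [|lra].
  unfold Rdiv in H; rewrite Rmult_assoc, Rinv_l in H; lra.
Qed.

Lemma is_derive_right_min (f : R -> R) (x l d : R) :
  is_derive f x l -> 0 < d -> (forall h, 0 < h < d -> f x <= f (x + h)) -> 0 <= l.
Proof.
intros Hf Hd H. apply Rnot_lt_le; intros Hl.
destruct (is_derive_neg_local f x l Hf Hl) as [d' [Hd' H']].
set (h := Rmin d d' / 2).
assert (0 < Rmin d d') by (apply Rmin_glb_lt; assumption).
generalize (Rmin_l d d') (Rmin_r d d'); intros.
destruct (H' h) as [H3 _]; [unfold h; lra|].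
specialize (H h ltac:(unfold h; lra)); lra.
Qed.

Lemma is_derive_left_min (f : R -> R) (x l d : R) :
  is_derive f x l -> 0 < d -> (forall h, 0 < h < d -> f x <= f (x - h)) -> l <= 0.
Proof.
intros Hf Hd H.
assert (Hf' : is_derive (fun t => f (- t)) (- x) (- l)).
{ replace (- l) with ((-1) * l) by ring.
  apply (is_derive_comp f Ropp (- x) l (-1)); [rewrite Ropp_involutive; exact Hf|].
  auto_derive; [exact I|ring]. }
assert (0 <= - l); [|lra].
apply (is_derive_right_min _ _ _ d Hf' Hd).
intros h Hh. rewrite Ropp_involutive. replace (- (- x + h)) with (x - h) by ring. auto.
Qed.

Lemma is_derive_local_min (f : R -> R) (x l d : R) :
  is_derive f x l -> 0 < d -> (forall h, Rabs h < d -> f x <= f (x + h)) -> l = 0.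
Proof.
intros Hf Hd H. apply Rle_antisym.
- apply (is_derive_left_min f x l d Hf Hd). intros h Hh. apply H.
  rewrite Rabs_Ropp, Rabs_pos_eq; lra.
- apply (is_derive_right_min f x l d Hf Hd). intros h Hh. apply H.
  rewrite Rabs_pos_eq; lra.
Qed.

Lemma second_derive_local_min (f f' : R -> R) (x l d : R) :
  (forall t, is_derive f t (f' t)) -> is_derive f' x l -> 0 < d ->
  (forall h, Rabs h < d -> f x <= f (x + h)) -> 0 <= l.
Proof.
intros Hf Hf' Hd H.
assert (H0 : f' x = 0) by (apply (is_derive_local_min f x _ d (Hf x) Hd H)).
apply Rnot_lt_le; intros Hl.
destruct (is_derive_neg_local f' x l Hf' Hl) as [d' [Hd' H']].
set (h := Rmin d d' / 2).
assert (0 < Rmin d d') by (apply Rmin_glb_lt; assumption).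
generalize (Rmin_l d d') (Rmin_r d d'); intros.
assert (mvt : forall u v, u <= v -> exists c, u <= c <= v /\ f v - f u = f' c * (v - u)).
{ intros u v Huv. destruct (MVT_gen f u v f') as [c [Hc Hc']].
  - intros t _; apply Hf.
  - intros t _; apply derivable_continuous_pt; exists (f' t); apply is_derive_Reals, Hf.
  - rewrite Rmin_left, Rmax_right in Hc by exact Huv. eauto. }
assert (Hn : forall c, x < c <= x + h -> f' c < 0).
{ intros c Hc. destruct (H' (c - x)) as [Hneg _]; [unfold h in *; lra|].
  replace (x + (c - x)) with c in Hneg by ring. lra. }
(* The interval is halved because the mean value point of the first half may be [x] itself, where
   [f'] is zero; the second half gives the strict decrease. *)
destruct (mvt x (x + h / 2)) as [c [Hc Ec]]; [unfold h; lra|].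
destruct (mvt (x + h / 2) (x + h)) as [c2 [Hc2 Ec2]]; [unfold h; lra|].
assert (Hh : 0 < h) by (unfold h; lra).
assert (f' c <= 0).
{ destruct (Req_dec c x) as [->|E]; [lra|]. apply Rlt_le, Hn; lra. }
assert (f' c2 < 0) by (apply Hn; lra).
specialize (H h). rewrite Rabs_pos_eq in H by lra. specialize (H ltac:(unfold h; lra)).
nra.
Qed.

(** * Functions of two variables with continuous derivatives *)

Lemma C1_line (f fq fp : R -> R -> R) (q p a b t : R) :
  (forall x y, is_derive (fun z => f z y) x (fq x y)) ->
  (forall x y, is_derive (fun z => f x z) y (fp x y)) ->
  (forall x y, continuity_2d_pt fq x y) ->
  is_derive (fun s => f (q + s * a) (p + s * b)) t
    (fq (q + t * a) (p + t * b) * a + fp (q + t * a) (p + t * b) * b).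
Proof.
intros Hq Hp Cq. apply is_derive_Reals.
apply (derivable_pt_lim_comp_2d f (fun s => q + s * a) (fun s => p + s * b)).
- apply filterdiff_differentiable_pt_lim.
  apply (is_derive_filterdiff f _ _ fq).
  + apply filter_forall; intros [u v]; apply Hq.
  + apply Hp.
  + apply continuity_2d_pt_filterlim, Cq.
- apply is_derive_Reals. auto_derive; [exact I|ring].
- apply is_derive_Reals. auto_derive; [exact I|ring].
Qed.

Lemma C1_continuity_2d (f fq fp : R -> R -> R) (q p : R) :
  (forall x y, is_derive (fun z => f z y) x (fq x y)) ->
  (forall x y, is_derive (fun z => f x z) y (fp x y)) ->
  (forall x y, continuity_2d_pt fq x y) ->
  continuity_2d_pt f q p.
Proof.
intros Hq Hp Cq. apply differentiable_continuity_pt.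
exists (fq q p), (fp q p).
apply filterdiff_differentiable_pt_lim.
apply (is_derive_filterdiff f _ _ fq).
+ apply filter_forall; intros [u v]; apply Hq.
+ apply Hp.
+ apply continuity_2d_pt_filterlim, Cq.
Qed.

(** One function [fqp] stands for both mixed derivatives. Continuity is recorded for the second
    derivatives only, because a function with continuous partial derivatives is differentiable and
    hence continuous. *)
Record is_C2 (f fq fp fqq fqp fpp : R -> R -> R) : Prop := {
  C2_q : forall q p, is_derive (fun x => f x p) q (fq q p);
  C2_p : forall q p, is_derive (fun y => f q y) p (fp q p);
  C2_qq : forall q p, is_derive (fun x => fq x p) q (fqq q p);
  C2_qp : forall q p, is_derive (fun y => fq q y) p (fqp q p);
  C2_pq : forall q p, is_derive (fun x => fp x p) q (fqp q p);
  C2_pp : forall q p, is_derive (fun y => fp q y) p (fpp q p);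
  C2_cqq : forall q p, continuity_2d_pt fqq q p;
  C2_cqp : forall q p, continuity_2d_pt fqp q p;
  C2_cpp : forall q p, continuity_2d_pt fpp q p }.

Lemma C2_cq f fq fp fqq fqp fpp :
  is_C2 f fq fp fqq fqp fpp -> forall q p, continuity_2d_pt fq q p.
Proof.
intros H q p; apply (C1_continuity_2d _ fqq fqp); intros; apply H.
Qed.

Lemma C2_cp f fq fp fqq fqp fpp :
  is_C2 f fq fp fqq fqp fpp -> forall q p, continuity_2d_pt fp q p.
Proof.
intros H q p; apply (C1_continuity_2d _ fqp fpp); intros; apply H.
Qed.

Lemma C2_c f fq fp fqq fqp fpp :
  is_C2 f fq fp fqq fqp fpp -> forall q p, continuity_2d_pt f q p.
Proof.
intros H q p; apply (C1_continuity_2d _ fq fp); intros; try apply H.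
apply (C2_cq _ _ _ _ _ _ H).
Qed.

Lemma C2_comb (c : R) f fq fp fqq fqp fpp g gq gp gqq gqp gpp :
  is_C2 f fq fp fqq fqp fpp -> is_C2 g gq gp gqq gqp gpp ->
  is_C2 (fun q p => f q p - c * g q p) (fun q p => fq q p - c * gq q p)
    (fun q p => fp q p - c * gp q p) (fun q p => fqq q p - c * gqq q p)
    (fun q p => fqp q p - c * gqp q p) (fun q p => fpp q p - c * gpp q p).
Proof.
intros Hf Hg.
assert (D : forall (u v : R -> R) x l m, is_derive u x l -> is_derive v x m ->
   is_derive (fun t => u t - c * v t) x (l - c * m)).
{ intros u v x l m Hu Hv.
  apply (is_derive_minus u (fun t => c * v t)); [exact Hu|].
  apply (is_derive_scal v x c m Hv). }
assert (C : forall (u v : R -> R -> R) x y, continuity_2d_pt u x y -> continuity_2d_pt v x y ->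
   continuity_2d_pt (fun s t => u s t - c * v s t) x y).
{ intros u v x y Hu Hv. apply continuity_2d_pt_minus; [exact Hu|].
  apply continuity_2d_pt_mult; [apply continuity_2d_pt_const|exact Hv]. }
destruct Hf, Hg; split; intros.
all: first [apply C; auto | apply (D _ _ _ _ _); auto].
Qed.

Lemma C2_prod (X X1 X2 Y Y1 Y2 : R -> R) :
  (forall t, is_derive X t (X1 t)) -> (forall t, is_derive X1 t (X2 t)) ->
  (forall t, continuity_pt X2 t) ->
  (forall t, is_derive Y t (Y1 t)) -> (forall t, is_derive Y1 t (Y2 t)) ->
  (forall t, continuity_pt Y2 t) ->
  is_C2 (fun q p => X q * Y p) (fun q p => X1 q * Y p) (fun q p => X q * Y1 p)
    (fun q p => X2 q * Y p) (fun q p => X1 q * Y1 p) (fun q p => X q * Y2 p).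
Proof.
intros HX HX1 HX2 HY HY1 HY2.
assert (Dl : forall (u : R -> R) c x l, is_derive u x l -> is_derive (fun t => u t * c) x (l * c)).
{ intros u c x l Hu. rewrite (Rmult_comm l c).
  apply is_derive_ext with (fun t => c * u t); [intros; apply Rmult_comm|].
  apply (is_derive_scal u x c l Hu). }
assert (Dr : forall (u : R -> R) c x l, is_derive u x l -> is_derive (fun t => c * u t) x (c * l)).
{ intros u c x l Hu. apply (is_derive_scal u x c l Hu). }
assert (cd : forall u u1 : R -> R, (forall t, is_derive u t (u1 t)) -> forall t, continuity_pt u t).
{ intros u u1 H t. apply derivable_continuous_pt; exists (u1 t); apply is_derive_Reals, H. }
assert (C : forall (u v : R -> R) x y, continuity_pt u x -> continuity_pt v y ->
   continuity_2d_pt (fun s t => u s * v t) x y).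
{ intros u v x y Hu Hv. apply continuity_2d_pt_mult.
  - apply (continuity_1d_2d_pt_comp u (fun s _ => s)); [exact Hu|apply continuity_2d_pt_id1].
  - apply (continuity_1d_2d_pt_comp v (fun _ s => s)); [exact Hv|apply continuity_2d_pt_id2]. }
split; intros.
- exact (Dl X _ _ _ (HX q)).
- exact (Dr Y _ _ _ (HY p)).
- exact (Dl X1 _ _ _ (HX1 q)).
- exact (Dr Y _ _ _ (HY p)).
- exact (Dl X _ _ _ (HX q)).
- exact (Dr Y1 _ _ _ (HY1 p)).
- exact (C X2 Y q p (HX2 q) (cd Y Y1 HY p)).
- exact (C X1 Y1 q p (cd X1 X2 HX1 q) (cd Y1 Y2 HY1 p)).
- exact (C X Y2 q p (cd X X1 HX q) (HY2 p)).
Qed.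

(** Along every line through a minimum the second derivative is nonnegative, so the Hessian is
    positive semidefinite, and the trace of its product with a positive semidefinite matrix is
    nonnegative. *)
Lemma local_min_2d (u uq up uqq uqp upp : R -> R -> R) (q p d a11 a12 a22 : R) :
  is_C2 u uq up uqq uqp upp -> 0 < d ->
  (forall x y, Rabs (x - q) < d -> Rabs (y - p) < d -> u q p <= u x y) ->
  0 < a22 -> a12 * a12 <= a11 * a22 ->
  uq q p = 0 /\ up q p = 0 /\
  0 <= a11 * uqq q p + 2 * a12 * uqp q p + a22 * upp q p.
Proof.
intros Hu Hd Hmin H22 Hdet.
assert (dir : forall a b, 0 <= uqq q p * a * a + 2 * uqp q p * a * b + upp q p * b * b).
{ intros a b.
  assert (M : 0 < 1 + Rabs a + Rabs b).
  { generalize (Rabs_pos a) (Rabs_pos b); lra. }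
  assert (E0 : forall f : R -> R -> R, f (q + 0 * a) (p + 0 * b) = f q p).
  { intros f; f_equal; ring. }
  replace (uqq q p * a * a + 2 * uqp q p * a * b + upp q p * b * b)
    with ((uqq (q + 0 * a) (p + 0 * b) * a + uqp (q + 0 * a) (p + 0 * b) * b) * a
        + (uqp (q + 0 * a) (p + 0 * b) * a + upp (q + 0 * a) (p + 0 * b) * b) * b)
    by (rewrite (E0 uqq), (E0 uqp), (E0 upp); ring).
  apply (second_derive_local_min (fun s => u (q + s * a) (p + s * b))
     (fun s => uq (q + s * a) (p + s * b) * a + up (q + s * a) (p + s * b) * b) 0 _
     (d / (1 + Rabs a + Rabs b))).
  - intros t. apply C1_line; try apply Hu. apply (C2_cq _ _ _ _ _ _ Hu).
  - apply (is_derive_plus (fun s => uq (q + s * a) (p + s * b) * a)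
       (fun s => up (q + s * a) (p + s * b) * b) 0).
    + rewrite Rmult_comm.
      apply is_derive_ext with (fun s => a * uq (q + s * a) (p + s * b)); [intros; apply Rmult_comm|].
      apply (is_derive_scal (fun s => uq (q + s * a) (p + s * b)) 0 a).
      apply C1_line; apply Hu.
    + rewrite Rmult_comm.
      apply is_derive_ext with (fun s => b * up (q + s * a) (p + s * b)); [intros; apply Rmult_comm|].
      apply (is_derive_scal (fun s => up (q + s * a) (p + s * b)) 0 b).
      apply C1_line; apply Hu.
  - apply Rdiv_lt_0_compat; assumption.
  - intros h Hh. rewrite E0.
    assert (Hh' : Rabs h * (1 + Rabs a + Rabs b) < d).
    { apply Rmult_lt_compat_r with (r := 1 + Rabs a + Rabs b) in Hh; [|exact M].
      unfold Rdiv in Hh; rewrite Rmult_assoc, Rinv_l in Hh; lra. }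
    generalize (Rabs_pos h) (Rabs_pos a) (Rabs_pos b); intros.
    apply Hmin.
    + replace (q + (0 + h) * a - q) with (h * a) by ring. rewrite Rabs_mult; nra.
    + replace (p + (0 + h) * b - p) with (h * b) by ring. rewrite Rabs_mult; nra. }
split; [|split].
- apply (is_derive_local_min (fun x => u x p) q _ d); [apply Hu|exact Hd|].
  intros h Hh. apply Hmin; [replace (q + h - q) with h by ring; exact Hh|].
  replace (p - p) with 0 by ring. rewrite Rabs_R0; exact Hd.
- apply (is_derive_local_min (fun y => u q y) p _ d); [apply Hu|exact Hd|].
  intros h Hh. apply Hmin; [|replace (p + h - p) with h by ring; exact Hh].
  replace (q - q) with 0 by ring. rewrite Rabs_R0; exact Hd.
(* Completing the square: [a22] times the operator is the Hessian form in the direction [(a12, a22)]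
   plus the determinant times [uqq]. *)
- assert (E : a11 * uqq q p + 2 * a12 * uqp q p + a22 * upp q p =
     ((a11 * a22 - a12 * a12) * uqq q p +
      (uqq q p * a12 * a12 + 2 * uqp q p * a12 * a22 + upp q p * a22 * a22)) / a22)
    by (field; lra).
  rewrite E. apply Rdiv_le_0_compat; [|exact H22].
  generalize (dir a12 a22) (dir 1 0); intros D1 D2.
  assert (0 <= uqq q p) by lra.
  assert (0 <= (a11 * a22 - a12 * a12) * uqq q p) by (apply Rmult_le_pos; lra).
  lra.
Qed.

(** * Maximum principles *)

(** Boundary values and the differential inequality are merged into one hypothesis: a point of [D]
    with [u < m] has to be interior, with a strictly negative operator. The coefficients may vary
    arbitrarily with the point, since only the minimum point is inspected. *)
Lemma weak_minimum_principle (a b c d m : R) (D : R -> R -> Prop)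
  (u uq up uqq uqp upp : R -> R -> R) :
  is_C2 u uq up uqq uqp upp ->
  (forall x y, D x y -> a <= x <= b /\ c <= y <= d) ->
  (forall x y, (forall e, 0 < e -> exists x' y', D x' y' /\ Rabs (x' - x) < e /\ Rabs (y' - y) < e)
     -> D x y) ->
  (forall x y, D x y -> u x y < m ->
     exists e a11 a12 a22 b1 b2, 0 < e /\
       (forall x' y', Rabs (x' - x) < e -> Rabs (y' - y) < e -> D x' y') /\
       0 < a22 /\ a12 * a12 <= a11 * a22 /\
       a11 * uqq x y + 2 * a12 * uqp x y + a22 * upp x y + b1 * uq x y + b2 * up x y < 0) ->
  forall x y, D x y -> m <= u x y.
Proof.
intros Hu bnd clo H x y Hxy.
destruct (min_attained_2d a b c d D u x y bnd clo) as [x0 [y0 [H0 Hmin]]].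
- intros; apply (C2_c _ _ _ _ _ _ Hu).
- exact Hxy.
- apply Rnot_lt_le; intros Hlt.
  destruct (H x0 y0 H0) as [e [a11 [a12 [a22 [b1 [b2 [He [Hin [H22 [Hdet HL]]]]]]]]]].
  { specialize (Hmin x y Hxy); lra. }
  destruct (local_min_2d u uq up uqq uqp upp x0 y0 e a11 a12 a22 Hu He) as [E1 [E2 E3]]; auto.
  rewrite E1, E2 in HL; lra.
Qed.

(* [A] bounds the mixed coefficient separately: the corner lemma needs it to vanish at the
   corner. *)
Definition supersolution (c0 K A : R) (vq vp vqq vqp vpp : R) : Prop :=
  exists a11 a12 a22 b1 b2,
    c0 <= a11 /\ c0 <= a22 /\ a12 * a12 <= (a11 - c0) * (a22 - c0) /\
    a11 <= K /\ a22 <= K /\ Rabs a12 <= A /\ Rabs b1 <= K /\ Rabs b2 <= K /\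
    a11 * vqq + 2 * a12 * vqp + a22 * vpp + b1 * vq + b2 * vp <= 0.

(** * Barriers on balls, the strong minimum principle and Hopf's lemma *)

Definition dist2 (q0 p0 q p : R) : R := (q - q0)^2 + (p - p0)^2.

Lemma dist2_pos (q0 p0 q p : R) : 0 <= dist2 q0 p0 q p.
Proof. apply Rplus_le_le_0_compat; apply pow2_ge_0. Qed.

Lemma dist2_closed (q0 p0 s1 s2 q p : R) :
  (forall e, 0 < e -> exists q' p', (s1 <= dist2 q0 p0 q' p' <= s2) /\
     Rabs (q' - q) < e /\ Rabs (p' - p) < e) ->
  s1 <= dist2 q0 p0 q p <= s2.
Proof.
intros H.
assert (C : continuity_2d_pt (dist2 q0 p0) q p).
{ unfold dist2.
  apply (continuity_2d_pt_plus (fun u _ => (u - q0)^2) (fun _ v => (v - p0)^2)).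
  - apply (continuity_1d_2d_pt_comp (fun t => (t - q0)^2) (fun u _ => u)).
    + apply derivable_continuous_pt; exists (2 * (q - q0)); apply is_derive_Reals; auto_derive; [exact I|ring].
    + apply continuity_2d_pt_id1.
  - apply (continuity_1d_2d_pt_comp (fun t => (t - p0)^2) (fun _ u => u)).
    + apply derivable_continuous_pt; exists (2 * (p - p0)); apply is_derive_Reals; auto_derive; [exact I|ring].
    + apply continuity_2d_pt_id2. }
split; apply Rnot_lt_le; intros Hlt.
- assert (Hg : 0 < s1 - dist2 q0 p0 q p) by lra.
  destruct (C (mkposreal _ Hg)) as [del Hdel]; simpl in Hdel.
  destruct (H del (cond_pos del)) as [q' [p' [H1 [H2 H3]]]].
  specialize (Hdel q' p' H2 H3). apply Rabs_def2 in Hdel; lra.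
- assert (Hg : 0 < dist2 q0 p0 q p - s2) by lra.
  destruct (C (mkposreal _ Hg)) as [del Hdel]; simpl in Hdel.
  destruct (H del (cond_pos del)) as [q' [p' [H1 [H2 H3]]]].
  specialize (Hdel q' p' H2 H3). apply Rabs_def2 in Hdel; lra.
Qed.

Lemma dist2_open (q0 p0 q p s1 s2 : R) : s1 < dist2 q0 p0 q p < s2 ->
  exists e, 0 < e /\ forall q' p', Rabs (q' - q) < e -> Rabs (p' - p) < e ->
    s1 < dist2 q0 p0 q' p' < s2.
Proof.
intros H.
set (B := 2 * (Rabs (q - q0) + Rabs (p - p0)) + 2).
assert (HB : 2 <= B) by (unfold B; generalize (Rabs_pos (q - q0)) (Rabs_pos (p - p0)); lra).
set (g := Rmin (dist2 q0 p0 q p - s1) (s2 - dist2 q0 p0 q p)).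
assert (Hg : 0 < g) by (apply Rmin_glb_lt; lra).
assert (Hg1 : g <= dist2 q0 p0 q p - s1) by apply Rmin_l.
assert (Hg2 : g <= s2 - dist2 q0 p0 q p) by apply Rmin_r.
set (e := Rmin 1 (g / B)).
assert (He : 0 < e) by (apply Rmin_glb_lt; [lra|apply Rdiv_lt_0_compat; lra]).
assert (He1 : e <= 1) by apply Rmin_l.
assert (HeB : e * B <= g).
{ assert (e <= g / B) by apply Rmin_r.
  apply Rmult_le_compat_r with (r := B) in H0; [|lra].
  unfold Rdiv in H0; rewrite Rmult_assoc, Rinv_l in H0; lra. }
exists e; split; [exact He|].
intros q' p' Hq Hp.
assert (E : dist2 q0 p0 q' p' - dist2 q0 p0 q p =
   (q' - q) * (2 * (q - q0) + (q' - q)) + (p' - p) * (2 * (p - p0) + (p' - p)))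
  by (unfold dist2; ring).
assert (Habs : Rabs (dist2 q0 p0 q' p' - dist2 q0 p0 q p) < g).
{ rewrite E. apply Rle_lt_trans with (1 := Rabs_triang _ _). rewrite 2!Rabs_mult.
  assert (T1 := Rabs_triang (2 * (q - q0)) (q' - q)).
  assert (T2 := Rabs_triang (2 * (p - p0)) (p' - p)).
  rewrite Rabs_mult, (Rabs_pos_eq 2) in T1, T2 by lra.
  unfold B in *.
  generalize (Rabs_pos (q - q0)) (Rabs_pos (p - p0)) (Rabs_pos (q' - q)) (Rabs_pos (p' - p))
    (Rabs_pos (2 * (q - q0) + (q' - q))) (Rabs_pos (2 * (p - p0) + (p' - p))).
  intros.
  set (A1 := Rabs (q - q0)) in *. set (A2 := Rabs (p - p0)) in *.
  set (B1 := Rabs (q' - q)) in *. set (B2 := Rabs (p' - p)) in *.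
  apply Rle_lt_trans with (B1 * (2 * A1 + 1) + B2 * (2 * A2 + 1)).
  - apply Rplus_le_compat; apply Rmult_le_compat_l; lra.
  - apply Rlt_le_trans with (2 := HeB).
    assert (B1 * (2 * A1 + 1) < e * (2 * A1 + 1)) by (apply Rmult_lt_compat_r; lra).
    assert (B2 * (2 * A2 + 1) < e * (2 * A2 + 1)) by (apply Rmult_lt_compat_r; lra).
    lra. }
apply Rabs_def2 in Habs; lra.
Qed.

Lemma dist2_bound (q0 p0 q p r : R) : 0 <= r -> dist2 q0 p0 q p <= r^2 ->
  Rabs (q - q0) <= r /\ Rabs (p - p0) <= r.
Proof.
unfold dist2; intros Hr H.
assert (0 <= (q - q0)^2) by apply pow2_ge_0. assert (0 <= (p - p0)^2) by apply pow2_ge_0.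
split; apply Rabs_le; split; apply Rnot_lt_le; intros Hlt; nra.
Qed.

(** Hopf's barrier: a Gaussian with a large exponent is a strict subsolution away from its centre.
    The bound on the annulus yields both positivity inside the ball and a nonzero slope at a zero on
    its boundary. *)
Lemma ball_barrier (c0 K q0 p0 r0 r : R) (A : R -> R -> R) (v vq vp vqq vqp vpp : R -> R -> R) :
  0 < c0 -> 0 < K -> 0 < r0 < r -> is_C2 v vq vp vqq vqp vpp ->
  (forall q p, dist2 q0 p0 q p <= r^2 -> 0 <= v q p) ->
  (forall q p, dist2 q0 p0 q p <= r0^2 -> 0 < v q p) ->
  (forall q p, dist2 q0 p0 q p < r^2 ->
     supersolution c0 K (A q p) (vq q p) (vp q p) (vqq q p) (vqp q p) (vpp q p)) ->
  exists k a, 0 < k /\ 0 < a /\ forall q p, r0^2 <= dist2 q0 p0 q p <= r^2 ->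
    k * (exp (- a * dist2 q0 p0 q p) - exp (- a * r^2)) <= v q p.
Proof.
intros Hc0 HK Hr Hv Hv0 Hvin Hsup.
(* Up to the Gaussian factor, the second-order term on the annulus is at least
   [4 * a * (a * (c0 * r0^2))] by ellipticity, while the trace and first-order terms are at most
   [4 * a * K * (1 + r)]; this [a] makes the former larger. *)
set (a := (K * (1 + r) + 1) / (c0 * r0^2)).
assert (Hr02 : 0 < r0^2) by nra.
assert (Hcr : 0 < c0 * r0^2) by (apply Rmult_lt_0_compat; assumption).
assert (Ha : 0 < a) by (unfold a; apply Rdiv_lt_0_compat; nra).
assert (Ea : a * (c0 * r0^2) = K * (1 + r) + 1) by (unfold a; field; lra).
(* The lower bound [-1] is vacuous; it lets [dist2_closed] serve for the disk as well as for the
   annulus. *)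
destruct (min_attained_2d (q0 - r0) (q0 + r0) (p0 - r0) (p0 + r0)
   (fun q p => -1 <= dist2 q0 p0 q p <= r0^2) v q0 p0) as [qm [pm [Hm Hmin]]].
{ intros q p Hd. destruct (dist2_bound q0 p0 q p r0) as [B1 B2]; try lra.
  apply Rabs_le_between in B1, B2; lra. }
{ intros q p H. apply (dist2_closed q0 p0 (-1) (r0^2) q p H). }
{ intros; apply (C2_c _ _ _ _ _ _ Hv). }
{ unfold dist2; rewrite !Rminus_diag; split; nra. }
set (k := v qm pm).
assert (Hk : 0 < k) by (apply Hvin; lra).
exists k, a; split; [exact Hk|split; [exact Ha|]].
(* The Gaussian is a product of functions of one variable, so [C2_prod] supplies its derivatives. *)
set (X := fun c t => exp (- a * (t - c)^2)).
set (X1 := fun c t => - 2 * a * (t - c) * exp (- a * (t - c)^2)).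
set (X2 := fun c t => (4 * a * a * (t - c)^2 - 2 * a) * exp (- a * (t - c)^2)).
assert (DX : forall c t, is_derive (X c) t (X1 c t)).
{ intros c t; unfold X, X1; auto_derive; [exact I|unfold Rminus; simpl; ring]. }
assert (DX1 : forall c t, is_derive (X1 c) t (X2 c t)).
{ intros c t; unfold X1, X2; auto_derive; [exact I|unfold Rminus; simpl; ring]. }
assert (CX2 : forall c t, continuity_pt (X2 c) t).
{ intros c t. apply derivable_continuous_pt, ex_derive_Reals_0. unfold X2; auto_derive; exact I. }
assert (Hb := C2_prod (X q0) (X1 q0) (X2 q0) (X p0) (X1 p0) (X2 p0)
   (DX q0) (DX1 q0) (CX2 q0) (DX p0) (DX1 p0) (CX2 p0)).
assert (EX : forall q p, X q0 q * X p0 p = exp (- a * dist2 q0 p0 q p)).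
{ intros q p; unfold X; rewrite <- exp_plus; f_equal; unfold dist2; ring. }
assert (Hu := C2_comb k _ _ _ _ _ _ _ _ _ _ _ _ Hv Hb).
cut (forall q p, r0^2 <= dist2 q0 p0 q p <= r^2 ->
   - k * exp (- a * r^2) <= v q p - k * (X q0 q * X p0 p)).
{ intros H q p Hd; specialize (H q p Hd); rewrite EX in H; lra. }
apply (weak_minimum_principle (q0 - r) (q0 + r) (p0 - r) (p0 + r) _ _ _ _ _ _ _ _ Hu).
{ intros q p Hd. destruct (dist2_bound q0 p0 q p r) as [B1 B2]; try lra.
  apply Rabs_le_between in B1, B2; lra. }
{ intros q p H. apply (dist2_closed q0 p0 _ _ q p H). }
intros q p Hd Hneg. rewrite EX in Hneg.
(* Neither circle carries a value below the threshold: [k] is the minimum of [v] on the inner disk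
   and the Gaussian is at most 1, while [v] is nonnegative on the outer circle. *)
assert (Hd' : r0^2 < dist2 q0 p0 q p < r^2).
{ split; apply Rnot_le_lt; intros Hle.
  - assert (k <= v q p) by (apply Hmin; split; [generalize (dist2_pos q0 p0 q p); lra|exact Hle]).
    assert (exp (- a * dist2 q0 p0 q p) <= 1).
    { rewrite <- exp_0. assert (Hp := dist2_pos q0 p0 q p).
      destruct (Req_dec (dist2 q0 p0 q p) 0) as [->|Hne]; [right; f_equal; ring|].
      left; apply exp_increasing. nra. }
    assert (0 < exp (- a * r^2)) by apply exp_pos. nra.
  - replace (dist2 q0 p0 q p) with (r^2) in Hneg by lra.
    assert (0 <= v q p) by (apply Hv0; lra). lra. }
destruct (dist2_open _ _ _ _ _ _ Hd') as [e [He Hin]].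
destruct (Hsup q p ltac:(lra)) as [a11 [a12 [a22 [b1 [b2 [H1 [H2 [H3 [H4 [H5 [H6 [H7 [H8 H9]]]]]]]]]]]]].
exists e, a11, a12, a22, b1, b2. split; [exact He|].
split; [intros q' p' Hq Hp; specialize (Hin q' p' Hq Hp); lra|].
split; [lra|]. split; [nra|].
destruct (dist2_bound q0 p0 q p r) as [B1 B2]; try lra.
set (xi := q - q0) in *. set (eta := p - p0) in *.
assert (HL : 0 < X q0 q * X p0 p * (4 * a * a * (a11 * xi^2 + 2 * a12 * xi * eta + a22 * eta^2)
     - 2 * a * (a11 + a22) - 2 * a * (b1 * xi + b2 * eta))).
{ apply Rmult_lt_0_compat; [apply Rmult_lt_0_compat; apply exp_pos|].
  (* Ellipticity: the conditions in [supersolution] say that the coefficient matrix minus [c0] times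
     the identity is positive semidefinite. *)
  assert (Q : c0 * (xi^2 + eta^2) <= a11 * xi^2 + 2 * a12 * xi * eta + a22 * eta^2).
  { assert (0 <= (a11 - c0) * xi^2 + 2 * a12 * xi * eta + (a22 - c0) * eta^2); [|lra].
    destruct (Req_dec (a11 - c0) 0) as [E|E].
    - assert (a12 = 0) by nra. subst a12. nra.
    - assert (0 < a11 - c0) by lra.
      assert (0 <= ((a11 - c0) * xi + a12 * eta)^2 + ((a11 - c0) * (a22 - c0) - a12 * a12) * eta^2).
      { apply Rplus_le_le_0_compat; [apply pow2_ge_0|]. apply Rmult_le_pos; [lra|apply pow2_ge_0]. }
      apply Rmult_le_reg_l with (a11 - c0); [lra|]. rewrite Rmult_0_r.
      replace ((a11 - c0) * ((a11 - c0) * xi ^ 2 + 2 * a12 * xi * eta + (a22 - c0) * eta ^ 2))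
       with (((a11 - c0) * xi + a12 * eta) ^ 2 + ((a11 - c0) * (a22 - c0) - a12 * a12) * eta ^ 2) by ring.
      exact H0. }
  assert (Hd2 : r0^2 <= xi^2 + eta^2) by (unfold dist2 in Hd'; unfold xi, eta; lra).
  assert (Q2 : K * (1 + r) + 1 <= a * (a11 * xi^2 + 2 * a12 * xi * eta + a22 * eta^2)).
  { rewrite <- Ea. apply Rmult_le_compat_l; [lra|].
    apply Rle_trans with (2 := Q). apply Rmult_le_compat_l; lra. }
  assert (Bd : forall b z, Rabs b <= K -> Rabs z <= r -> b * z <= K * r).
  { intros b z Hb1 Hz. apply Rle_trans with (1 := Rle_abs _). rewrite Rabs_mult.
    apply Rmult_le_compat; auto using Rabs_pos. }
  assert (B3 := Bd b1 xi H7 B1). assert (B4 := Bd b2 eta H8 B2).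
  assert (0 < a * (4 * (a * (a11 * xi^2 + 2 * a12 * xi * eta + a22 * eta^2))
    - 2 * (a11 + a22) - 2 * (b1 * xi + b2 * eta))); [|lra].
  apply Rmult_lt_0_compat; lra. }
unfold X, X1, X2 in HL |- *. fold xi eta in HL |- *.
set (E1 := exp (- a * xi^2)) in *. set (E2 := exp (- a * eta^2)) in *.
match type of HL with 0 < ?l => assert (0 < k * l) by (apply Rmult_lt_0_compat; assumption) end.
lra.
Qed.

Lemma positivity_ball (c0 K q0 p0 r : R) (A : R -> R -> R) (v vq vp vqq vqp vpp : R -> R -> R) :
  0 < c0 -> 0 < K -> 0 < r -> is_C2 v vq vp vqq vqp vpp ->
  (forall q p, dist2 q0 p0 q p <= r^2 -> 0 <= v q p) ->
  0 < v q0 p0 ->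
  (forall q p, dist2 q0 p0 q p < r^2 ->
     supersolution c0 K (A q p) (vq q p) (vp q p) (vqq q p) (vqp q p) (vpp q p)) ->
  forall q p, dist2 q0 p0 q p < r^2 -> 0 < v q p.
Proof.
intros Hc0 HK Hr Hv Hv0 Hpos Hsup q p Hd.
destruct (C2_c _ _ _ _ _ _ Hv q0 p0 (mkposreal _ Hpos)) as [del Hdel]; simpl in Hdel.
set (r0 := Rmin (del / 2) (r / 2)).
assert (Hr0 : 0 < r0) by (apply Rmin_glb_lt; [generalize (cond_pos del)|]; lra).
assert (Hr1 : r0 <= del / 2) by apply Rmin_l.
assert (Hr2 : r0 <= r / 2) by apply Rmin_r.
assert (Hin : forall q p, dist2 q0 p0 q p <= r0^2 -> 0 < v q p).
{ intros q' p' H. destruct (dist2_bound _ _ _ _ r0 ltac:(lra) H) as [B1 B2].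
  specialize (Hdel q' p' ltac:(generalize (cond_pos del); lra) ltac:(generalize (cond_pos del); lra)).
  apply Rabs_def2 in Hdel; lra. }
destruct (Rle_lt_dec (dist2 q0 p0 q p) (r0^2)) as [H|H]; [auto|].
destruct (ball_barrier c0 K q0 p0 r0 r A v vq vp vqq vqp vpp) as [k [a [Hk [Ha Hb]]]]; auto; [lra|].
apply Rlt_le_trans with (2 := Hb q p ltac:(lra)).
apply Rmult_lt_0_compat; [exact Hk|].
apply Rlt_0_minus, exp_increasing. nra.
Qed.

(** Along the radius [v] lies above the barrier, and both vanish at the end point, so the outward
    slope of [v] is at most that of the barrier, which is negative. *)
Lemma hopf_ball (c0 K q0 p0 r n1 n2 : R) (A : R -> R -> R) (v vq vp vqq vqp vpp : R -> R -> R) :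
  0 < c0 -> 0 < K -> 0 < r -> is_C2 v vq vp vqq vqp vpp ->
  (forall q p, dist2 q0 p0 q p <= r^2 -> 0 <= v q p) ->
  0 < v q0 p0 ->
  (forall q p, dist2 q0 p0 q p < r^2 ->
     supersolution c0 K (A q p) (vq q p) (vp q p) (vqq q p) (vqp q p) (vpp q p)) ->
  n1^2 + n2^2 = 1 -> v (q0 + r * n1) (p0 + r * n2) = 0 ->
  vq (q0 + r * n1) (p0 + r * n2) * n1 + vp (q0 + r * n1) (p0 + r * n2) * n2 < 0.
Proof.
intros Hc0 HK Hr Hv Hv0 Hpos Hsup Hn Hz.
destruct (ball_barrier c0 K q0 p0 (r / 2) r A v vq vp vqq vqp vpp) as [k [a [Hk [Ha Hb]]]]; auto; [lra| |].
{ intros q p H. apply (positivity_ball c0 K q0 p0 r A v vq vp vqq vqp vpp); auto. nra. }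
set (f := fun t => v (q0 + t * n1) (p0 + t * n2) - k * (exp (- a * t^2) - exp (- a * r^2))).
assert (Df : is_derive f r ((vq (q0 + r * n1) (p0 + r * n2) * n1 + vp (q0 + r * n1) (p0 + r * n2) * n2)
    - k * (- 2 * a * r * exp (- a * r^2)))).
{ apply (is_derive_minus (fun t => v (q0 + t * n1) (p0 + t * n2))
     (fun t => k * (exp (- a * t^2) - exp (- a * r^2)))).
  - apply C1_line; try apply Hv. apply (C2_cq _ _ _ _ _ _ Hv).
  - auto_derive; [exact I|simpl; ring]. }
assert (Hneg := is_derive_left_min f r _ (r / 2) Df).
assert (E : f r = 0) by (unfold f; rewrite Hz; ring).
assert (0 < k * (2 * a * r * exp (- a * r^2))).
{ repeat apply Rmult_lt_0_compat; try lra. apply exp_pos. }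
assert (vq (q0 + r * n1) (p0 + r * n2) * n1 + vp (q0 + r * n1) (p0 + r * n2) * n2
    - k * (- 2 * a * r * exp (- a * r^2)) <= 0); [|lra].
apply Hneg; [lra|].
intros h Hh. rewrite E. unfold f.
assert (Ed : dist2 q0 p0 (q0 + (r - h) * n1) (p0 + (r - h) * n2) = (r - h)^2).
{ unfold dist2. replace ((q0 + (r - h) * n1 - q0) ^ 2 + (p0 + (r - h) * n2 - p0) ^ 2)
   with ((r - h)^2 * (n1^2 + n2^2)) by ring. rewrite Hn; ring. }
specialize (Hb (q0 + (r - h) * n1) (p0 + (r - h) * n2)). rewrite Ed in Hb.
assert (r / 2 <= r - h) by lra.
specialize (Hb ltac:(split; nra)). lra.
Qed.

(* Along the segment the distance to the boundary of a convex set is bounded below, so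
   positivity propagates by finitely many balls. *)
Lemma strong_minimum_half_strip (c0 K l : R) (A : R -> R -> R) (v vq vp vqq vqp vpp : R -> R -> R) :
  0 < c0 -> 0 < K -> is_C2 v vq vp vqq vqp vpp ->
  (forall q p, q < l -> -1 < p < 0 -> 0 <= v q p /\
     supersolution c0 K (A q p) (vq q p) (vp q p) (vqq q p) (vqp q p) (vpp q p)) ->
  (exists q p, q < l /\ -1 < p < 0 /\ 0 < v q p) ->
  forall q p, q < l -> -1 < p < 0 -> 0 < v q p.
Proof.
intros Hc0 HK Hv H [q1 [p1 [Hq1 [Hp1 Hv1]]]] q p Hq Hp.
set (d := Rmin (Rmin (l - q1) (l - q)) (Rmin (Rmin (p1 + 1) (p + 1)) (Rmin (- p1) (- p)))).
assert (Hd : 0 < d) by (unfold d; repeat apply Rmin_glb_lt; lra).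
assert (d1 : d <= l - q1) by (eapply Rle_trans; [apply Rmin_l|apply Rmin_l]).
assert (d2 : d <= l - q) by (eapply Rle_trans; [apply Rmin_l|apply Rmin_r]).
assert (d3 : d <= p1 + 1).
{ eapply Rle_trans; [apply Rmin_r|]. eapply Rle_trans; apply Rmin_l. }
assert (d4 : d <= p + 1).
{ eapply Rle_trans; [apply Rmin_r|]. eapply Rle_trans; [apply Rmin_l|apply Rmin_r]. }
assert (d5 : d <= - p1).
{ eapply Rle_trans; [apply Rmin_r|]. eapply Rle_trans; [apply Rmin_r|apply Rmin_l]. }
assert (d6 : d <= - p).
{ eapply Rle_trans; [apply Rmin_r|]. eapply Rle_trans; [apply Rmin_r|apply Rmin_r]. }
clearbody d.
set (D := Rabs (q - q1) + Rabs (p - p1) + 1).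
assert (HD : 1 <= D) by (unfold D; generalize (Rabs_pos (q - q1)) (Rabs_pos (p - p1)); lra).
(* Balls of radius [d / 2] around points of the segment stay in the half strip. With [N] steps each
   coordinate moves by less than [d / 4] at a time, so every centre lies in the previous ball. *)
destruct (archimed_cor1 (d / (4 * D))) as [N [HN1 HN2]]; [apply Rdiv_lt_0_compat; lra|].
assert (HN : 0 < INR N) by (apply lt_0_INR; exact HN2).
assert (step : / INR N * D < d / 4).
{ apply Rmult_lt_compat_r with (r := D) in HN1; [|lra].
  replace (d / (4 * D) * D) with (d / 4) in HN1 by (field; lra). exact HN1. }
assert (ind : forall n, (n <= N)%nat ->
  0 < v (q1 + INR n / INR N * (q - q1)) (p1 + INR n / INR N * (p - p1))).
{ induction n as [|n IH]; intros Hn.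
  - simpl. unfold Rdiv; rewrite !Rmult_0_l, !Rplus_0_r; exact Hv1.
  - set (s := INR n / INR N) in *.
    assert (Hs : 0 <= s <= 1).
    { unfold s; split; [apply Rdiv_le_0_compat; [apply pos_INR|exact HN]|].
      apply Rmult_le_reg_r with (INR N); [exact HN|].
      unfold Rdiv; rewrite Rmult_assoc, Rinv_l by lra.
      rewrite Rmult_1_r, Rmult_1_l. apply le_INR; lia. }
    assert (Es : INR (S n) / INR N = s + / INR N) by (unfold s; rewrite S_INR; field; lra).
    rewrite Es.
    set (qs := q1 + s * (q - q1)) in *. set (ps := p1 + s * (p - p1)) in *.
    assert (B1 : qs <= l - d) by (unfold qs; nra).
    assert (B2 : -1 + d <= ps <= - d) by (unfold ps; split; nra).
    apply (positivity_ball c0 K qs ps (d / 2) A v vq vp vqq vqp vpp); auto; try lra.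
    + intros x y Hxy. destruct (dist2_bound _ _ _ _ (d / 2) ltac:(lra) Hxy) as [C1 C2].
      apply Rabs_le_between in C1, C2. apply H; lra.
    + apply IH; lia.
    + intros x y Hxy. destruct (dist2_bound _ _ _ _ (d / 2) ltac:(lra) (Rlt_le _ _ Hxy)) as [C1 C2].
      apply Rabs_le_between in C1, C2. apply H; lra.
    + unfold dist2.
      replace (q1 + (s + / INR N) * (q - q1) - qs) with (/ INR N * (q - q1)) by (unfold qs; ring).
      replace (p1 + (s + / INR N) * (p - p1) - ps) with (/ INR N * (p - p1)) by (unfold ps; ring).
      assert (T : forall z, Rabs z <= D -> (/ INR N * z)^2 <= (d / 4)^2).
      { intros z Hz. apply pow_maj_Rabs. rewrite Rabs_mult.
        rewrite Rabs_pos_eq by (left; apply Rinv_0_lt_compat; exact HN).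
        apply Rle_trans with (/ INR N * D); [|lra].
        apply Rmult_le_compat_l; [left; apply Rinv_0_lt_compat; exact HN|exact Hz]. }
      assert (T1 := T (q - q1) ltac:(unfold D; generalize (Rabs_pos (p - p1)); lra)).
      assert (T2 := T (p - p1) ltac:(unfold D; generalize (Rabs_pos (q - q1)); lra)).
      nra. }
specialize (ind N (Nat.le_refl N)).
replace (INR N / INR N) with 1 in ind by (field; lra).
replace (q1 + 1 * (q - q1)) with q in ind by ring.
replace (p1 + 1 * (p - p1)) with p in ind by ring.
exact ind.
Qed.

(** * Serrin's corner lemma *)

Lemma lower_linear_bound (f : R -> R) (r l : R) :
  0 < r -> is_derive f 0 l -> (forall x, continuity_pt f x) ->
  (forall x, 0 < x <= r -> 0 < f x) -> 0 < f 0 \/ (f 0 = 0 /\ 0 < l) ->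
  exists k, 0 < k /\ forall x, 0 <= x <= r -> k * x <= f x.
Proof.
intros Hr Df Cf Hf H0.
(* Near 0 the bound comes from continuity or from half the slope; on the rest of the interval it
   comes from a positive minimum. Both alternatives occur on the sides of a corner: [f 0 > 0] at the
   surface, a Hopf slope at the axis and at the bottom. *)
assert (near : exists k d, 0 < k /\ 0 < d /\ forall x, 0 <= x < d -> k * x <= f x).
{ destruct H0 as [H0|[H0 Hl]].
  - destruct (Cf 0 (f 0 / 2) ltac:(lra)) as [d [Hd Hd']].
    exists (f 0 / 2 / (d + 1)), (Rmin d 1).
    assert (0 < f 0 / 2 / (d + 1)) by (apply Rdiv_lt_0_compat; lra).
    split; [assumption|split; [apply Rmin_glb_lt; lra|]].
    intros x Hx. generalize (Rmin_l d 1) (Rmin_r d 1); intros M1 M2.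
    assert (f 0 / 2 < f x).
    { destruct (Req_dec x 0) as [->|Hx0]; [lra|].
      specialize (Hd' x). unfold D_x, no_cond, Rdist in Hd'; simpl in Hd'.
      unfold Rdist in Hd'. specialize (Hd' ltac:(split; [split; [exact I|auto]|rewrite Rminus_0_r, Rabs_pos_eq; lra])).
      apply Rabs_def2 in Hd'; lra. }
    apply Rle_trans with (f 0 / 2); [|lra].
    replace (f 0 / 2 / (d + 1) * x) with (f 0 / 2 * (x / (d + 1))) by (field; lra).
    assert (x / (d + 1) <= 1).
    { apply Rmult_le_reg_r with (d + 1); [lra|]. unfold Rdiv; rewrite Rmult_assoc, Rinv_l; lra. }
    nra.
  - assert (Dg : is_derive (fun x => l / 2 * x - f x) 0 (l / 2 - l)).
    { apply (is_derive_minus (fun x => l / 2 * x) f); [auto_derive; [exact I|ring]|exact Df]. }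
    destruct (is_derive_neg_local _ _ _ Dg ltac:(lra)) as [d [Hd Hd']].
    exists (l / 2), d. split; [lra|split; [exact Hd|]].
    intros x Hx. destruct (Req_dec x 0) as [->|Hx0]; [rewrite H0; lra|].
    destruct (Hd' x ltac:(lra)) as [H1 _]. rewrite Rplus_0_l, H0 in H1. lra. }
destruct near as [k [d [Hk [Hd Hn]]]].
destruct (Rle_lt_dec d r) as [Hdr|Hdr].
- destruct (continuity_ab_min f d r Hdr) as [xm [Hm1 Hm2]]; [intros; apply Cf|].
  assert (Hfm : 0 < f xm) by (apply Hf; lra).
  exists (Rmin k (f xm / r)).
  assert (0 < f xm / r) by (apply Rdiv_lt_0_compat; lra).
  split; [apply Rmin_glb_lt; lra|].
  intros x Hx. destruct (Rle_lt_dec d x) as [Hdx|Hdx].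
  + apply Rle_trans with (f xm / r * r); [|replace (f xm / r * r) with (f xm) by (field; lra); apply Hm1; lra].
    apply Rmult_le_compat; try lra; [apply Rmin_glb; lra|apply Rmin_r].
  + apply Rle_trans with (k * x); [|apply Hn; lra].
    apply Rmult_le_compat_r; [lra|apply Rmin_l].
- exists k; split; [exact Hk|]. intros x Hx; apply Hn; lra.
Qed.

(** With x and y the distances to the two sides, the barrier is a multiple of
    [(x + al x^2)(y + al y^2)]. Its pure second derivatives contribute at least [2 al c0 (x + y)];
    the mixed term is of the same order x + y because the mixed coefficient vanishes linearly at the
    corner, so a large [al] wins. The sign [s] treats the bottom and the surface at once. *)
Lemma corner_barrier (c0 K C l pc s r0 : R) (v vq vp vqq vqp vpp : R -> R -> R) :
  0 < c0 -> 0 < K -> 0 <= C -> 0 < r0 -> s = 1 \/ s = -1 -> is_C2 v vq vp vqq vqp vpp ->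
  (forall q p, l - r0 <= q <= l -> 0 <= s * (p - pc) <= r0 -> 0 <= v q p) ->
  (forall q p, l - r0 < q < l -> 0 < s * (p - pc) < r0 ->
     supersolution c0 K (C * ((l - q) + s * (p - pc)))
       (vq q p) (vp q p) (vqq q p) (vqp q p) (vpp q p)) ->
  (forall r, 0 < r <= r0 -> exists k, 0 < k /\
     forall p, 0 <= s * (p - pc) <= r -> k * (s * (p - pc)) <= v (l - r) p) ->
  (forall r, 0 < r <= r0 -> exists k, 0 < k /\
     forall q, l - r <= q <= l -> k * (l - q) <= v q (pc + s * r)) ->
  exists k r, 0 < k /\ 0 < r /\ forall q p, l - r <= q <= l -> 0 <= s * (p - pc) <= r ->
     k * ((l - q) * (s * (p - pc))) <= v q p.
Proof.
intros Hc0 HK HC Hr0 Hs Hv Hv0 Hsup Hside1 Hside2.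
(* In units of x + y, the mixed term costs at most [8 * C] and the first-order terms at most
   [4 * K]; [2 * al * c0] exceeds the sum by 2. *)
set (al := (4 * C + 2 * K + 1) / c0).
assert (Hal : 0 < al) by (unfold al; apply Rdiv_lt_0_compat; lra).
assert (Eal : al * c0 = 4 * C + 2 * K + 1) by (unfold al; field; lra).
set (r := Rmin r0 (/ (2 * al))).
assert (Hr : 0 < r) by (apply Rmin_glb_lt; [lra|apply Rinv_0_lt_compat; lra]).
assert (Hrr0 : r <= r0) by apply Rmin_l.
assert (Hral : al * r <= / 2).
{ assert (r <= / (2 * al)) by apply Rmin_r.
  apply Rmult_le_compat_l with (r := al) in H; [|lra].
  replace (al * / (2 * al)) with (/ 2) in H by (field; lra). exact H. }
clearbody r al.
assert (Hss : s * s = 1) by (destruct Hs; subst s; ring).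
destruct (Hside1 r ltac:(lra)) as [k1 [Hk1 S1]].
destruct (Hside2 r ltac:(lra)) as [k2 [Hk2 S2]].
(* On an outer side one factor of the barrier is at most [2 * r] and the other at most twice its
   distance, so the barrier stays below the linear bounds [S1] and [S2]. *)
set (k := Rmin k1 k2 / (4 * r)).
assert (Hk : 0 < k) by (apply Rdiv_lt_0_compat; [apply Rmin_glb_lt; assumption|lra]).
assert (Ek : k * (4 * r) <= k1 /\ k * (4 * r) <= k2).
{ unfold k. replace (Rmin k1 k2 / (4 * r) * (4 * r)) with (Rmin k1 k2) by (field; lra).
  split; [apply Rmin_l|apply Rmin_r]. }
clearbody k.
set (X := fun q => (l - q) + al * (l - q)^2).
set (X1 := fun q => - (1 + 2 * al * (l - q))).
set (Y := fun p => s * (p - pc) + al * (p - pc)^2).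
set (Y1 := fun p => s + 2 * al * (p - pc)).
assert (Hb : is_C2 (fun q p => X q * Y p) (fun q p => X1 q * Y p) (fun q p => X q * Y1 p)
    (fun q p => (2 * al) * Y p) (fun q p => X1 q * Y1 p) (fun q p => X q * (2 * al))).
{ apply (C2_prod X X1 (fun _ => 2 * al) Y Y1 (fun _ => 2 * al)).
  - intros t; unfold X, X1; auto_derive; [exact I|simpl; ring].
  - intros t; unfold X1; auto_derive; [exact I|ring].
  - intros t; apply continuity_pt_const; intros ? ?; reflexivity.
  - intros t; unfold Y, Y1; auto_derive; [exact I|simpl; ring].
  - intros t; unfold Y1; auto_derive; [exact I|ring].
  - intros t; apply continuity_pt_const; intros ? ?; reflexivity. }
assert (Hu := C2_comb k _ _ _ _ _ _ _ _ _ _ _ _ Hv Hb).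
assert (EY : forall p, Y p = s * (p - pc) + al * (s * (p - pc))^2).
{ intros p; unfold Y. replace ((s * (p - pc))^2) with (s * s * (p - pc)^2) by ring.
  rewrite Hss; ring. }
assert (BX : forall x, 0 <= x <= r -> x <= x + al * x^2 <= 2 * x).
{ intros x Hx. assert (0 <= al * x <= / 2) by (split; nra). split; nra. }
exists k, r; split; [exact Hk|split; [exact Hr|]].
intros q0 p0 Hq0 Hp0.
cut (0 <= v q0 p0 - k * (X q0 * Y p0)).
{ intros H.
  assert (HX := BX (l - q0) ltac:(lra)). assert (HY := BX _ Hp0).
  unfold X in H; rewrite EY in H.
  apply Rle_trans with (k * ((l - q0 + al * (l - q0) ^ 2) * (s * (p0 - pc) + al * (s * (p0 - pc)) ^ 2)));
    [|lra].
  apply Rmult_le_compat_l; [lra|]. apply Rmult_le_compat; lra. }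
apply (weak_minimum_principle (l - r) l (pc - r) (pc + r) 0
   (fun q p => l - r <= q <= l /\ 0 <= s * (p - pc) <= r) _ _ _ _ _ _ Hu); [| | |split; assumption].
{ intros q p [Hq Hp]. destruct Hs; subst s; lra. }
{ intros q p H. repeat split; apply Rnot_lt_le; intros Hlt.
  - destruct (H (l - r - q) ltac:(lra)) as [q' [p' [H1 [H2 H3]]]]. apply Rabs_def2 in H2, H3; lra.
  - destruct (H (q - l) ltac:(lra)) as [q' [p' [H1 [H2 H3]]]]. apply Rabs_def2 in H2, H3; lra.
  - destruct (H (- (s * (p - pc))) ltac:(lra)) as [q' [p' [H1 [H2 H3]]]]. apply Rabs_def2 in H2, H3.
    destruct Hs; subst s; lra.
  - destruct (H (s * (p - pc) - r) ltac:(lra)) as [q' [p' [H1 [H2 H3]]]]. apply Rabs_def2 in H2, H3.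
    destruct Hs; subst s; lra. }
intros q p [Hq Hp] Hneg.
assert (HX := BX (l - q) ltac:(lra)). assert (HY := BX _ Hp). rewrite <- EY in HY.
change (l - q + al * (l - q)^2) with (X q) in HX.
assert (Hin : l - r < q < l /\ 0 < s * (p - pc) < r).
{ assert (Hvp : 0 <= v q p) by (apply Hv0; lra).
  repeat split; apply Rnot_le_lt; intros Hle.
  - assert (q = l - r) by lra. subst q.
    specialize (S1 p Hp).
    assert (k * (X (l - r) * Y p) <= k * (4 * r) * (s * (p - pc))).
    { replace (k * (4 * r) * (s * (p - pc))) with (k * (2 * r * (2 * (s * (p - pc))))) by ring.
      apply Rmult_le_compat_l; [lra|]. apply Rmult_le_compat; lra. }
    assert (k * (4 * r) * (s * (p - pc)) <= k1 * (s * (p - pc))) by (apply Rmult_le_compat_r; lra).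
    lra.
  - assert (X q = 0) by lra. rewrite H in Hneg; lra.
  - assert (Y p = 0) by lra. rewrite H in Hneg; lra.
  - assert (Ep : p = pc + s * r).
    { replace (p - pc) with (s * s * (p - pc)) in * by (rewrite Hss; ring).
      destruct Hs; subst s; lra. }
    specialize (S2 q ltac:(lra)). rewrite <- Ep in S2.
    assert (k * (X q * Y p) <= k * (4 * r) * (l - q)).
    { replace (k * (4 * r) * (l - q)) with (k * (2 * (l - q) * (2 * r))) by ring.
      apply Rmult_le_compat_l; [lra|]. apply Rmult_le_compat; lra. }
    assert (k * (4 * r) * (l - q) <= k2 * (l - q)) by (apply Rmult_le_compat_r; lra).
    lra. }
destruct Hin as [Hq' Hp'].
destruct (Hsup q p ltac:(lra) ltac:(lra)) as [a11 [a12 [a22 [b1 [b2 [H1 [H2 [H3 [H4 [H5 [H6 [H7 [H8 H9]]]]]]]]]]]]].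
set (x := l - q) in *. set (y := s * (p - pc)) in *.
exists (Rmin (Rmin x (r - x)) (Rmin y (r - y))), a11, a12, a22, b1, b2.
split; [repeat apply Rmin_glb_lt; unfold x, y in *; lra|].
split.
{ intros q' p' Hq2 Hp2.
  generalize (Rmin_l (Rmin x (r - x)) (Rmin y (r - y))) (Rmin_r (Rmin x (r - x)) (Rmin y (r - y)))
   (Rmin_l x (r - x)) (Rmin_r x (r - x)) (Rmin_l y (r - y)) (Rmin_r y (r - y)); intros.
  apply Rabs_def2 in Hq2, Hp2. unfold x, y in *.
  destruct Hs; subst s; lra. }
split; [lra|]. split; [nra|].
assert (AX : Rabs (X1 q) <= 2).
{ unfold X1; rewrite Rabs_Ropp; fold x. assert (0 <= al * x <= / 2) by (split; unfold x in *; nra).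
  rewrite Rabs_pos_eq; lra. }
assert (AY : Rabs (Y1 p) <= 2).
{ unfold Y1. replace (s + 2 * al * (p - pc)) with (s * (1 + 2 * (al * y))).
  2: { unfold y; ring_simplify. replace (s^2) with 1 by (rewrite <- Hss; ring). ring. }
  assert (0 <= al * y <= / 2) by (split; nra).
  rewrite Rabs_mult, (Rabs_pos_eq (1 + _)) by lra.
  replace (Rabs s) with 1; [lra|]. destruct Hs; subst s; [rewrite Rabs_R1|rewrite Rabs_left]; lra. }
assert (Hx : 0 < x) by (unfold x; lra).
assert (T1 : - (4 * C * (x + y)) <= a12 * (X1 q * Y1 p)).
{ assert (Rabs (a12 * (X1 q * Y1 p)) <= C * (x + y) * 4).
  { rewrite 2!Rabs_mult. replace 4 with (2 * 2) by ring.
    apply Rmult_le_compat; auto using Rabs_pos.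
    - apply Rmult_le_pos; apply Rabs_pos.
    - apply Rmult_le_compat; auto using Rabs_pos. }
  apply Rabs_le_between in H; lra. }
assert (T2 : - (K * (2 * (2 * y))) <= b1 * (X1 q * Y p)).
{ assert (Rabs (b1 * (X1 q * Y p)) <= K * (2 * (2 * y))).
  { rewrite 2!Rabs_mult.
    apply Rmult_le_compat; auto using Rabs_pos.
    - apply Rmult_le_pos; apply Rabs_pos.
    - apply Rmult_le_compat; auto using Rabs_pos. rewrite Rabs_pos_eq; lra. }
  apply Rabs_le_between in H; lra. }
assert (T3 : - (K * (2 * x * 2)) <= b2 * (X q * Y1 p)).
{ assert (Rabs (b2 * (X q * Y1 p)) <= K * (2 * x * 2)).
  { rewrite 2!Rabs_mult.
    apply Rmult_le_compat; auto using Rabs_pos.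
    - apply Rmult_le_pos; apply Rabs_pos.
    - apply Rmult_le_compat; auto using Rabs_pos. rewrite Rabs_pos_eq; lra. }
  apply Rabs_le_between in H; lra. }
assert (T4 : c0 * y <= a11 * Y p) by (apply Rmult_le_compat; lra).
assert (T5 : c0 * x <= a22 * X q) by (apply Rmult_le_compat; lra).
assert (T6 : al * (c0 * y) <= al * (a11 * Y p)) by (apply Rmult_le_compat_l; lra).
assert (T7 : al * (c0 * x) <= al * (a22 * X q)) by (apply Rmult_le_compat_l; lra).
assert (T8 : (4 * C + 2 * K + 1) * (x + y) <= al * (a11 * Y p) + al * (a22 * X q)).
{ rewrite <- Eal. lra. }
assert (HL : 0 < a11 * (2 * al * Y p) + 2 * a12 * (X1 q * Y1 p) + a22 * (X q * (2 * al))
    + b1 * (X1 q * Y p) + b2 * (X q * Y1 p)).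
{ assert (0 < x + y) by lra. lra. }
match type of HL with 0 < ?l => assert (0 < k * l) by (apply Rmult_lt_0_compat; assumption) end.
lra.
Qed.

(** On the axis [v] is zero, and [v >= k x y] nearby, so [vq <= - k y] there. Since [vq] vanishes at
    the corner, a second one-sided comparison, now along the axis, gives [s * vqp <= - k]. *)
Lemma corner_mixed_derivative (c0 K C l pc s r0 : R) (v vq vp vqq vqp vpp : R -> R -> R) :
  0 < c0 -> 0 < K -> 0 <= C -> 0 < r0 -> s = 1 \/ s = -1 -> is_C2 v vq vp vqq vqp vpp ->
  (forall q p, l - r0 <= q <= l -> 0 <= s * (p - pc) <= r0 -> 0 <= v q p) ->
  (forall q p, l - r0 < q < l -> 0 < s * (p - pc) < r0 ->
     supersolution c0 K (C * ((l - q) + s * (p - pc)))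
       (vq q p) (vp q p) (vqq q p) (vqp q p) (vpp q p)) ->
  (forall r, 0 < r <= r0 -> exists k, 0 < k /\
     forall p, 0 <= s * (p - pc) <= r -> k * (s * (p - pc)) <= v (l - r) p) ->
  (forall r, 0 < r <= r0 -> exists k, 0 < k /\
     forall q, l - r <= q <= l -> k * (l - q) <= v q (pc + s * r)) ->
  (forall p, 0 <= s * (p - pc) <= r0 -> v l p = 0) -> vq l pc = 0 ->
  s * vqp l pc < 0.
Proof.
intros Hc0 HK HC Hr0 Hs Hv Hv0 Hsup Hside1 Hside2 Hz Hzq.
destruct (corner_barrier c0 K C l pc s r0 v vq vp vqq vqp vpp) as [k [r [Hk [Hr Hb]]]]; auto.
assert (Hss : s * s = 1) by (destruct Hs; subst s; ring).
set (rr := Rmin r r0).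
assert (Hrr : 0 < rr) by (apply Rmin_glb_lt; assumption).
assert (Hrr1 : rr <= r) by apply Rmin_l.
assert (Hrr2 : rr <= r0) by apply Rmin_r.
assert (step : forall y, 0 <= y < rr -> vq l (pc + s * y) <= - k * y).
{ intros y Hy.
  assert (E : s * (pc + s * y - pc) = y).
  { replace (s * (pc + s * y - pc)) with (s * s * y) by ring. rewrite Hss; ring. }
  assert (vq l (pc + s * y) - (- k * y) <= 0); [|lra].
  apply (is_derive_left_min (fun q => v q (pc + s * y) - k * ((l - q) * y)) l _ rr).
  - apply (is_derive_minus (fun q => v q (pc + s * y)) (fun q => k * ((l - q) * y))).
    + apply Hv.
    + auto_derive; [exact I|ring].
  - exact Hrr.
  - intros h Hh. specialize (Hb (l - h) (pc + s * y)). rewrite E in Hb.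
    rewrite Hz by lra. specialize (Hb ltac:(lra) ltac:(lra)).
    replace (k * ((l - l) * y)) with 0 by ring. lra. }
assert (0 <= - k - vqp l pc * s); [|lra].
apply (is_derive_right_min (fun y => - k * y - vq l (pc + s * y)) 0 _ rr).
- apply (is_derive_minus (fun y => - k * y) (fun y => vq l (pc + s * y))).
  + auto_derive; [exact I|ring].
  + rewrite Rmult_comm. apply (is_derive_comp (fun p => vq l p) (fun y => pc + s * y) 0 (vqp l pc) s).
    * replace (pc + s * 0) with pc by ring. apply Hv.
    * auto_derive; [exact I|ring].
- exact Hrr.
- intros h Hh. rewrite Rplus_0_l. replace (pc + s * 0) with pc by ring. rewrite Hzq.
  specialize (step h ltac:(lra)). lra.
Qed.

(** * Shooting for the linearised problem *)

Lemma is_derive_continuity_pt (f : R -> R) (x l : R) : is_derive f x l -> continuity_pt f x.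
Proof. intros H. apply derivable_continuous_pt; exists l; apply is_derive_Reals, H. Qed.

Lemma sum_tail_bound (a M : nat -> R) (n : nat) :
  (forall k, Rabs (a k) <= M k) -> ex_series M ->
  Rabs (Series a - sum_n a n) <= Series M - sum_n M n.
Proof.
intros H EM.
assert (Ea : ex_series a).
{ apply (ex_series_le (K := R_AbsRing) (V := R_CompleteNormedModule) a M); [exact H|exact EM]. }
assert (fin : forall m, Rabs (sum_n a (n + m) - sum_n a n) <= sum_n M (n + m) - sum_n M n).
{ induction m as [|m IH].
  - rewrite Nat.add_0_r, !Rminus_diag, Rabs_R0; lra.
  - rewrite Nat.add_succ_r, !sum_Sn. unfold plus; simpl.
    replace (sum_n a (n + m) + a (S (n + m)) - sum_n a n)
      with ((sum_n a (n + m) - sum_n a n) + a (S (n + m))) by ring.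
    apply Rle_trans with (1 := Rabs_triang _ _). specialize (H (S (n + m))); lra. }
assert (La : is_lim_seq (sum_n a) (Series a)) by apply (Series_correct a Ea).
assert (LM : is_lim_seq (sum_n M) (Series M)) by apply (Series_correct M EM).
apply (is_lim_seq_incr_n (sum_n a) n) in La. apply (is_lim_seq_incr_n (sum_n M) n) in LM.
assert (L1 : is_lim_seq (fun m => Rabs (sum_n a (m + n) - sum_n a n)) (Rabs (Series a - sum_n a n))).
{ apply (is_lim_seq_abs (fun m => sum_n a (m + n) - sum_n a n) (Series a - sum_n a n)).
  apply is_lim_seq_minus'; [exact La|apply is_lim_seq_const]. }
assert (L2 : is_lim_seq (fun m => sum_n M (m + n) - sum_n M n) (Series M - sum_n M n)).
{ apply is_lim_seq_minus'; [exact LM|apply is_lim_seq_const]. }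
apply (is_lim_seq_le _ _ (Rabs (Series a - sum_n a n)) (Series M - sum_n M n)
   (fun m => eq_ind _ (fun j => Rabs (sum_n a j - sum_n a n) <= sum_n M j - sum_n M n)
       (fin m) _ (Nat.add_comm n m)) L1 L2).
Qed.

Lemma series_derive (f f' : nat -> R -> R) (M : nat -> R) (c : R) (r : posreal) :
  (forall k x, Boule c r x -> is_derive (f k) x (f' k x)) ->
  (forall k x, Boule c r x -> Rabs (f k x) <= M k) ->
  (forall k x, Boule c r x -> Rabs (f' k x) <= M k) -> ex_series M ->
  forall x, Boule c r x ->
  is_derive (fun t => Series (fun k => f k t)) x (Series (fun k => f' k x)).
Proof.
intros Df Bf Bf' EM.
assert (tail : forall e, 0 < e -> exists N, forall n, (N <= n)%nat -> Series M - sum_n M n < e).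
{ intros e He. assert (L : is_lim_seq (sum_n M) (Series M)) by apply (Series_correct M EM). apply is_lim_seq_Reals in L.
  destruct (L e He) as [N HN]. exists N. intros n Hn. specialize (HN n Hn).
  apply Rabs_def2 in HN. unfold Rdist in HN. lra. }
assert (cvu : forall g : nat -> R -> R, (forall k x, Boule c r x -> Rabs (g k x) <= M k) ->
   CVU (fun n x => sum_n (fun k => g k x) n) (fun x => Series (fun k => g k x)) c r).
{ intros g Hg e He. destruct (tail e He) as [N HN]. exists N. intros n y Hn Hy.
  apply Rle_lt_trans with (2 := HN n Hn). apply sum_tail_bound; [|exact EM].
  intros k; apply Hg, Hy. }
intros x Hx. apply is_derive_Reals.
apply (CVU_derivable (fun n x => sum_n (fun k => f k x) n)
  (fun n x => sum_n (fun k => f' k x) n) _ (fun x => Series (fun k => f' k x)) c r); auto.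
- intros y Hy e He. destruct (cvu f Bf e He) as [N HN]. exists N. intros n Hn.
  unfold Rdist. rewrite Rabs_minus_sym. apply HN; auto.
- intros n y Hy. apply is_derive_Reals.
  induction n as [|n IH].
  + rewrite sum_O. apply is_derive_ext with (f 0%nat); [intros; rewrite sum_O; reflexivity|auto].
  + rewrite sum_Sn. apply is_derive_ext with (fun x => plus (sum_n (fun k => f k x) n) (f (S n) x)).
    * intros; rewrite sum_Sn; reflexivity.
    * apply (is_derive_plus (fun x => sum_n (fun k => f k x) n) (f (S n))); auto.
Qed.

(** * Power series solution of the shooting problem *)

Lemma abs_primitive_bound (F F' : R -> R) (c N : R) (n : nat) :
  (forall t, is_derive F t (F' t)) -> F (-1) = 0 ->
  (forall t, Rabs (t + 1) <= N -> Rabs (F' t) <= c * Rabs (t + 1) ^ n) ->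
  forall p, Rabs (p + 1) <= N -> Rabs (F p) <= c * Rabs (p + 1) ^ S n / INR (S n).
Proof.
assert (right : forall F F' : R -> R, (forall t, is_derive F t (F' t)) -> F (-1) = 0 ->
  (forall t, Rabs (t + 1) <= N -> Rabs (F' t) <= c * Rabs (t + 1) ^ n) ->
  forall p, -1 <= p -> Rabs (p + 1) <= N -> F p <= c * Rabs (p + 1) ^ S n / INR (S n)).
{ intros G G' DG G1 BG p Hp HpN.
  set (D := fun t => c * (t + 1) ^ S n / INR (S n) - G t).
  assert (DD : forall t, is_derive D t (c * (t + 1) ^ n - G' t)).
  { intros t. apply (is_derive_minus (fun t => c * (t + 1) ^ S n / INR (S n)) G); [|apply DG].
    assert (INR (S n) <> 0) by (apply not_0_INR; lia).
    auto_derive; [exact I|]. rewrite S_INR in *. simpl pred. destruct n; simpl; field; exact H. }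
  destruct (MVT_gen D (-1) p (fun t => c * (t + 1) ^ n - G' t)) as [x [Hx E]].
  - intros; apply DD.
  - intros; apply (is_derive_continuity_pt _ _ _ (DD _)).
  - rewrite Rmin_left, Rmax_right in Hx by exact Hp.
    rewrite Rabs_pos_eq in HpN by lra.
    specialize (BG x). rewrite (Rabs_pos_eq (x + 1)) in BG by lra.
    specialize (BG ltac:(lra)). apply Rabs_le_between in BG.
    assert (ED : D (-1) = 0).
    { unfold D. rewrite G1. replace (-1 + 1) with 0 by ring. rewrite pow_i by lia. unfold Rdiv; ring. }
    rewrite ED in E. rewrite Rabs_pos_eq by lra.
    assert (0 <= D p); [|unfold D in H; lra].
    replace (D p) with ((c * (x + 1) ^ n - G' x) * (p - -1)) by lra.
    apply Rmult_le_pos; lra. }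
assert (absr : forall F F' : R -> R, (forall t, is_derive F t (F' t)) -> F (-1) = 0 ->
  (forall t, Rabs (t + 1) <= N -> Rabs (F' t) <= c * Rabs (t + 1) ^ n) ->
  forall p, -1 <= p -> Rabs (p + 1) <= N -> Rabs (F p) <= c * Rabs (p + 1) ^ S n / INR (S n)).
{ intros G G' DG G1 BG p Hp HpN. apply Rabs_le. split; [|apply (right G G'); auto].
  assert (- G p <= c * Rabs (p + 1) ^ S n / INR (S n)); [|lra].
  apply (right (fun t => - G t) (fun t => - G' t)); auto.
  - intros t; apply (is_derive_opp G); auto.
  - lra.
  - intros t Ht; rewrite Rabs_Ropp; auto. }
intros DF F1 BF p Hp.
destruct (Rle_lt_dec (-1) p) as [H|H]; [apply (absr F F'); auto|].
(* Reflection in -1 covers the points to its left: [SL_eigen] asks for an eigenfunction of class C^2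
   on the whole line. *)
assert (E : forall t, Rabs (-2 - t + 1) = Rabs (t + 1)).
{ intros t. replace (-2 - t + 1) with (- (t + 1)) by ring. apply Rabs_Ropp. }
replace (F p) with ((fun t => F (-2 - t)) (-2 - p)) by (simpl; f_equal; ring).
rewrite <- (E p).
apply (absr (fun t => F (-2 - t)) (fun t => - F' (-2 - t))).
- intros t. replace (- F' (-2 - t)) with (-1 * F' (-2 - t)) by ring.
  apply (is_derive_comp F (fun t => -2 - t)); [apply DF|]. auto_derive; [exact I|ring].
- replace (-2 - -1) with (-1) by ring. exact F1.
- intros t Ht. rewrite Rabs_Ropp, <- (E t). apply BF. rewrite E; exact Ht.
- lra.
- rewrite E; exact Hp.
Qed.

(** Picard iterates of the system solved by [shoot_phi] and [shoot_z], stripped of the powers of the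
    parameter. Even indices belong to [z], odd ones to [phi], and the weights [g] and [d] alternate
    accordingly. *)
Fixpoint iterated_primitive (g d : R -> R) (n : nat) : R -> R :=
  match n with
  | O => fun _ => 1
  | S m => RInt (fun t => (if Nat.even m then g t else d t) * iterated_primitive g d m t) (-1)
  end.

Lemma iterated_primitive_derive (g d : R -> R) :
  (forall t, continuity_pt g t) -> (forall t, continuity_pt d t) ->
  forall n t, is_derive (iterated_primitive g d (S n)) t
     ((if Nat.even n then g t else d t) * iterated_primitive g d n t).
Proof.
intros Cg Cd.
assert (prim : forall f : R -> R, (forall t, continuity_pt f t) -> forall t,
   is_derive (RInt f (-1)) t (f t)).
{ intros f Cf t. apply (is_derive_RInt f (RInt f (-1)) (-1)).
  - apply filter_forall. intros b. apply (RInt_correct f).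
    apply (ex_RInt_continuous f). intros z _. apply continuity_pt_filterlim, Cf.
  - apply continuity_pt_filterlim, Cf. }
assert (Cm : forall n (u : R -> R), (forall t, continuity_pt u t) ->
   forall t, continuity_pt (fun t => (if Nat.even n then g t else d t) * u t) t).
{ intros n u Cu t. destruct (Nat.even n).
  - apply (continuity_pt_mult g u); auto.
  - apply (continuity_pt_mult d u); auto. }
assert (CC : forall n t, continuity_pt (iterated_primitive g d n) t).
{ induction n as [|n IH]; intros t.
  - apply continuity_pt_const; intros ? ?; reflexivity.
  - apply (is_derive_continuity_pt _ _ _ (prim _ (Cm n _ IH) t)). }
intros n t. apply (prim _ (Cm n _ (CC n)) t).
Qed.

Lemma iterated_primitive_bound (g d : R -> R) (C N : R) :
  (forall t, continuity_pt g t) -> (forall t, continuity_pt d t) -> 0 <= C ->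
  (forall t, Rabs (t + 1) <= N -> Rabs (g t) <= C /\ Rabs (d t) <= C) ->
  forall n p, Rabs (p + 1) <= N ->
    Rabs (iterated_primitive g d n p) <= C ^ n * Rabs (p + 1) ^ n / INR (fact n).
Proof.
intros Cg Cd HC B. induction n as [|n IH]; intros p Hp.
- simpl. rewrite Rabs_R1; lra.
- replace (C ^ S n * Rabs (p + 1) ^ S n / INR (fact (S n)))
   with (C ^ S n / INR (fact n) * Rabs (p + 1) ^ S n / INR (S n)).
  2: { rewrite fact_simpl, mult_INR. field. split; [apply not_0_INR, fact_neq_0|apply not_0_INR; lia]. }
  apply (abs_primitive_bound _ _ _ N n (iterated_primitive_derive g d Cg Cd n)); [| |exact Hp].
  + exact (RInt_point (V := R_CompleteNormedModule) (-1) _).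
  + intros t Ht. rewrite Rabs_mult.
    replace (C ^ S n / INR (fact n) * Rabs (t + 1) ^ n)
      with (C * (C ^ n * Rabs (t + 1) ^ n / INR (fact n))) by (simpl; unfold Rdiv; ring).
    apply Rmult_le_compat; try apply Rabs_pos; auto.
    destruct (Nat.even n); apply B, Ht.
Qed.

Lemma continuous_bounded (f : R -> R) (a b : R) : a <= b -> (forall t, continuity_pt f t) ->
  exists C, 0 <= C /\ forall t, a <= t <= b -> Rabs (f t) <= C.
Proof.
intros Hab Cf.
destruct (continuity_ab_maj (fun t => Rabs (f t)) a b Hab) as [m [Hm _]].
- intros t _. apply (continuity_pt_comp f Rabs); [apply Cf|apply Rcontinuity_abs].
- exists (Rabs (f m)). split; [apply Rabs_pos|exact Hm].
Qed.

(* The solution of [phi' = g z], [z' = mu d phi], [phi (-1) = 0], [z (-1) = 1]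
   as a power series in [mu]. *)
Definition shoot_z (g d : R -> R) (mu p : R) : R :=
  Series (fun k => mu ^ k * iterated_primitive g d (2 * k) p).
Definition shoot_phi (g d : R -> R) (mu p : R) : R :=
  Series (fun k => mu ^ k * iterated_primitive g d (2 * k + 1) p).

Lemma shoot_majorant (g d : R -> R) (X N : R) :
  (forall t, continuity_pt g t) -> (forall t, continuity_pt d t) -> 0 <= X -> 0 <= N ->
  exists M, ex_series M /\ forall k mu p, Rabs mu <= X -> Rabs (p + 1) <= N ->
    Rabs (mu ^ k * iterated_primitive g d (2 * k) p) <= M k /\
    Rabs (mu ^ k * iterated_primitive g d (2 * k + 1) p) <= M k /\
    Rabs (mu ^ k * (g p * iterated_primitive g d (2 * k) p)) <= M k /\
    Rabs (mu ^ S k * (d p * iterated_primitive g d (2 * k + 1) p)) <= M (S k).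
Proof.
intros Cg Cd HX HN.
destruct (continuous_bounded g (-1 - N) (-1 + N) ltac:(lra) Cg) as [C1 [HC1 B1]].
destruct (continuous_bounded d (-1 - N) (-1 + N) ltac:(lra) Cd) as [C2 [HC2 B2]].
set (C := C1 + C2).
assert (Bgd : forall t, Rabs (t + 1) <= N -> Rabs (g t) <= C /\ Rabs (d t) <= C).
{ intros t Ht. apply Rabs_le_between in Ht.
  specialize (B1 t ltac:(lra)). specialize (B2 t ltac:(lra)). unfold C; lra. }
assert (HC : 0 <= C) by (unfold C; lra).
assert (Ba := iterated_primitive_bound g d C N Cg Cd HC Bgd).
(* [B] is at least 1 and bounds both [C] and [C * N]. The additional factor [B] in the majorant
   absorbs either the odd index [2 * k + 1] or the weight [g]. *)
set (B := (C + 1) * (N + 1)).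
assert (HB : 1 <= B) by (unfold B; nra).
assert (HCB : C <= B) by (unfold B; nra).
(* Replacing the factorial of [n] by that of a smaller [m] turns the majorant into the exponential
   series of [X * B ^ 2]. *)
assert (Ba' : forall n m p, (m <= n)%nat -> Rabs (p + 1) <= N ->
   Rabs (iterated_primitive g d n p) <= B ^ n / INR (fact m)).
{ intros n m p Hmn Hp. apply Rle_trans with (1 := Ba n p Hp).
  assert (F1 : 0 < INR (fact n)) by apply INR_fact_lt_0.
  assert (F2 : 0 < INR (fact m)) by apply INR_fact_lt_0.
  apply Rmult_le_compat.
  - apply Rmult_le_pos; apply pow_le; [exact HC|apply Rabs_pos].
  - left; apply Rinv_0_lt_compat; exact F1.
  - rewrite <- Rpow_mult_distr. apply pow_incr. split.
    + apply Rmult_le_pos; [exact HC|apply Rabs_pos].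
    + unfold B. apply Rmult_le_compat; try lra; apply Rabs_pos.
  - apply Rinv_le_contravar; [exact F2|]. apply le_INR, fact_le, Hmn. }
assert (Hpow : forall mu k, Rabs mu <= X -> Rabs (mu ^ k) <= X ^ k).
{ intros mu k Hmu. rewrite <- RPow_abs. apply pow_incr. split; [apply Rabs_pos|exact Hmu]. }
exists (fun k => B * ((X * B ^ 2) ^ k / INR (fact k))). split.
- apply (ex_series_scal (K := R_AbsRing) (V := R_NormedModule) B).
  exists (exp (X * B ^ 2)).
  apply is_series_ext with (2 := is_exp_Reals (X * B ^ 2)).
  intros n. rewrite pow_n_pow. unfold scal; simpl; unfold mult; simpl.
  unfold Rdiv; ring.
- intros k mu p Hmu Hp.
  assert (F : 0 < / INR (fact k)) by apply Rinv_0_lt_compat, INR_fact_lt_0.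
  assert (HXk : 0 <= X ^ k) by (apply pow_le; exact HX).
  assert (E0 : (X * B ^ 2) ^ k = X ^ k * B ^ (2 * k)) by (rewrite Rpow_mult_distr, pow_mult; ring).
  assert (HBk : 0 <= B ^ (2 * k)) by (apply pow_le; lra).
  assert (P1 : Rabs (mu ^ k * iterated_primitive g d (2 * k) p) <= X ^ k * (B ^ (2 * k) / INR (fact k))).
  { rewrite Rabs_mult. apply Rmult_le_compat; try apply Rabs_pos; auto. apply Ba'; [lia|exact Hp]. }
  assert (T : 0 <= X ^ k * B ^ (2 * k) / INR (fact k)).
  { apply Rmult_le_pos; [apply Rmult_le_pos; assumption|lra]. }
  split; [|split; [|split]].
  + apply Rle_trans with (1 := P1). rewrite E0. unfold Rdiv in *. nra.
  + rewrite Rabs_mult.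
    apply Rle_trans with (X ^ k * (B ^ (2 * k + 1) / INR (fact k))).
    * apply Rmult_le_compat; try apply Rabs_pos; auto. apply Ba'; [lia|exact Hp].
    * rewrite E0, pow_add, pow_1. right; unfold Rdiv; ring.
  + replace (mu ^ k * (g p * iterated_primitive g d (2 * k) p))
      with (g p * (mu ^ k * iterated_primitive g d (2 * k) p)) by ring.
    rewrite Rabs_mult, E0.
    apply Rmult_le_compat; try apply Rabs_pos.
    * apply Rle_trans with (2 := HCB). apply Bgd, Hp.
    * apply Rle_trans with (1 := P1). right; unfold Rdiv; ring.
  + rewrite Rabs_mult, Rabs_mult.
    apply Rle_trans with (X ^ S k * (B * (B ^ (2 * k + 1) / INR (fact (S k))))).
    * apply Rmult_le_compat; try apply Rabs_pos; auto.
      { apply Rmult_le_pos; apply Rabs_pos. }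
      apply Rmult_le_compat; try apply Rabs_pos.
      { apply Rle_trans with (2 := HCB). apply Bgd, Hp. }
      destruct k; [simpl; specialize (Ba' 1%nat 1%nat p (le_n 1) Hp); simpl in Ba'; exact Ba'|].
      apply Ba'; [lia|exact Hp].
    * assert (F1 : 0 < / INR (fact (S k))) by apply Rinv_0_lt_compat, INR_fact_lt_0.
      assert (E1 : (X * B ^ 2) ^ S k = X ^ S k * (B * B ^ (2 * k + 1))).
      { rewrite Rpow_mult_distr, <- pow_mult. f_equal.
        replace (2 * S k)%nat with (S (2 * k + 1)) by lia. reflexivity. }
      rewrite E1.
      assert (0 <= X ^ S k * (B * B ^ (2 * k + 1)) / INR (fact (S k))).
      { apply Rmult_le_pos; [|lra]. apply Rmult_le_pos; [apply pow_le; exact HX|].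
        apply Rmult_le_pos; [lra|apply pow_le; lra]. }
      unfold Rdiv in *. nra.
Qed.

Lemma shoot_derive (g d : R -> R) :
  (forall t, continuity_pt g t) -> (forall t, continuity_pt d t) ->
  forall mu p, is_derive (shoot_phi g d mu) p (g p * shoot_z g d mu p) /\
               is_derive (shoot_z g d mu) p (mu * d p * shoot_phi g d mu p).
Proof.
intros Cg Cd mu p.
set (N := Rabs (p + 1) + 1).
assert (HN : 0 < N) by (unfold N; generalize (Rabs_pos (p + 1)); lra).
destruct (shoot_majorant g d (Rabs mu) N Cg Cd (Rabs_pos mu) (Rlt_le _ _ HN)) as [M [EM B]].
assert (Bo : forall x, Boule (-1) (mkposreal N HN) x -> Rabs (x + 1) <= N).
{ intros x Hx. unfold Boule in Hx; simpl in Hx. replace (x + 1) with (x - -1) by ring. lra. }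
assert (Hp : Boule (-1) (mkposreal N HN) p).
{ unfold Boule; simpl. unfold N. replace (p - -1) with (p + 1) by ring. lra. }
assert (Dr : forall (c : R) n x, is_derive (fun t => c * iterated_primitive g d (S n) t) x
    (c * ((if Nat.even n then g x else d x) * iterated_primitive g d n x))).
{ intros c n x. apply (is_derive_scal (iterated_primitive g d (S n)) x c).
  apply iterated_primitive_derive; assumption. }
assert (ev : forall k, Nat.even (2 * k) = true).
{ intros k. rewrite Nat.even_mul. reflexivity. }
split.
- replace (g p * shoot_z g d mu p)
    with (Series (fun k => mu ^ k * (g p * iterated_primitive g d (2 * k) p))).
  2: { unfold shoot_z. rewrite <- Series_scal_l. apply Series_ext; intros k; ring. }
  apply (series_derive (fun k t => mu ^ k * iterated_primitive g d (2 * k + 1) t)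
    (fun k t => mu ^ k * (g t * iterated_primitive g d (2 * k) t)) M (-1) (mkposreal N HN)); auto.
  + intros k x _. rewrite Nat.add_1_r. specialize (Dr (mu ^ k) (2 * k)%nat x). rewrite ev in Dr. exact Dr.
  + intros k x Hx. apply (B k mu x); [lra|auto].
  + intros k x Hx. apply (B k mu x); [lra|auto].
- replace (mu * d p * shoot_phi g d mu p)
    with (Series (fun k => match k with O => 0
        | S j => mu ^ S j * (d p * iterated_primitive g d (2 * j + 1) p) end)).
  2: { unfold shoot_phi. rewrite Series_incr_1.
       - rewrite Rplus_0_l, <- Series_scal_l. apply Series_ext; intros k; simpl; ring.
       - apply (ex_series_le (K := R_AbsRing) (V := R_CompleteNormedModule) _ M); [|exact EM].
         intros [|k].
         + change (norm 0) with (Rabs 0). rewrite Rabs_R0.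
           apply Rle_trans with (1 := Rabs_pos (mu ^ 0 * iterated_primitive g d (2 * 0) p)).
           apply (B 0%nat mu p); [lra|auto].
         + apply (B k mu p); [lra|auto]. }
  apply (series_derive (fun k t => mu ^ k * iterated_primitive g d (2 * k) t)
    (fun k t => match k with O => 0
        | S j => mu ^ S j * (d t * iterated_primitive g d (2 * j + 1) t) end) M (-1) (mkposreal N HN)); auto.
  + intros [|j] x _.
    * apply is_derive_ext with (fun _ => 1); [intros t; simpl; rewrite Rmult_1_l; reflexivity|].
      apply (is_derive_cst 1 x).
    * specialize (Dr (mu ^ S j) (2 * j + 1)%nat x).
      replace (2 * S j)%nat with (S (2 * j + 1)) by lia.
      rewrite Nat.even_add, ev in Dr. exact Dr.
  + intros k x Hx. apply (B k mu x); [lra|auto].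
  + intros [|k] x Hx.
    * rewrite Rabs_R0.
      apply Rle_trans with (1 := Rabs_pos (mu ^ 0 * iterated_primitive g d (2 * 0) x)).
      apply (B 0%nat mu x); [lra|auto].
    * apply (B k mu x); [lra|auto].
Qed.

Lemma shoot_initial (g d : R -> R) (mu : R) :
  shoot_phi g d mu (-1) = 0 /\ shoot_z g d mu (-1) = 1.
Proof.
assert (Z : forall n, iterated_primitive g d (S n) (-1) = 0).
{ intros n. exact (RInt_point (V := R_CompleteNormedModule) (-1) _). }
split.
- unfold shoot_phi. rewrite (Series_ext _ (fun k => 0 * 0)).
  + rewrite Series_scal_l. ring.
  + intros k. rewrite Nat.add_1_r, Z. ring.
- unfold shoot_z. rewrite Series_incr_1.
  + rewrite (Series_ext (fun k => mu ^ S k * _) (fun k => 0 * 0)).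
    * rewrite Series_scal_l. simpl; ring.
    * intros k. replace (2 * S k)%nat with (S (2 * k + 1)) by lia. rewrite Z. ring.
  + apply ex_series_incr_1. apply ex_series_ext with (fun _ : nat => 0).
    * intros k. replace (2 * S k)%nat with (S (2 * k + 1)) by lia. rewrite Z.
      change (0 = mu ^ S k * 0). ring.
    * exists 0. apply is_series_Reals. intros e He. exists 0%nat. intros n _.
      unfold Rdist. rewrite sum_eq_R0 by reflexivity. rewrite Rminus_0_r, Rabs_R0. exact He.
Qed.

Lemma pow_lipschitz (X mu nu : R) (k : nat) : 1 <= X -> Rabs mu <= X -> Rabs nu <= X ->
  Rabs (mu ^ k - nu ^ k) <= Rabs (mu - nu) * (2 * X) ^ k.
Proof.
intros HX Hmu Hnu. induction k as [|k IH].
- simpl. rewrite Rminus_diag, Rabs_R0. generalize (Rabs_pos (mu - nu)); lra.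
- replace (mu ^ S k - nu ^ S k) with (mu * (mu ^ k - nu ^ k) + (mu - nu) * nu ^ k) by (simpl; ring).
  apply Rle_trans with (1 := Rabs_triang _ _). rewrite !Rabs_mult.
  assert (P1 : Rabs (nu ^ k) <= (2 * X) ^ k).
  { rewrite <- RPow_abs. apply pow_incr. split; [apply Rabs_pos|lra]. }
  assert (P2 : 0 <= (2 * X) ^ k) by (apply pow_le; lra).
  assert (P3 := Rabs_pos (mu - nu)).
  set (A := Rabs (mu - nu)) in *. set (Z := (2 * X) ^ k) in *.
  apply Rle_trans with (X * (A * Z) + A * Z).
  + apply Rplus_le_compat.
    * apply Rmult_le_compat; auto using Rabs_pos.
    * apply Rmult_le_compat_l; assumption.
  + simpl. fold Z. assert (0 <= A * Z) by (apply Rmult_le_pos; assumption). nra.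
Qed.

Lemma shoot_lipschitz (g d : R -> R) (X : R) :
  (forall t, continuity_pt g t) -> (forall t, continuity_pt d t) -> 1 <= X ->
  exists L, 0 <= L /\ forall mu nu p, Rabs mu <= X -> Rabs nu <= X -> -1 <= p <= 0 ->
    Rabs (shoot_z g d mu p - shoot_z g d nu p) <= L * Rabs (mu - nu) /\
    Rabs (shoot_phi g d mu p - shoot_phi g d nu p) <= L * Rabs (mu - nu).
Proof.
intros Cg Cd HX.
(* The doubled radius pays for the factor [(2 * X) ^ k] lost in [pow_lipschitz]. *)
destruct (shoot_majorant g d (2 * X) 1 Cg Cd ltac:(lra) ltac:(lra)) as [M [EM B]].
assert (key : forall (a : nat -> R -> R),
  (forall k mu p, Rabs mu <= 2 * X -> Rabs (p + 1) <= 1 -> Rabs (mu ^ k * a k p) <= M k) ->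
  forall mu nu p, Rabs mu <= X -> Rabs nu <= X -> Rabs (p + 1) <= 1 ->
  Rabs (Series (fun k => mu ^ k * a k p) - Series (fun k => nu ^ k * a k p)) <= Series M * Rabs (mu - nu)).
{ intros a Ha mu nu p Hmu Hnu Hp.
  assert (ex : forall m, Rabs m <= X -> ex_series (fun k => m ^ k * a k p)).
  { intros m Hm. apply (ex_series_le (K := R_AbsRing) (V := R_CompleteNormedModule) _ M); [|exact EM].
    intros k. apply Ha; [generalize (Rabs_pos m)|]; lra. }
  rewrite <- Series_minus by (apply ex; assumption).
  assert (bd : forall k, 0 <= Rabs (mu ^ k * a k p - nu ^ k * a k p) <= Rabs (mu - nu) * M k).
  { intros k. split; [apply Rabs_pos|].
    rewrite <- Rmult_minus_distr_r, Rabs_mult.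
    apply Rle_trans with (Rabs (mu - nu) * (2 * X) ^ k * Rabs (a k p)).
    - apply Rmult_le_compat_r; [apply Rabs_pos|apply pow_lipschitz; assumption].
    - rewrite Rmult_assoc. apply Rmult_le_compat_l; [apply Rabs_pos|].
      specialize (Ha k (2 * X) p). rewrite Rabs_pos_eq in Ha by lra. specialize (Ha (Rle_refl _) Hp).
      rewrite Rabs_mult, (Rabs_pos_eq (_ ^ _)) in Ha by (apply pow_le; lra). exact Ha. }
  assert (EM' : ex_series (fun k => Rabs (mu - nu) * M k)).
  { apply (ex_series_scal (K := R_AbsRing) (V := R_NormedModule) (Rabs (mu - nu))), EM. }
  apply Rle_trans with (1 := Series_Rabs _ (ex_series_le (K := R_AbsRing) (V := R_CompleteNormedModule)
     (fun k => Rabs (mu ^ k * a k p - nu ^ k * a k p)) _ (fun k => eq_ind_r (fun z => z <= _) (proj2 (bd k)) (Rabs_Rabsolu _)) EM')).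
  apply Rle_trans with (1 := Series_le _ _ bd EM').
  rewrite Series_scal_l. lra. }
exists (Series M). split.
- assert (Z : 0 = Series (fun _ => 0 * 0)) by (rewrite Series_scal_l; ring).
  rewrite Z. apply Series_le; [|exact EM].
  intros k. split; [lra|]. rewrite Rmult_0_l.
  apply Rle_trans with (1 := Rabs_pos (0 ^ k * iterated_primitive g d (2 * k) 0)).
  apply (B k 0 0); [rewrite Rabs_R0; lra|rewrite Rplus_0_l, Rabs_R1; lra].
- intros mu nu p Hmu Hnu Hp. assert (Hp1 : Rabs (p + 1) <= 1) by (rewrite Rabs_pos_eq; lra).
  split.
  + apply (key (fun k => iterated_primitive g d (2 * k))); auto. intros; apply B; assumption.
  + apply (key (fun k => iterated_primitive g d (2 * k + 1))); auto. intros; apply B; assumption.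
Qed.

(** * Positivity below the first eigenvalue and the strict supersolution *)

Lemma increasing_of_derive (f f' : R -> R) (a b c : R) :
  a <= b -> (forall t, a <= t <= b -> is_derive f t (f' t)) ->
  (forall t, a <= t <= b -> c <= f' t) -> f a + c * (b - a) <= f b.
Proof.
intros Hab Df Hf.
destruct (MVT_gen f a b f') as [x [Hx E]].
- rewrite Rmin_left, Rmax_right by exact Hab. intros; apply Df; lra.
- rewrite Rmin_left, Rmax_right by exact Hab.
  intros x Hx; apply (is_derive_continuity_pt _ _ _ (Df x Hx)).
- rewrite Rmin_left, Rmax_right in Hx by exact Hab. specialize (Hf x Hx).
  assert (c * (b - a) <= f' x * (b - a)) by (apply Rmult_le_compat_r; lra). lra.
Qed.

Lemma lipschitz_continuity_pt (f : R -> R) (x L e : R) : 0 < e -> 0 <= L ->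
  (forall y, Rabs (y - x) < e -> Rabs (f y - f x) <= L * Rabs (y - x)) -> continuity_pt f x.
Proof.
intros He HL Hf eps Heps.
assert (Hq : 0 < eps / (L + 1)) by (apply Rdiv_lt_0_compat; lra).
exists (Rmin e (eps / (L + 1))). split; [apply Rmin_glb_lt; assumption|].
intros y [_ Hy]. simpl in *. unfold Rdist in *.
assert (Rabs (y - x) < e) by (apply Rlt_le_trans with (1 := Hy), Rmin_l).
assert (Hy2 : Rabs (y - x) < eps / (L + 1)) by (apply Rlt_le_trans with (1 := Hy), Rmin_r).
apply Rle_lt_trans with (1 := Hf y H).
apply Rmult_lt_compat_r with (r := L + 1) in Hy2; [|lra].
unfold Rdiv in Hy2; rewrite Rmult_assoc, Rinv_l in Hy2 by lra.
generalize (Rabs_pos (y - x)); nra.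
Qed.

(** As long as [z >= 0], [phi] increases from 0, and then [z' = mu d phi <= 0]; so [z] is smallest
    at the top. *)
Lemma shoot_decreasing (g d : R -> R) (mu : R) :
  (forall t, continuity_pt g t) -> (forall t, continuity_pt d t) ->
  (forall p, -1 <= p <= 0 -> 0 < g p) -> (forall p, -1 <= p <= 0 -> d p <= 0) -> 0 <= mu ->
  (forall p, -1 <= p <= 0 -> 0 <= shoot_z g d mu p) ->
  forall p, -1 <= p <= 0 -> 0 <= shoot_phi g d mu p /\ shoot_z g d mu 0 <= shoot_z g d mu p.
Proof.
intros Cg Cd Hg Hd Hmu Hz.
assert (phi0 : forall p, -1 <= p <= 0 -> 0 <= shoot_phi g d mu p).
{ intros p Hp. destruct (shoot_initial g d mu) as [I _].
  assert (shoot_phi g d mu (-1) + 0 * (p - -1) <= shoot_phi g d mu p); [|lra].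
  apply (increasing_of_derive _ (fun t => g t * shoot_z g d mu t)); [lra| |].
  - intros t _; apply shoot_derive; assumption.
  - intros t Ht. apply Rmult_le_pos; [left; apply Hg; lra|apply Hz; lra]. }
intros p Hp. split; [auto|].
assert (- shoot_z g d mu p + 0 * (0 - p) <= - shoot_z g d mu 0); [|lra].
apply (increasing_of_derive (fun t => - shoot_z g d mu t) (fun t => - (mu * d t * shoot_phi g d mu t))); [lra| |].
- intros t _. apply (is_derive_opp (shoot_z g d mu)). apply shoot_derive; assumption.
- intros t Ht. specialize (phi0 t ltac:(lra)). specialize (Hd t ltac:(lra)).
  assert (0 <= mu * (- d t * shoot_phi g d mu t)); [|lra].
  apply Rmult_le_pos; [exact Hmu|apply Rmult_le_pos; lra].
Qed.

(* [z - mu c phi] at the top starts from 1 at [mu = 0] and cannot vanish before the first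
   eigenvalue; as long as it is positive, [z] cannot touch zero from above, since it
   would be smallest at the top. *)
Lemma shoot_positive (g d : R -> R) (c mu1 : R) :
  (forall t, continuity_pt g t) -> (forall t, continuity_pt d t) ->
  (forall p, -1 <= p <= 0 -> 0 < g p) -> (forall p, -1 <= p <= 0 -> d p <= 0) ->
  0 < c -> 0 < mu1 ->
  (forall mu, 0 < mu <= mu1 -> shoot_z g d mu 0 - mu * c * shoot_phi g d mu 0 <> 0) ->
  0 < shoot_z g d mu1 0 - mu1 * c * shoot_phi g d mu1 0 /\
  forall p, -1 <= p <= 0 -> 0 < shoot_z g d mu1 p.
Proof.
intros Cg Cd Hg Hd Hc Hmu1 Hne.
destruct (shoot_lipschitz g d (mu1 + 2) Cg Cd ltac:(lra)) as [L [HL Lip]].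
set (m := fun mu => shoot_z g d mu 0 - mu * c * shoot_phi g d mu 0).
assert (z0 : forall p, -1 <= p <= 0 -> shoot_z g d 0 p = 1).
{ intros p Hp. destruct (shoot_initial g d 0) as [_ I].
  assert (E : forall t, is_derive (shoot_z g d 0) t 0).
  { intros t. replace 0 with (0 * d t * shoot_phi g d 0 t) at 2 by ring. apply shoot_derive; assumption. }
  assert (A1 := increasing_of_derive (shoot_z g d 0) (fun _ => 0) (-1) p 0 ltac:(lra)
     (fun t _ => E t) (fun t _ => Rle_refl 0)).
  assert (A2 := increasing_of_derive (fun t => - shoot_z g d 0 t) (fun _ => - 0) (-1) p 0 ltac:(lra)
     (fun t _ => is_derive_opp _ _ _ (E t)) ltac:(intros; lra)).
  simpl in A2. lra. }
assert (Cm : forall mu, continuity_pt m mu).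
{ intros mu. assert (Am := Rabs_pos mu).
  destruct (shoot_lipschitz g d (Rabs mu + 1) Cg Cd ltac:(lra)) as [L' [HL' Lip']].
  unfold m.
  apply (continuity_pt_minus (fun mu => shoot_z g d mu 0) (fun mu => mu * c * shoot_phi g d mu 0)).
  2: apply (continuity_pt_mult (fun mu => mu * c) (fun mu => shoot_phi g d mu 0)).
  2: apply (is_derive_continuity_pt _ _ c); auto_derive; [exact I|ring].
  all: apply (lipschitz_continuity_pt _ mu L' 1); try lra.
  all: intros y Hy; apply Lip'; try lra.
  all: replace y with (mu + (y - mu)) by ring.
  all: apply Rle_trans with (1 := Rabs_triang _ _); lra. }
assert (mpos : forall mu, 0 <= mu <= mu1 -> 0 < m mu).
{ intros mu Hmu. apply Rnot_le_lt; intros Hle.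
  assert (m0 : m 0 = 1) by (unfold m; rewrite z0; [ring|lra]).
  destruct (IVT_cor m 0 mu) as [x [Hx E]]; [exact Cm|lra|rewrite m0; lra|].
  destruct (Req_dec x 0) as [->|Hx0]; [lra|].
  apply (Hne x); [lra|exact E]. }
(* This improves [z >= 0] to [z >= m mu > 0], a margin independent of [p]. With the Lipschitz bound
   in the parameter it makes the set [E] below open to the right as well as closed. *)
assert (Hbelow : forall mu, 0 <= mu <= mu1 -> (forall p, -1 <= p <= 0 -> 0 <= shoot_z g d mu p) ->
   forall p, -1 <= p <= 0 -> m mu <= shoot_z g d mu p).
{ intros mu Hmu Hz p Hp.
  assert (D := shoot_decreasing g d mu Cg Cd Hg Hd ltac:(lra) Hz).
  destruct (D p Hp) as [_ D1]. destruct (D 0 ltac:(lra)) as [D2 _].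
  assert (0 <= mu * c * shoot_phi g d mu 0) by (repeat apply Rmult_le_pos; lra).
  unfold m; lra. }
set (E := fun mu => 0 <= mu <= mu1 /\ forall p, -1 <= p <= 0 -> 0 <= shoot_z g d mu p).
destruct (completeness E) as [s [Hs1 Hs2]].
{ exists mu1. intros x [Hx _]; lra. }
{ exists 0. split; [lra|]. intros p Hp; rewrite z0; lra. }
assert (Hs : 0 <= s <= mu1).
{ split.
  - apply Hs1. split; [lra|]. intros p Hp; rewrite z0; lra.
  - apply Hs2. intros x [Hx _]; lra. }
assert (Lip' : forall mu nu p, 0 <= mu <= mu1 + 1 -> 0 <= nu <= mu1 + 1 -> -1 <= p <= 0 ->
   Rabs (shoot_z g d mu p - shoot_z g d nu p) <= L * Rabs (mu - nu)).
{ intros mu nu p H1 H2 Hp. apply Lip; try (rewrite Rabs_pos_eq; lra). exact Hp. }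
assert (Es : E s).
{ split; [exact Hs|]. intros p Hp. apply Rnot_lt_le; intros Hlt.
  set (e := - shoot_z g d s p / (L + 1)).
  assert (He : 0 < e) by (apply Rdiv_lt_0_compat; lra).
  assert (Hex : exists x, E x /\ s - e < x).
  { apply NNPP; intros H. assert (s <= s - e); [|lra].
    apply Hs2; intros t Et. apply Rnot_lt_le; intros Hl; apply H; exists t; auto. }
  destruct Hex as [x [Ex Hx]]. assert (x <= s) by (apply Hs1; exact Ex).
  destruct Ex as [Hx1 Hx2]. specialize (Hx2 p Hp).
  specialize (Lip' x s p ltac:(lra) ltac:(lra) Hp).
  rewrite (Rabs_left1 (x - s)) in Lip' by lra.
  assert (e * (L + 1) = - shoot_z g d s p) by (unfold e; field; lra).
  apply Rabs_le_between in Lip'. nra. }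
assert (Hms := mpos s Hs).
assert (Hzs := Hbelow s Hs (proj2 Es)).
assert (Hend : s = mu1).
{ apply Rle_antisym; [lra|]. apply Rnot_lt_le; intros Hlt.
  set (e := m s / (L + 1)).
  assert (He : 0 < e) by (apply Rdiv_lt_0_compat; lra).
  assert (Ee : e * (L + 1) = m s) by (unfold e; field; lra).
  set (x := Rmin mu1 (s + e)).
  assert (Hx : s < x) by (apply Rmin_glb_lt; lra).
  assert (Hx1 : x <= mu1) by apply Rmin_l. assert (Hx2 : x <= s + e) by apply Rmin_r.
  assert (x <= s); [|lra].
  apply Hs1. split; [lra|]. intros p Hp.
  specialize (Lip' x s p ltac:(lra) ltac:(lra) Hp). specialize (Hzs p Hp).
  rewrite (Rabs_pos_eq (x - s)) in Lip' by lra.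
  apply Rabs_le_between in Lip'. nra. }
subst s. split; [exact Hms|].
intros p Hp. specialize (Hzs p Hp). lra.
Qed.

(** The interior inequality is the Sturm-Liouville operator [(psi' / G^3)' - mu d psi] multiplied by
    [G^3], with [G] for H_p, [d] for rho' and [c] for rho(0). Positivity includes the bottom, so
    that quotients by [psi] make sense on the closed strip. *)
Record strict_profile (G G1 d : R -> R) (c mu : R) (psi psi1 psi2 : R -> R) (dl : R) : Prop := {
  sp_d1 : forall t, is_derive psi t (psi1 t);
  sp_d2 : forall t, is_derive psi1 t (psi2 t);
  sp_c2 : forall t, continuity_pt psi2 t;
  sp_pos : forall p, -1 <= p <= 0 -> 0 < psi p;
  sp_dl : 0 < dl;
  sp_int : forall p, -1 <= p <= 0 ->
    psi2 p - 3 * psi1 p * (G1 p / G p) - mu * d p * G p ^ 3 * psi p <= - dl;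
  sp_top : mu * c * psi 0 - psi1 0 / G 0 ^ 3 <= - dl }.

Lemma strict_profile_exists (G G1 d : R -> R) (c mu : R) :
  (forall t, is_derive G t (G1 t)) -> (forall t, continuity_pt G1 t) ->
  (forall t, continuity_pt d t) ->
  (forall p, -1 <= p <= 0 -> 0 < G p) -> (forall p, -1 <= p <= 0 -> d p <= 0) ->
  0 < c -> 0 < mu ->
  (forall m, 0 < m <= mu ->
     shoot_z (fun t => G t ^ 3) d m 0 - m * c * shoot_phi (fun t => G t ^ 3) d m 0 <> 0) ->
  exists psi psi1 psi2 dl, strict_profile G G1 d c mu psi psi1 psi2 dl.
Proof.
intros DG CG1 Cd HG Hd Hc Hmu Hne.
set (g := fun t => G t ^ 3) in *.
assert (Dg : forall t, is_derive g t (3 * G t ^ 2 * G1 t)).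
{ intros t. replace (3 * G t ^ 2 * G1 t) with (INR 3 * G1 t * G t ^ pred 3) by (simpl; ring).
  apply is_derive_pow, DG. }
assert (Cg : forall t, continuity_pt g t) by (intros t; apply (is_derive_continuity_pt _ _ _ (Dg t))).
assert (Hg : forall p, -1 <= p <= 0 -> 0 < g p) by (intros p Hp; apply pow_lt, HG, Hp).
destruct (shoot_positive g d c mu Cg Cd Hg Hd Hc Hmu Hne) as [Hm Hz].
set (m := shoot_z g d mu 0 - mu * c * shoot_phi g d mu 0) in *.
set (z0 := shoot_z g d mu 0). assert (Hz0 : 0 < z0) by (apply Hz; lra).
assert (Hmono := shoot_decreasing g d mu Cg Cd Hg Hd (Rlt_le _ _ Hmu) (fun p Hp => Rlt_le _ _ (Hz p Hp))).
destruct (shoot_initial g d mu) as [I0 I1].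
assert (SD := shoot_derive g d Cg Cd mu).
destruct (continuity_ab_min g (-1) 0 ltac:(lra)) as [xm [Hm1 Hm2]]; [intros; apply Cg|].
set (g0 := g xm) in *. assert (Hg0 : 0 < g0) by (apply Hg; exact Hm2).
destruct (continuous_bounded g (-1) 0 ltac:(lra) Cg) as [C [HC BC]].
destruct (continuous_bounded d (-1) 0 ltac:(lra) Cd) as [D [HD BD]].
(* Where [chi] lies in [0, 1], [K] exceeds [- mu d chi] by at least 1; where [chi] is negative, that
   term has the favourable sign. *)
set (K := mu * D + 1). assert (HK : 0 < K) by (unfold K; nra).
set (chi := fun p => 1 - K * RInt (fun t => g t * (t + 1)) (-1) p).
assert (Cgt : forall t, continuity_pt (fun t => g t * (t + 1)) t).
{ intros t. apply (continuity_pt_mult g (fun t => t + 1)); [apply Cg|].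
  apply (is_derive_continuity_pt _ _ 1); auto_derive; [exact I|ring]. }
assert (Dchi : forall t, is_derive chi t (- (K * (g t * (t + 1))))).
{ intros t. replace (- (K * (g t * (t + 1)))) with (0 - K * (g t * (t + 1))) by ring.
  apply (is_derive_minus (fun _ => 1) (fun p => K * RInt (fun t => g t * (t + 1)) (-1) p)).
  - apply (is_derive_cst 1 t).
  - apply (is_derive_scal (RInt (fun t => g t * (t + 1)) (-1)) t K).
    apply (is_derive_RInt (fun t => g t * (t + 1)) _ (-1)).
    + apply filter_forall. intros b. apply (RInt_correct (fun t => g t * (t + 1))).
      apply (ex_RInt_continuous (fun t => g t * (t + 1))). intros z _. apply continuity_pt_filterlim, Cgt.
    + apply continuity_pt_filterlim, Cgt. }
assert (chi1 : chi (-1) = 1).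
{ unfold chi. replace (RInt (fun t => g t * (t + 1)) (-1) (-1)) with 0; [ring|].
  symmetry; exact (RInt_point (V := R_CompleteNormedModule) (-1) _). }
assert (chi_le : forall p, -1 <= p <= 0 -> chi p <= 1).
{ intros p Hp. assert (- chi (-1) + 0 * (p - -1) <= - chi p); [|lra].
  apply (increasing_of_derive (fun t => - chi t) (fun t => - - (K * (g t * (t + 1))))); [lra| |].
  - intros t _. apply (is_derive_opp chi), Dchi.
  - intros t Ht. rewrite Ropp_involutive. specialize (Hg t ltac:(lra)).
    apply Rmult_le_pos; [lra|apply Rmult_le_pos; lra]. }
assert (chi_ge : forall p, -1 <= p <= 0 -> 1 - K * C * (p + 1) <= chi p).
{ intros p Hp. assert (chi (-1) + (- (K * C)) * (p - -1) <= chi p); [|lra].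
  apply (increasing_of_derive chi (fun t => - (K * (g t * (t + 1))))); [lra| |].
  - intros t _. apply Dchi.
  - intros t Ht. apply Ropp_le_contravar. apply Rmult_le_compat_l; [lra|].
    specialize (BC t ltac:(lra)). apply Rabs_le_between in BC.
    specialize (Hg t ltac:(lra)). nra. }
assert (phi_ge : forall p, -1 <= p <= 0 -> z0 * g0 * (p + 1) <= shoot_phi g d mu p).
{ intros p Hp. assert (shoot_phi g d mu (-1) + (z0 * g0) * (p - -1) <= shoot_phi g d mu p); [|lra].
  apply (increasing_of_derive _ (fun t => g t * shoot_z g d mu t)); [lra| |].
  - intros t _. apply SD.
  - intros t Ht. rewrite (Rmult_comm z0). apply Rmult_le_compat; try lra.
    + apply Hm1; lra.
    + apply Hmono; lra. }
(* The first bound keeps [phi + e * chi] positive through [phi_ge] and [chi_ge]; the second gives up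
   at most half of the margin [m] at the top. *)
set (e := Rmin (z0 * g0 / (K * C + 1)) (m / (2 * (K + mu * c)))).
assert (Hmc : 0 < mu * c) by (apply Rmult_lt_0_compat; assumption).
assert (HKC : 0 <= K * C) by (apply Rmult_le_pos; lra).
assert (Hzg : 0 < z0 * g0) by (apply Rmult_lt_0_compat; assumption).
assert (He : 0 < e) by (apply Rmin_glb_lt; apply Rdiv_lt_0_compat; lra).
assert (He1 : e * (K * C + 1) <= z0 * g0).
{ replace (z0 * g0) with (z0 * g0 / (K * C + 1) * (K * C + 1)) by (field; lra).
  apply Rmult_le_compat_r; [lra|apply Rmin_l]. }
assert (He2 : e * (2 * (K + mu * c)) <= m).
{ replace m with (m / (2 * (K + mu * c)) * (2 * (K + mu * c))) at 1 by (field; lra).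
  apply Rmult_le_compat_r; [lra|apply Rmin_r]. }
clearbody e.
exists (fun p => shoot_phi g d mu p + e * chi p).
exists (fun p => g p * (shoot_z g d mu p + e * (- (K * (p + 1))))).
exists (fun p => 3 * G p ^ 2 * G1 p * (shoot_z g d mu p + e * (- (K * (p + 1))))
     + g p * (mu * d p * shoot_phi g d mu p + e * (- K))).
exists (Rmin (e * g0) (m / 2)).
assert (Ceg : 0 < e * g0) by (apply Rmult_lt_0_compat; assumption).
assert (Dz : forall t, is_derive (fun p => shoot_z g d mu p + e * (- (K * (p + 1)))) t
     (mu * d t * shoot_phi g d mu t + e * (- K))).
{ intros t. apply (is_derive_plus (shoot_z g d mu) (fun p => e * (- (K * (p + 1))))); [apply SD|].
  auto_derive; [exact I|ring]. }
split.
- intros t.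
  replace (g t * (shoot_z g d mu t + e * - (K * (t + 1))))
    with (g t * shoot_z g d mu t + e * (- (K * (g t * (t + 1))))) by ring.
  apply (is_derive_plus (shoot_phi g d mu) (fun p => e * chi p)); [apply SD|].
  apply (is_derive_scal chi t e), Dchi.
- intros t.
  apply (is_derive_mult g (fun p => shoot_z g d mu p + e * (- (K * (p + 1))))); [apply Dg|apply Dz|].
  intros; apply Rmult_comm.
- intros t.
  apply (continuity_pt_plus
    (fun p => 3 * G p ^ 2 * G1 p * (shoot_z g d mu p + e * (- (K * (p + 1)))))
    (fun p => g p * (mu * d p * shoot_phi g d mu p + e * (- K)))).
  + apply (continuity_pt_mult (fun p => 3 * G p ^ 2 * G1 p)).
    * apply (continuity_pt_mult (fun p => 3 * G p ^ 2)); [|apply CG1].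
      apply (continuity_pt_mult (fun _ => 3) (fun p => G p ^ 2)).
      -- apply continuity_pt_const; intros ? ?; reflexivity.
      -- apply (is_derive_continuity_pt _ _ _ (is_derive_pow G 2 t _ (DG t))).
    * apply (is_derive_continuity_pt _ _ _ (Dz t)).
  + apply (continuity_pt_mult g); [apply Cg|].
    apply (continuity_pt_plus (fun p => mu * d p * shoot_phi g d mu p) (fun _ => e * (- K))).
    * apply (continuity_pt_mult (fun p => mu * d p)).
      -- apply (continuity_pt_mult (fun _ => mu) d); [|apply Cd].
         apply continuity_pt_const; intros ? ?; reflexivity.
      -- apply (is_derive_continuity_pt _ _ _ (proj1 (SD t))).
    * apply continuity_pt_const; intros ? ?; reflexivity.
- intros p Hp. specialize (phi_ge p Hp). specialize (chi_ge p Hp).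
  assert (e * (1 - K * C * (p + 1)) <= e * chi p) by (apply Rmult_le_compat_l; lra).
  assert (e * (K * C + 1) * (p + 1) <= z0 * g0 * (p + 1)) by (apply Rmult_le_compat_r; lra).
  assert (0 <= e * (p + 1)) by (apply Rmult_le_pos; lra). lra.
- apply Rmin_glb_lt; lra.
- intros p Hp. assert (HGp := HG p Hp).
  assert (E : 3 * G p ^ 2 * G1 p * (shoot_z g d mu p + e * - (K * (p + 1))) +
      g p * (mu * d p * shoot_phi g d mu p + e * - K) -
      3 * (g p * (shoot_z g d mu p + e * - (K * (p + 1)))) * (G1 p / G p) -
      mu * d p * G p ^ 3 * (shoot_phi g d mu p + e * chi p)
    = - (e * (g p * (K + mu * d p * chi p)))).
  { unfold g. field. lra. }
  rewrite E. apply Ropp_le_contravar.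
  apply Rle_trans with (1 := Rmin_l _ _). apply Rmult_le_compat_l; [lra|].
  assert (Hk : 1 <= K + mu * d p * chi p).
  { specialize (BD p Hp). specialize (Hd p Hp). apply Rabs_le_between in BD.
    specialize (chi_le p Hp).
    destruct (Rle_lt_dec 0 (chi p)) as [Hch|Hch].
    - assert (mu * (- d p * chi p) <= mu * (D * 1)).
      { apply Rmult_le_compat_l; [lra|]. apply Rmult_le_compat; lra. }
      unfold K; lra.
    - assert (0 <= mu * (- d p * - chi p)).
      { apply Rmult_le_pos; [lra|]. apply Rmult_le_pos; lra. }
      assert (0 <= mu * D) by (apply Rmult_le_pos; lra). unfold K; lra. }
  apply Rle_trans with (g p * 1); [rewrite Rmult_1_r; apply Hm1; exact Hp|].
  apply Rmult_le_compat_l; [left; apply Hg, Hp|exact Hk].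
- assert (HG0 := HG 0 ltac:(lra)).
  replace (mu * c * (shoot_phi g d mu 0 + e * chi 0) -
     g 0 * (shoot_z g d mu 0 + e * - (K * (0 + 1))) / G 0 ^ 3)
   with (- m + e * (K + mu * c * chi 0)) by (unfold m, g; field; lra).
  assert (chi 0 <= 1) by (apply chi_le; lra).
  assert (mu * c * chi 0 <= mu * c * 1) by (apply Rmult_le_compat_l; lra).
  assert (e * (K + mu * c * chi 0) <= e * (K + mu * c)) by (apply Rmult_le_compat_l; lra).
  generalize (Rmin_r (e * g0) (m / 2)); lra.
Qed.

Lemma Derive_n_unfold2 (f f1 f2 : R -> R) :
  (forall t, is_derive f t (f1 t)) -> (forall t, is_derive f1 t (f2 t)) ->
  (forall t, Derive f t = f1 t) /\ (forall t, Derive (Derive f) t = f2 t).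
Proof.
intros D1 D2.
assert (E : forall t, Derive f t = f1 t) by (intros t; apply is_derive_unique, D1).
split; [exact E|].
intros t. rewrite (Derive_ext (Derive f) f1 t E). apply is_derive_unique, D2.
Qed.

Lemma shoot_eigen (rho H : R -> R) (mu : R) :
  (forall t, ex_derive (Derive H) t) -> (forall t, continuity_pt (Derive (Derive H)) t) ->
  (forall t, continuity_pt (Derive rho) t) ->
  (forall p, -1 <= p <= 0 -> 0 < Derive H p) ->
  shoot_z (fun t => Derive H t ^ 3) (Derive rho) mu 0
    - mu * rho 0 * shoot_phi (fun t => Derive H t ^ 3) (Derive rho) mu 0 = 0 ->
  SL_eigen rho H mu.
Proof.
intros DG CG1 Cd HG Hm.
set (G := Derive H) in *. set (g := fun t => G t ^ 3) in *. set (d := Derive rho) in *.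
assert (DG' : forall t, is_derive G t (Derive G t)) by (intros t; apply Derive_correct, DG).
assert (Dg : forall t, is_derive g t (3 * G t ^ 2 * Derive G t)).
{ intros t. replace (3 * G t ^ 2 * Derive G t) with (INR 3 * Derive G t * G t ^ pred 3) by (simpl; ring).
  apply is_derive_pow, DG'. }
assert (CG : forall t, continuity_pt G t) by (intros t; apply (is_derive_continuity_pt _ _ _ (DG' t))).
assert (Cg : forall t, continuity_pt g t) by (intros t; apply (is_derive_continuity_pt _ _ _ (Dg t))).
assert (SD := shoot_derive g d Cg Cd mu).
destruct (shoot_initial g d mu) as [I0 I1].
set (phi := shoot_phi g d mu) in *. set (z := shoot_z g d mu) in *.
assert (D1 : forall t, is_derive phi t (g t * z t)) by (intros t; apply SD).
assert (D2 : forall t, is_derive (fun t => g t * z t) t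
   (3 * G t ^ 2 * Derive G t * z t + g t * (mu * d t * phi t))).
{ intros t. apply (is_derive_mult g z); [apply Dg|apply SD|intros; apply Rmult_comm]. }
destruct (Derive_n_unfold2 phi _ _ D1 D2) as [E1 E2].
exists phi. split; [split|split; [|split; [|split]]].
- intros [|[|[|n]]] x Hn; try lia; simpl.
  + exact I.
  + exists (g x * z x); apply D1.
  + apply ex_derive_ext with (fun t => g t * z t); [intros t; symmetry; apply E1|].
    eexists; apply D2.
- intros x. apply continuous_ext with
    (fun t => 3 * G t ^ 2 * Derive G t * z t + g t * (mu * d t * phi t)).
  + intros t; symmetry; apply E2.
  + apply continuity_pt_filterlim.
    apply (continuity_pt_plus (fun t => 3 * G t ^ 2 * Derive G t * z t) (fun t => g t * (mu * d t * phi t))).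
    * apply (continuity_pt_mult (fun t => 3 * G t ^ 2 * Derive G t) z).
      -- apply (continuity_pt_mult (fun t => 3 * G t ^ 2) (Derive G)); [|apply CG1].
         apply (continuity_pt_mult (fun _ => 3) (fun t => G t ^ 2)).
         ++ apply continuity_pt_const; intros ? ?; reflexivity.
         ++ apply (is_derive_continuity_pt _ _ _ (is_derive_pow G 2 x _ (DG' x))).
      -- apply (is_derive_continuity_pt _ _ _ (proj2 (SD x))).
    * apply (continuity_pt_mult g (fun t => mu * d t * phi t)); [apply Cg|].
      apply (continuity_pt_mult (fun t => mu * d t) phi).
      -- apply (continuity_pt_mult (fun _ => mu) d); [|apply Cd].
         apply continuity_pt_const; intros ? ?; reflexivity.
      -- apply (is_derive_continuity_pt _ _ _ (D1 x)).
(* Nontriviality: the slope of [phi] at -1 is [g (-1) > 0]. *)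
- apply NNPP; intros no.
  assert (Hneg : - (g (-1) * z (-1)) < 0).
  { rewrite I1. assert (0 < g (-1)) by (apply pow_lt, HG; lra). lra. }
  destruct (is_derive_neg_local _ _ _ (is_derive_opp _ _ _ (D1 (-1))) Hneg) as [e [He Hl]].
  assert (Hm1 : 0 < Rmin e 1 / 2 < e /\ Rmin e 1 / 2 < 1).
  { assert (0 < Rmin e 1) by (apply Rmin_glb_lt; lra).
    generalize (Rmin_l e 1) (Rmin_r e 1); lra. }
  destruct (Hl (Rmin e 1 / 2) ltac:(lra)) as [Hl1 _].
  apply no. exists (-1 + Rmin e 1 / 2). split; [lra|]. intros E.
  unfold opp in Hl1; simpl in Hl1. lra.
- intros p Hp.
  (* The identity [phi' / H_p^3 = z] is available only where H_p is known to be nonzero, hence the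
     local version. *)
  rewrite (Derive_ext_loc (fun y => Derive phi y / G y ^ 3) z).
  + rewrite (is_derive_unique _ _ _ (proj2 (SD p))). unfold phi, d. ring.
  + assert (Hd : 0 < Rmin (p + 1) (- p)) by (apply Rmin_glb_lt; lra).
    exists (mkposreal _ Hd). intros y Hy.
    unfold ball in Hy; simpl in Hy; unfold AbsRing_ball, abs, minus, plus, opp in Hy; simpl in Hy.
    apply Rabs_def2 in Hy. generalize (Rmin_l (p + 1) (- p)) (Rmin_r (p + 1) (- p)); intros.
    rewrite E1. unfold g, G. assert (HGy : 0 < Derive H y) by (apply HG; lra). field. exact (Rgt_not_eq _ _ HGy).
- exact I0.
- assert (0 < Derive H 0) by (apply HG; lra).
  rewrite E1. replace (- (g 0 * z 0) / Derive H 0 ^ 3) with (- z 0) by (unfold g, G; field; lra). lra.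
Qed.

Lemma subcritical_strict_profile (rho H : R -> R) (mucr mu : R) :
  (forall t, ex_derive (Derive H) t) -> (forall t, continuity_pt (Derive (Derive H)) t) ->
  (forall t, continuity_pt (Derive rho) t) ->
  (forall p, -1 <= p <= 0 -> 0 < Derive H p) ->
  (forall p, -1 <= p <= 0 -> Derive rho p <= 0) -> 0 < rho 0 ->
  is_mu_cr rho H mucr -> 0 < mu < mucr ->
  exists psi psi1 psi2 dl,
    strict_profile (Derive H) (Derive (Derive H)) (Derive rho) (rho 0) mu psi psi1 psi2 dl.
Proof.
intros DG CG1 Cd HG Hd Hr [_ [_ Hcr]] Hmu.
apply strict_profile_exists; auto; try lra.
- intros t; apply Derive_correct, DG.
- intros m Hm E. assert (mucr <= m); [|lra].
  apply Hcr; [lra|]. apply shoot_eigen; auto.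
Qed.

(** * The moving plane *)

(* [bg] is H', [sd] is rho', [st] is rho(0) and [fr] is 1/F^2; the profile [ps] is a strict
   supersolution of the linearised problem, which exists because F > F_cr.  The equation is
   in nondivergence form, multiplied by h_p^3, and holds up to the boundary. *)
Record solitary : Type := Solitary {
  bg : R -> R; bg1 : R -> R; sd : R -> R; st : R; fr : R;
  wv : R -> R -> R; wv_q : R -> R -> R; wv_p : R -> R -> R;
  wv_qq : R -> R -> R; wv_qp : R -> R -> R; wv_pp : R -> R -> R;
  ps : R -> R; ps1 : R -> R; ps2 : R -> R; gap : R; lo : R; hi : R;
  bg_derive : forall t, is_derive bg t (bg1 t);
  bg1_cont : forall t, continuity_pt bg1 t;
  sd_cont : forall t, continuity_pt sd t;
  bg_pos : forall p, -1 <= p <= 0 -> 0 < bg p;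
  sd_neg : forall p, -1 <= p <= 0 -> sd p <= 0;
  st_pos : 0 < st; fr_pos : 0 < fr; lo_pos : 0 < lo; hi_ge1 : 1 <= hi;
  ps_profile : strict_profile bg bg1 sd st fr ps ps1 ps2 gap;
  wv_C2 : is_C2 wv wv_q wv_p wv_qq wv_qp wv_pp;
  coef_bound : forall p, -1 <= p <= 0 ->
    Rabs (bg p) <= hi /\ Rabs (bg1 p) <= hi /\ Rabs (bg1 p / bg p ^ 3) <= hi /\ Rabs (fr * sd p) <= hi;
  wv_bound : forall q p, -1 <= p <= 0 ->
    Rabs (wv q p) <= hi /\ Rabs (wv_q q p) <= hi /\ Rabs (wv_p q p) <= hi /\
    Rabs (wv_qq q p) <= hi /\ Rabs (wv_qp q p) <= hi /\ Rabs (wv_pp q p) <= hi;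
  wv_lo : forall q p, -1 <= p <= 0 -> lo <= bg p + wv_p q p;
  wv_eq : forall q p, -1 <= p <= 0 ->
    (1 + wv_q q p ^ 2) * (bg1 p + wv_pp q p) - 2 * wv_q q p * (bg p + wv_p q p) * wv_qp q p
      + (bg p + wv_p q p) ^ 2 * wv_qq q p
      - (bg p + wv_p q p) ^ 3 * (bg1 p / bg p ^ 3 + fr * sd p * wv q p) = 0;
  wv_top : forall q, (1 + wv_q q 0 ^ 2) / (2 * (bg 0 + wv_p q 0) ^ 2) - 1 / (2 * bg 0 ^ 2)
      + fr * st * wv q 0 = 0;
  wv_bot : forall q, wv q (-1) = 0;
  wv_pos : forall q p, -1 < p <= 0 -> 0 < wv q p;
  wv_decay : forall e, 0 < e -> exists Q, forall q p, q < Q -> -1 <= p <= 0 ->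
    Rabs (wv q p) < e /\ Rabs (wv_q q p) < e /\ Rabs (wv_p q p) < e /\
    Rabs (wv_qq q p) < e /\ Rabs (wv_qp q p) < e }.

Lemma is_C2_ext f fq fp fqq fqp fpp g gq gp gqq gqp gpp :
  is_C2 f fq fp fqq fqp fpp ->
  (forall q p, f q p = g q p) -> (forall q p, fq q p = gq q p) -> (forall q p, fp q p = gp q p) ->
  (forall q p, fqq q p = gqq q p) -> (forall q p, fqp q p = gqp q p) ->
  (forall q p, fpp q p = gpp q p) -> is_C2 g gq gp gqq gqp gpp.
Proof.
intros H E1 E2 E3 E4 E5 E6.
assert (ext : forall a b : R -> R -> R, (forall q p, a q p = b q p) -> a = b).
{ intros a b E; apply functional_extensionality; intros q; apply functional_extensionality; auto. }
rewrite (ext _ _ E1), (ext _ _ E2), (ext _ _ E3), (ext _ _ E4), (ext _ _ E5), (ext _ _ E6) in H.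
exact H.
Qed.

Lemma C2_reflect l f fq fp fqq fqp fpp :
  is_C2 f fq fp fqq fqp fpp ->
  is_C2 (fun q p => f (2 * l - q) p) (fun q p => - fq (2 * l - q) p) (fun q p => fp (2 * l - q) p)
    (fun q p => fqq (2 * l - q) p) (fun q p => - fqp (2 * l - q) p) (fun q p => fpp (2 * l - q) p).
Proof.
intros H.
assert (D : forall (g : R -> R) q m, is_derive g (2 * l - q) m -> is_derive (fun t => g (2 * l - t)) q (- m)).
{ intros g q m Hg. replace (- m) with (-1 * m) by ring.
  apply (is_derive_comp g (fun t => 2 * l - t)); [exact Hg|auto_derive; [exact I|ring]]. }
assert (C : forall (g : R -> R -> R) q p, continuity_2d_pt g (2 * l - q) p ->
   continuity_2d_pt (fun q p => g (2 * l - q) p) q p).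
{ intros g q p Hg e. destruct (Hg e) as [d Hd]. exists d. intros u v Hu Hv. apply Hd; [|exact Hv].
  replace (2 * l - u - (2 * l - q)) with (- (u - q)) by ring. rewrite Rabs_Ropp; exact Hu. }
split; intros q p.
- apply (D (fun x => f x p)), H.
- apply H.
- replace (fqq (2 * l - q) p) with (- - fqq (2 * l - q) p) by ring.
  apply (is_derive_opp (fun x => fq (2 * l - x) p)), (D (fun x => fq x p)), H.
- apply (is_derive_opp (fun y => fq (2 * l - q) y)), H.
- apply (D (fun x => fp x p)), H.
- apply H.
- apply C, H.
- apply continuity_2d_pt_opp, C, H.
- apply C, H.
Qed.

(** * The difference between the mirror image and w *)

Definition dv (W : solitary) (l q p : R) : R := wv W (2 * l - q) p - wv W q p.
Definition dv_q (W : solitary) (l q p : R) : R := - wv_q W (2 * l - q) p - wv_q W q p.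
Definition dv_p (W : solitary) (l q p : R) : R := wv_p W (2 * l - q) p - wv_p W q p.
Definition dv_qq (W : solitary) (l q p : R) : R := wv_qq W (2 * l - q) p - wv_qq W q p.
Definition dv_qp (W : solitary) (l q p : R) : R := - wv_qp W (2 * l - q) p - wv_qp W q p.
Definition dv_pp (W : solitary) (l q p : R) : R := wv_pp W (2 * l - q) p - wv_pp W q p.

Lemma dv_C2 (W : solitary) (l : R) :
  is_C2 (dv W l) (dv_q W l) (dv_p W l) (dv_qq W l) (dv_qp W l) (dv_pp W l).
Proof.
apply (is_C2_ext _ _ _ _ _ _ _ _ _ _ _ _
  (C2_comb 1 _ _ _ _ _ _ _ _ _ _ _ _ (C2_reflect l _ _ _ _ _ _ (wv_C2 W)) (wv_C2 W)));
  intros; unfold dv, dv_q, dv_p, dv_qq, dv_qp, dv_pp; ring.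
Qed.

Lemma dv_axis (W : solitary) (l p : R) : dv W l l p = 0.
Proof. unfold dv. replace (2 * l - l) with l by ring. ring. Qed.

Lemma dv_bottom (W : solitary) (l q : R) : dv W l q (-1) = 0.
Proof. unfold dv. rewrite !wv_bot. ring. Qed.

Lemma wv_nonneg (W : solitary) (q p : R) : -1 <= p <= 0 -> 0 <= wv W q p.
Proof.
intros Hp. destruct (Req_dec p (-1)) as [->|E]; [rewrite wv_bot; lra|].
left; apply wv_pos; lra.
Qed.

Lemma wv_q_bottom (W : solitary) (q : R) : wv_q W q (-1) = 0.
Proof.
assert (D := C2_q _ _ _ _ _ _ (wv_C2 W) q (-1)).
rewrite <- (is_derive_unique _ _ _ D).
rewrite (Derive_ext _ (fun _ => 0)); [apply Derive_const|intros t; apply wv_bot].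
Qed.

Lemma Rabs_mult_le (x y A B : R) : Rabs x <= A -> Rabs y <= B -> Rabs (x * y) <= A * B.
Proof. intros H1 H2. rewrite Rabs_mult. apply Rmult_le_compat; auto using Rabs_pos. Qed.

Lemma Rabs_plus_le (x y A B : R) : Rabs x <= A -> Rabs y <= B -> Rabs (x + y) <= A + B.
Proof. intros H1 H2. apply Rle_trans with (1 := Rabs_triang _ _). lra. Qed.

Lemma Rabs_minus_le (x y A B : R) : Rabs x <= A -> Rabs y <= B -> Rabs (x - y) <= A + B.
Proof. intros H1 H2. apply Rabs_plus_le; [exact H1|rewrite Rabs_Ropp; exact H2]. Qed.

(* Subtracting the equations at the two mirror points gives
   L v = (h_p)^3 fr rho' v with rho' <= 0, so the zeroth-order term has the sign that makes
   a nonnegative v a supersolution of the operator without it. *)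
Lemma dv_supersolution (W : solitary) :
  exists c1 K, 0 < c1 /\ 0 < K /\ forall l q p, -1 <= p <= 0 -> 0 <= dv W l q p ->
    supersolution c1 K (K * Rabs (wv_q W (2 * l - q) p))
      (dv_q W l q p) (dv_p W l q p) (dv_qq W l q p) (dv_qp W l q p) (dv_pp W l q p).
Proof.
set (M := hi W). assert (HM : 1 <= M) by apply hi_ge1.
assert (Hlo := lo_pos W).
(* The principal matrix has determinant [P' ^ 2 >= lo W ^ 2] and trace at most [1 + 5 * M ^ 2]; the
   quotient bounds its eigenvalues from below. *)
set (c1 := lo W ^ 2 / (1 + 5 * M ^ 2)).
assert (HM2 : 0 < 1 + 5 * M ^ 2) by nra.
assert (Hc1 : 0 < c1) by (apply Rdiv_lt_0_compat; [apply pow_lt; exact Hlo|exact HM2]).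
assert (Ec1 : c1 * (1 + 5 * M ^ 2) = lo W ^ 2) by (unfold c1; field; lra).
set (K := 8 * M ^ 2 + 12 * M ^ 3 + 12 * M ^ 4).
assert (HM3 : 0 < M ^ 3) by (apply pow_lt; lra).
assert (HM4 : 0 < M ^ 4) by (apply pow_lt; lra).
assert (HK : 8 * M ^ 2 <= K) by (unfold K; lra).
exists c1, K. split; [exact Hc1|split; [nra|]].
intros l q p Hp Hv.
assert (E1 := wv_eq W (2 * l - q) p Hp). assert (E2 := wv_eq W q p Hp).
destruct (wv_bound W (2 * l - q) p Hp) as [A1 [A2 [A3 [A4 [A5 A6]]]]].
destruct (wv_bound W q p Hp) as [B1 [B2 [B3 [B4 [B5 B6]]]]].
destruct (coef_bound W p Hp) as [C1 [C2 [C3 C4]]].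
assert (L1 := wv_lo W (2 * l - q) p Hp). assert (L2 := wv_lo W q p Hp).
assert (Hsd := sd_neg W p Hp). assert (Hfr := fr_pos W).
unfold dv_q, dv_p, dv_qq, dv_qp, dv_pp. unfold dv in Hv.
fold M in A1, A2, A3, A4, A5, A6, B1, B2, B3, B4, B5, B6, C1, C2, C3, C4.
set (s' := - wv_q W (2 * l - q) p). set (s := wv_q W q p) in *.
assert (Es' : wv_q W (2 * l - q) p = - s') by (unfold s'; ring).
rewrite Es' in *. clearbody s'. rewrite Rabs_Ropp in *.
set (P' := bg W p + wv_p W (2 * l - q) p) in *. set (P := bg W p + wv_p W q p) in *.
replace (wv_p W (2 * l - q) p - wv_p W q p) with (P' - P) by (unfold P', P; ring).
assert (BP' : Rabs P' <= 2 * M) by (apply Rle_trans with (1 := Rabs_triang _ _); lra).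
assert (BP : Rabs P <= 2 * M) by (apply Rle_trans with (1 := Rabs_triang _ _); lra).
clearbody P' P.
set (rr := bg1 W p / bg W p ^ 3) in *. set (fd := fr W * sd W p) in *.
assert (Hfd : fd <= 0) by (unfold fd; nra).
set (h := wv W q p) in *. set (h' := wv W (2 * l - q) p) in *.
set (hqq := wv_qq W q p) in *. set (h'qq := wv_qq W (2 * l - q) p) in *.
set (hqp := wv_qp W q p) in *. set (h'qp := wv_qp W (2 * l - q) p) in *.
set (hpp := wv_pp W q p) in *. set (h'pp := wv_pp W (2 * l - q) p) in *.
set (g1 := bg1 W p) in *.
assert (Q1 : P' ^ 2 <= 4 * M ^ 2).
{ rewrite <- (Rabs_pos_eq (P' ^ 2)) by apply pow2_ge_0. replace (4 * M ^ 2) with (2 * M * (2 * M)) by ring.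
  simpl; rewrite Rmult_1_r. apply Rabs_mult_le; assumption. }
assert (Q2 : s' ^ 2 <= M ^ 2).
{ rewrite <- (Rabs_pos_eq (s' ^ 2)) by apply pow2_ge_0. simpl; rewrite !Rmult_1_r. apply Rabs_mult_le; assumption. }
assert (Q3 : lo W ^ 2 <= P' ^ 2) by nra.
assert (Q4 : 0 <= s' ^ 2) by apply pow2_ge_0.
(* The principal part is that of the equation at the mirror function. The differences of the
   coefficients multiply second derivatives of w itself, which thus end up in the bounded
   first-order coefficients. *)
exists (P' ^ 2), (- s' * P'), (1 + s' ^ 2),
  ((s' + s) * (g1 + hpp) - 2 * P * hqp),
  (- 2 * s' * hqp + (P' + P) * hqq - (P' ^ 2 + P' * P + P ^ 2) * (rr + fd * h)).
repeat split.
- nra.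
- assert (c1 * (1 + 5 * M ^ 2) <= 1 * (1 + 5 * M ^ 2)) by lra.
  apply Rmult_le_reg_r in H; lra.
- assert (c1 * (P' ^ 2 + 1 + s' ^ 2) <= c1 * (1 + 5 * M ^ 2)) by (apply Rmult_le_compat_l; lra).
  assert (0 <= c1 * c1) by (apply Rmult_le_pos; lra). lra.
- nra.
- nra.
- rewrite Ropp_mult_distr_l_reverse, Rabs_Ropp, Rabs_mult, Rmult_comm.
  apply Rmult_le_compat_r; [apply Rabs_pos|]. nra.
- assert (T1 : Rabs ((s' + s) * (g1 + hpp)) <= (M + M) * (M + M)).
  { apply Rabs_mult_le; apply Rabs_plus_le; assumption. }
  assert (T2 : Rabs (2 * P * hqp) <= 2 * (2 * M) * M).
  { apply Rabs_mult_le; [apply Rabs_mult_le|]; try assumption. rewrite Rabs_pos_eq; lra. }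
  assert (T := Rabs_minus_le _ _ _ _ T1 T2). nra.
- assert (T1 : Rabs (- 2 * s' * hqp) <= 2 * M * M).
  { apply Rabs_mult_le; [apply Rabs_mult_le|]; try assumption. rewrite Rabs_left; lra. }
  assert (T2 : Rabs ((P' + P) * hqq) <= (2 * M + 2 * M) * M).
  { apply Rabs_mult_le; [apply Rabs_plus_le|]; assumption. }
  assert (T3 : Rabs ((P' ^ 2 + P' * P + P ^ 2) * (rr + fd * h)) <=
     (2 * M * (2 * M) + 2 * M * (2 * M) + 2 * M * (2 * M)) * (M + M * M)).
  { simpl; rewrite !Rmult_1_r. apply Rabs_mult_le.
    - apply Rabs_plus_le; [apply Rabs_plus_le|]; apply Rabs_mult_le; assumption.
    - apply Rabs_plus_le; [assumption|apply Rabs_mult_le; assumption]. }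
  assert (T := Rabs_minus_le _ _ _ _ (Rabs_plus_le _ _ _ _ T1 T2) T3).
  apply Rle_trans with (1 := T). unfold K. nra.
- match goal with |- ?x <= 0 => replace x with (P' ^ 3 * (fd * (h' - h))) end.
  + assert (0 <= P' ^ 3) by (apply pow_le; lra). assert (0 <= - fd * (h' - h)) by (apply Rmult_le_pos; lra).
    assert (0 <= P' ^ 3 * (- fd * (h' - h))) by (apply Rmult_le_pos; lra). lra.
  + lra.
Qed.

(* [g + a] and [g + a + t] are the height slopes of w and of its mirror image, both close to
   the background [g]. *)
Lemma perturbed_operator (B e g a t s x y z f1 f2 f3 rr fd : R) :
  1 <= B -> 0 < e <= 1 -> Rabs g <= B -> Rabs f1 <= B -> Rabs f2 <= B -> Rabs f3 <= B ->
  Rabs rr <= B -> Rabs fd <= B ->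
  Rabs a <= e -> Rabs t <= e -> Rabs s <= e -> Rabs x <= e -> Rabs y <= e -> Rabs z <= e ->
  Rabs (((1 + s ^ 2) * f3 - 2 * s * f2 * x + (2 * (g + a) + t) * f2 * y
     - ((g + a + t) ^ 2 + (g + a + t) * (g + a) + (g + a) ^ 2) * f2 * (rr + fd * z)
     - (g + a + t) ^ 3 * fd * f1)
   - (f3 - 3 * g ^ 2 * f2 * rr - g ^ 3 * fd * f1)) <= 100 * B ^ 4 * e.
Proof.
intros HB He Hg H1 H2 H3 Hrr Hfd Ha Ht Hs Hx Hy Hz.
assert (He1 : e <= B) by lra.
set (b := a + t).
assert (Hb : Rabs b <= 2 * e) by (unfold b; replace (2 * e) with (e + e) by ring; apply Rabs_plus_le; assumption).
assert (HP : Rabs (g + a) <= 2 * B).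
{ replace (2 * B) with (B + B) by ring. apply Rabs_plus_le; lra. }
assert (HP' : Rabs (g + b) <= 3 * B).
{ replace (3 * B) with (B + 2 * B) by ring. apply Rabs_plus_le; lra. }
replace (g + a + t) with (g + b) by (unfold b; ring).
replace (2 * (g + a) + t) with ((g + a) + (g + b)) by (unfold b; ring).
assert (T1 : Rabs (s * s * f3) <= e * 1 * B) by (repeat apply Rabs_mult_le; lra).
assert (T2 : Rabs (2 * s * f2 * x) <= 2 * 1 * B * e).
{ repeat apply Rabs_mult_le; try lra. rewrite Rabs_pos_eq; lra. }
assert (T3 : Rabs (((g + a) + (g + b)) * f2 * y) <= (2 * B + 3 * B) * B * e).
{ repeat apply Rabs_mult_le; try lra. apply Rabs_plus_le; lra. }
assert (T4 : Rabs ((b * (g + b + g) + (b * (g + a) + g * a) + a * (g + a + g)) * f2 * rr)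
   <= ((2 * e * (3 * B + B)) + (2 * e * (2 * B) + B * e) + e * (2 * B + B)) * B * B).
{ repeat apply Rabs_mult_le; try lra.
  repeat apply Rabs_plus_le; repeat apply Rabs_mult_le; try lra; apply Rabs_plus_le; lra. }
assert (T5 : Rabs (((g + b) * (g + b) + (g + b) * (g + a) + (g + a) * (g + a)) * f2 * (fd * z))
   <= (3 * B * (3 * B) + 3 * B * (2 * B) + 2 * B * (2 * B)) * B * (B * e)).
{ repeat apply Rabs_mult_le; try lra. repeat apply Rabs_plus_le; apply Rabs_mult_le; lra. }
assert (T6 : Rabs (b * ((g + b) * (g + b) + (g + b) * g + g * g) * fd * f1)
   <= 2 * e * (3 * B * (3 * B) + 3 * B * B + B * B) * B * B).
{ repeat apply Rabs_mult_le; try lra. repeat apply Rabs_plus_le; apply Rabs_mult_le; lra. }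
assert (B2 : B <= B ^ 2) by nra.
assert (B3 : B ^ 2 <= B ^ 3) by (simpl in *; nra).
assert (B4 : B ^ 3 <= B ^ 4) by (replace (B ^ 4) with (B * B ^ 3) by ring; assert (0 < B ^ 3) by (apply pow_lt; lra); nra).
match goal with |- Rabs ?lhs <= _ => replace lhs with
  (s * s * f3 - 2 * s * f2 * x + ((g + a) + (g + b)) * f2 * y
   - (b * (g + b + g) + (b * (g + a) + g * a) + a * (g + a + g)) * f2 * rr
   - ((g + b) * (g + b) + (g + b) * (g + a) + (g + a) * (g + a)) * f2 * (fd * z)
   - b * ((g + b) * (g + b) + (g + b) * g + g * g) * fd * f1) by ring end.
apply Rle_trans with (1 := Rabs_minus_le _ _ _ _ (Rabs_minus_le _ _ _ _ (Rabs_minus_le _ _ _ _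
  (Rabs_plus_le _ _ _ _ (Rabs_minus_le _ _ _ _ T1 T2) T3) T4) T5) T6).
assert (U1 : e * B <= e * B ^ 4) by (apply Rmult_le_compat_l; lra).
assert (U2 : e * B ^ 2 <= e * B ^ 4) by (apply Rmult_le_compat_l; lra).
assert (U3 : e * B ^ 3 <= e * B ^ 4) by (apply Rmult_le_compat_l; lra).
assert (U4 : 0 <= e * B ^ 4) by (apply Rmult_le_pos; lra).
lra.
Qed.

(** Surface counterpart of [perturbed_operator]: the difference of the two surface conditions,
    cleared of denominators and of the factor [k]. The limit [m * f1 * g ^ 4 - f2 * g] is [g ^ 4]
    times the left side of [sp_top]. *)
Lemma perturbed_boundary (B e g a t s f1 f2 m : R) :
  1 <= B -> 0 < e <= 1 -> Rabs g <= B -> Rabs f2 <= B -> Rabs (m * f1) <= B ->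
  Rabs a <= e -> Rabs t <= e -> Rabs s <= e ->
  Rabs ((m * f1 * (g + a) ^ 2 * (g + a + t) ^ 2 - (1 + s ^ 2) * f2 * (g + a + t / 2))
   - (m * f1 * g ^ 4 - f2 * g)) <= 100 * B ^ 4 * e.
Proof.
intros HB He Hg H2 Hm Ha Ht Hs.
set (b := a + t).
assert (Hb : Rabs b <= 2 * e) by (unfold b; replace (2 * e) with (e + e) by ring; apply Rabs_plus_le; assumption).
assert (HP : Rabs (g + a) <= 2 * B).
{ replace (2 * B) with (B + B) by ring. apply Rabs_plus_le; lra. }
assert (HP' : Rabs (g + b) <= 3 * B).
{ replace (3 * B) with (B + 2 * B) by ring. apply Rabs_plus_le; lra. }
assert (Ht2 : Rabs (t / 2) <= e).
{ unfold Rdiv. rewrite Rabs_mult, (Rabs_pos_eq (/ 2)) by lra. lra. }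
replace (g + a + t) with (g + b) by (unfold b; ring).
assert (T1 : Rabs (m * f1 * ((b * (g + a) + g * a) * ((g + a) * (g + b) + g * g)))
   <= B * ((2 * e * (2 * B) + B * e) * (2 * B * (3 * B) + B * B))).
{ repeat apply Rabs_mult_le; try lra; apply Rabs_plus_le; apply Rabs_mult_le; lra. }
assert (T2 : Rabs (f2 * ((a + t / 2) + s * s * (g + a + t / 2))) <= B * ((e + e) + e * 1 * (2 * B + B))).
{ repeat apply Rabs_mult_le; try lra. apply Rabs_plus_le; [apply Rabs_plus_le; lra|].
  repeat apply Rabs_mult_le; try lra. apply Rabs_plus_le; lra. }
match goal with |- Rabs ?lhs <= _ => replace lhs with
  (m * f1 * ((b * (g + a) + g * a) * ((g + a) * (g + b) + g * g))
   - f2 * ((a + t / 2) + s * s * (g + a + t / 2))) by field end.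
apply Rle_trans with (1 := Rabs_minus_le _ _ _ _ T1 T2).
assert (B2 : B <= B ^ 2) by nra.
assert (B3 : B ^ 2 <= B ^ 3) by (simpl in *; nra).
assert (B4 : B ^ 3 <= B ^ 4) by (replace (B ^ 4) with (B * B ^ 3) by ring; assert (0 < B ^ 3) by (apply pow_lt; lra); nra).
assert (U1 : e * B <= e * B ^ 4) by (apply Rmult_le_compat_l; lra).
assert (U2 : e * B ^ 2 <= e * B ^ 4) by (apply Rmult_le_compat_l; lra).
assert (U3 : e * B ^ 3 <= e * B ^ 4) by (apply Rmult_le_compat_l; lra).
assert (U4 : 0 <= e * B ^ 4) by (apply Rmult_le_pos; lra).
lra.
Qed.

(** [k] is the minimum of v / ps on the closed half strip. In product form it says that v - k ps,
    which is again of class C^2, has the minimum value 0. *)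
Definition negative_min (W : solitary) (l q p k : R) : Prop :=
  q < l /\ -1 < p <= 0 /\ k < 0 /\ dv W l q p = k * ps W p /\
  forall q' p', q' <= l -> -1 <= p' <= 0 -> k * ps W p' <= dv W l q' p'.

Lemma ps_C2 (W : solitary) :
  is_C2 (fun _ p => ps W p) (fun _ _ => 0) (fun _ p => ps1 W p)
    (fun _ _ => 0) (fun _ _ => 0) (fun _ p => ps2 W p).
Proof.
destruct (ps_profile W) as [d1 d2 c2 _ _ _ _].
apply (is_C2_ext _ _ _ _ _ _ _ _ _ _ _ _ (C2_prod (fun _ => 1) (fun _ => 0) (fun _ => 0) (ps W) (ps1 W) (ps2 W)
  (is_derive_cst 1) (is_derive_cst 0)
  (fun t => continuity_pt_const (fun _ => 0) t (fun _ _ => eq_refl)) d1 d2 c2)); intros; simpl; ring.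
Qed.

Lemma negative_min_gradient (W : solitary) (l q p k : R) :
  negative_min W l q p k ->
  dv_q W l q p = 0 /\ dv_p W l q p <= k * ps1 W p /\
  (p < 0 -> dv_p W l q p = k * ps1 W p /\
     forall a11 a12 a22, 0 < a22 -> a12 * a12 <= a11 * a22 ->
       0 <= a11 * dv_qq W l q p + 2 * a12 * dv_qp W l q p + a22 * (dv_pp W l q p - k * ps2 W p)).
Proof.
intros [Hq [Hp [Hk [E Hmin]]]].
assert (HC := C2_comb k _ _ _ _ _ _ _ _ _ _ _ _ (dv_C2 W l) (ps_C2 W)).
split; [|split].
- apply (is_derive_local_min (fun x => dv W l x p) q _ (l - q)); [apply dv_C2|lra|].
  intros h Hh. apply Rabs_def2 in Hh. rewrite E. apply Hmin; lra.
(* The point may lie on the surface, where only points below are available for comparison. *)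
- assert (dv_p W l q p - k * ps1 W p <= 0); [|lra].
  apply (is_derive_left_min (fun y => dv W l q y - k * ps W y) p _ (p + 1)); [apply HC|lra|].
  intros h Hh. specialize (Hmin q (p - h) ltac:(lra) ltac:(lra)). lra.
- intros Hp0.
  assert (Hd : 0 < Rmin (l - q) (Rmin (p + 1) (- p))) by (repeat apply Rmin_glb_lt; lra).
  assert (loc : forall x y, Rabs (x - q) < Rmin (l - q) (Rmin (p + 1) (- p)) ->
      Rabs (y - p) < Rmin (l - q) (Rmin (p + 1) (- p)) ->
      dv W l q p - k * ps W p <= dv W l x y - k * ps W y).
  { intros x y Hx Hy. apply Rabs_def2 in Hx, Hy.
    generalize (Rmin_l (l - q) (Rmin (p + 1) (- p))) (Rmin_r (l - q) (Rmin (p + 1) (- p)))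
      (Rmin_l (p + 1) (- p)) (Rmin_r (p + 1) (- p)); intros.
    specialize (Hmin x y ltac:(lra) ltac:(lra)). lra. }
  split.
  + destruct (local_min_2d _ _ _ _ _ _ q p _ 1 0 1 HC Hd loc) as [_ [G _]]; lra.
  + intros a11 a12 a22 H22 Hdet.
    destruct (local_min_2d _ _ _ _ _ _ q p _ a11 a12 a22 HC Hd loc) as [_ [_ G]]; lra.
Qed.

Lemma ps_bounds (W : solitary) : exists B ps0, 1 <= B /\ hi W <= B /\ 0 < ps0 /\
  forall p, -1 <= p <= 0 -> ps0 <= ps W p /\ Rabs (ps W p) <= B /\ Rabs (ps1 W p) <= B /\
    Rabs (ps2 W p) <= B /\ Rabs (fr W * st W * ps W p) <= B.
Proof.
destruct (ps_profile W) as [d1 d2 c2 pos _ _ _].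
assert (C0 : forall t, continuity_pt (ps W) t) by (intros t; apply (is_derive_continuity_pt _ _ _ (d1 t))).
assert (C1 : forall t, continuity_pt (ps1 W) t) by (intros t; apply (is_derive_continuity_pt _ _ _ (d2 t))).
destruct (continuous_bounded (ps W) (-1) 0 ltac:(lra) C0) as [B0 [H0 B0']].
destruct (continuous_bounded (ps1 W) (-1) 0 ltac:(lra) C1) as [B1 [H1 B1']].
destruct (continuous_bounded (ps2 W) (-1) 0 ltac:(lra) c2) as [B2 [H2 B2']].
destruct (continuity_ab_min (ps W) (-1) 0 ltac:(lra)) as [m [Hm Hm']]; [intros; apply C0|].
assert (Hfs : 0 < fr W * st W) by (apply Rmult_lt_0_compat; [apply fr_pos|apply st_pos]).
assert (HfB : 0 <= fr W * st W * B0) by (apply Rmult_le_pos; lra).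
assert (Hh := hi_ge1 W).
exists (hi W + B0 + B1 + B2 + fr W * st W * B0), (ps W m).
split; [lra|split; [lra|split; [apply pos; exact Hm'|]]].
intros p Hp. specialize (B0' p Hp). specialize (B1' p Hp). specialize (B2' p Hp).
split; [apply Hm; exact Hp|]. repeat split; try lra.
rewrite Rabs_mult, (Rabs_pos_eq (fr W * st W)) by lra.
assert (fr W * st W * Rabs (ps W p) <= fr W * st W * B0) by (apply Rmult_le_compat_l; lra). lra.
Qed.

(* At a negative minimum of v / ps the mirror value and gradient are close to those of w,
   hence small; the second derivatives of the mirror function enter only through the Hessian
   of v, which has a sign. *)
Lemma no_negative_min_far_left (W : solitary) :
  exists N, forall l q p k, q < N -> ~ negative_min W l q p k.
Proof.
destruct (ps_bounds W) as [B [ps0 [HB [HhB [Hps0 Bps]]]]].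
destruct (ps_profile W) as [_ _ _ pos Hgap Hint Htop].
set (dl := gap W) in *.
assert (HB4 : 0 < 100 * B ^ 4) by (assert (0 < B ^ 4) by (apply pow_lt; lra); lra).
assert (Hg0 : 0 < bg W 0) by (apply bg_pos; lra).
assert (Hg4 : 0 < bg W 0 ^ 4) by (apply pow_lt; exact Hg0).
set (D := Rmin dl (dl * bg W 0 ^ 4)).
assert (HD : 0 < D) by (apply Rmin_glb_lt; [exact Hgap|apply Rmult_lt_0_compat; assumption]).
assert (HD1 : D <= dl) by apply Rmin_l. assert (HD2 : D <= dl * bg W 0 ^ 4) by apply Rmin_r.
set (e := Rmin 1 (D / (2 * (100 * B ^ 4)))).
assert (He : 0 < e) by (apply Rmin_glb_lt; [lra|apply Rdiv_lt_0_compat; lra]).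
assert (He1 : e <= 1) by apply Rmin_l.
assert (He2 : 100 * B ^ 4 * e < D).
{ assert (e <= D / (2 * (100 * B ^ 4))) by apply Rmin_r.
  apply Rmult_le_compat_l with (r := 100 * B ^ 4) in H; [|lra].
  replace (100 * B ^ 4 * (D / (2 * (100 * B ^ 4)))) with (D / 2) in H by (field; lra). lra. }
clearbody e D.
set (eta := Rmin e (e * ps0 / B)).
assert (Heta : 0 < eta).
{ apply Rmin_glb_lt; [exact He|]. apply Rdiv_lt_0_compat; [apply Rmult_lt_0_compat; assumption|lra]. }
destruct (wv_decay W eta Heta) as [N HN].
exists N. intros l q p k Hq Hmin.
destruct (negative_min_gradient W l q p k Hmin) as [G1 [G2 G3]].
destruct Hmin as [Hql [Hp [Hk [E Hall]]]].
assert (Hp' : -1 <= p <= 0) by lra.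
destruct (HN q p Hq Hp') as [S0 [S1 [S2 [S3 S4]]]].
assert (Ht1 : eta <= e) by apply Rmin_l.
assert (Ht2 : eta <= e * ps0 / B) by apply Rmin_r.
destruct (Bps p Hp') as [P0 [P1 [P2 [P3 P4]]]].
assert (Hpsp := pos p Hp').
assert (Hw' := wv_nonneg W (2 * l - q) p Hp').
assert (Hw := wv_nonneg W q p Hp').
unfold dv in E.
(* The mirror value is nonnegative, so [- k * ps W p <= wv W q p < eta]. Hence [k] is small, and
   with it [k * ps1 W p], by which the slopes of w and of its mirror image are compared. *)
assert (Htk : Rabs (k * ps1 W p) <= e).
{ rewrite Rabs_mult, (Rabs_left k) by exact Hk.
  assert (- k * ps W p <= eta) by (apply Rabs_def2 in S0; lra).
  assert (- k * ps0 <= eta) by (apply Rle_trans with (2 := H); apply Rmult_le_compat_l; lra).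
  assert (- k * ps0 <= e * ps0 / B) by lra.
  assert (- k * B <= e).
  { apply Rmult_le_reg_r with (ps0 / B); [apply Rdiv_lt_0_compat; lra|].
    replace (- k * B * (ps0 / B)) with (- k * ps0) by (field; lra).
    replace (e * (ps0 / B)) with (e * ps0 / B) by (field; lra). exact H1. }
  apply Rle_trans with (2 := H2). apply Rmult_le_compat_l; lra. }
destruct (coef_bound W p Hp') as [C1 [C2 [C3 C4]]].
destruct (Rle_lt_dec 0 p) as [Hp0|Hp0].
- assert (p = 0) by lra. subst p.
  assert (L1 := wv_lo W (2 * l - q) 0 Hp'). assert (L2 := wv_lo W q 0 Hp').
  assert (T1 := wv_top W (2 * l - q)). assert (T2 := wv_top W q).
  assert (Hlo := lo_pos W).
  unfold dv_q in G1. unfold dv_p in G2.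
  replace (wv_q W (2 * l - q) 0) with (- wv_q W q 0) in T1 by lra.
  set (s := wv_q W q 0) in *. set (g := bg W 0) in *. set (a := wv_p W q 0) in *.
  set (a' := wv_p W (2 * l - q) 0) in *. set (t := k * ps1 W 0) in *.
  assert (PB := perturbed_boundary B e g a t s (ps W 0) (ps1 W 0) (fr W * st W) HB (conj He He1)
     ltac:(lra) P2 P4 ltac:(lra) Htk ltac:(lra)).
  assert (HPt : 0 < g + a + t) by lra.
  assert (HPa : 0 < g + a) by lra.
  (* The mirror slope is at most [g + a + t]; with this value in its place the mirror condition
     becomes an inequality, from which the factor [k] can be divided out. *)
  assert (Hbr : 0 <= fr W * st W * ps W 0 * (g + a) ^ 2 * (g + a + t) ^ 2
      - (1 + s ^ 2) * ps1 W 0 * (g + a + t / 2)).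
  { assert (inv : / (g + a + t) ^ 2 <= / (g + a') ^ 2).
    { apply Rinv_le_contravar; [apply pow_lt; lra|]. apply pow_incr; lra. }
    assert (Hs2 : 0 <= s ^ 2) by apply pow2_ge_0.
    assert (I1 : (1 + s ^ 2) / 2 * (/ (g + a + t) ^ 2) <= (1 + s ^ 2) / 2 * (/ (g + a') ^ 2))
      by (apply Rmult_le_compat_l; lra).
    assert (I2 : (1 + s ^ 2) / 2 * (/ (g + a + t) ^ 2) - (1 + s ^ 2) / 2 * (/ (g + a) ^ 2)
        + fr W * st W * (k * ps W 0) <= 0).
    { replace ((1 + (- s) ^ 2) / (2 * (g + a') ^ 2)) with ((1 + s ^ 2) / 2 * / (g + a') ^ 2) in T1
        by (field; lra).
      replace ((1 + s ^ 2) / (2 * (g + a) ^ 2)) with ((1 + s ^ 2) / 2 * / (g + a) ^ 2) in T2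
        by (field; lra).
      replace (wv W (2 * l - q) 0) with (wv W q 0 + k * ps W 0) in T1 by lra. lra. }
    apply Rmult_le_reg_l with (- k); [lra|]. rewrite Rmult_0_r.
    assert (Z : 0 < (g + a) ^ 2 * (g + a + t) ^ 2) by (apply Rmult_lt_0_compat; apply pow_lt; lra).
    apply Rmult_le_compat_r with (r := (g + a) ^ 2 * (g + a + t) ^ 2) in I2; [|lra].
    rewrite Rmult_0_l in I2.
    replace (((1 + s ^ 2) / 2 * / (g + a + t) ^ 2 - (1 + s ^ 2) / 2 * / (g + a) ^ 2 +
      fr W * st W * (k * ps W 0)) * ((g + a) ^ 2 * (g + a + t) ^ 2))
      with (- (- k * (fr W * st W * ps W 0 * (g + a) ^ 2 * (g + a + t) ^ 2
         - (1 + s ^ 2) * ps1 W 0 * (g + a + t / 2)))) in I2 by (unfold t; field; fold t; lra).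
    lra. }
  assert (Htop' : fr W * st W * ps W 0 * g ^ 4 - ps1 W 0 * g <= - (dl * g ^ 4)).
  { apply Rmult_le_compat_r with (r := g ^ 4) in Htop; [|lra].
    replace ((fr W * st W * ps W 0 - ps1 W 0 / g ^ 3) * g ^ 4)
      with (fr W * st W * ps W 0 * g ^ 4 - ps1 W 0 * g) in Htop by (field; lra). lra. }
  apply Rabs_le_between in PB. lra.
- destruct (G3 Hp0) as [G4 G5].
  assert (L1 := wv_lo W (2 * l - q) p Hp'). assert (L2 := wv_lo W q p Hp').
  assert (E1 := wv_eq W (2 * l - q) p Hp'). assert (E2 := wv_eq W q p Hp').
  specialize (Hint p Hp').
  assert (Hgp := bg_pos W p Hp').
  assert (Hlo := lo_pos W).
  unfold dv_q in G1. unfold dv_p in G4. unfold dv_qq, dv_qp, dv_pp in G5.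
  replace (wv_q W (2 * l - q) p) with (- wv_q W q p) in E1 by lra.
  replace (wv_p W (2 * l - q) p) with (wv_p W q p + k * ps1 W p) in E1, L1 by lra.
  replace (wv W (2 * l - q) p) with (wv W q p + k * ps W p) in E1 by lra.
  set (s := wv_q W q p) in *. set (g := bg W p) in *. set (a := wv_p W q p) in *.
  set (t := k * ps1 W p) in *.
  assert (PB := perturbed_operator B e g a t s (wv_qp W q p) (wv_qq W q p) (wv W q p)
     (ps W p) (ps1 W p) (ps2 W p) (bg1 W p / g ^ 3) (fr W * sd W p) HB (conj He He1)
     ltac:(lra) P1 P2 P3 ltac:(lra) ltac:(lra) ltac:(lra) Htk ltac:(lra) ltac:(lra) ltac:(lra) ltac:(lra)).
  (* The Hessian test is made with the principal part at the mirror function. By the two equations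
     its result is [- k] times the bracket of [perturbed_operator], which is negative. *)
  specialize (G5 ((g + a + t) ^ 2) (- s * (g + a + t)) (1 + s ^ 2)).
  specialize (G5 ltac:(assert (0 <= s ^ 2) by apply pow2_ge_0; lra)).
  specialize (G5 ltac:(assert (0 <= (g + a + t) ^ 2) by apply pow2_ge_0; lra)).
  replace (ps2 W p - 3 * ps1 W p * (bg1 W p / g) - fr W * sd W p * g ^ 3 * ps W p)
    with (ps2 W p - 3 * g ^ 2 * ps1 W p * (bg1 W p / g ^ 3) - g ^ 3 * (fr W * sd W p) * ps W p)
    in Hint by (field; lra).
  set (rr := bg1 W p / g ^ 3) in *. set (fd := fr W * sd W p) in *.
  apply Rabs_le_between in PB.
  assert (Hbr : (1 + s ^ 2) * ps2 W p - 2 * s * ps1 W p * wv_qp W q p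
     + (2 * (g + a) + t) * ps1 W p * wv_qq W q p
     - ((g + a + t) ^ 2 + (g + a + t) * (g + a) + (g + a) ^ 2) * ps1 W p * (rr + fd * wv W q p)
     - (g + a + t) ^ 3 * fd * ps W p < 0) by lra.
  match type of Hbr with ?b < 0 => assert (0 <= - k * b) end; [|nra].
  match type of G5 with 0 <= ?z => apply Rle_trans with (1 := G5); apply Req_le end.
  unfold t in *. lra.
Qed.

(** Far to the left v is at least - w, which is close to zero, so the infimum of v / ps is attained
    at a finite point. That point lies neither on the axis nor on the bottom, where v is zero. *)
Lemma negative_min_exists (W : solitary) (l q1 p1 : R) :
  q1 <= l -> -1 <= p1 <= 0 -> dv W l q1 p1 < 0 -> exists q p k, negative_min W l q p k.
Proof.
intros Hq1 Hp1 Hneg.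
destruct (ps_bounds W) as [B [ps0 [HB [_ [Hps0 Bps]]]]].
destruct (ps_profile W) as [d1 _ _ pos _ _ _].
set (k0 := dv W l q1 p1 / ps W p1).
assert (Hk0 : k0 < 0).
{ unfold k0. apply Rmult_neg_pos; [exact Hneg|]. apply Rinv_0_lt_compat, pos, Hp1. }
destruct (wv_decay W (- k0 * ps0)) as [Q HQ]; [apply Rmult_lt_0_compat; lra|].
set (a := Rmin Q q1).
assert (Ha1 : a <= Q) by apply Rmin_l. assert (Ha2 : a <= q1) by apply Rmin_r.
destruct (min_attained_2d a l (-1) 0 (fun q p => a <= q <= l /\ -1 <= p <= 0)
   (fun q p => dv W l q p * / ps W p) q1 p1) as [q [p [[Hq Hp] Hmin]]].
{ intros x y H; exact H. }
{ intros x y H. repeat split; apply Rnot_lt_le; intros Hlt.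
  - destruct (H (a - x) ltac:(lra)) as [x' [y' [H1 [H2 H3]]]]. apply Rabs_def2 in H2; lra.
  - destruct (H (x - l) ltac:(lra)) as [x' [y' [H1 [H2 H3]]]]. apply Rabs_def2 in H2; lra.
  - destruct (H (-1 - y) ltac:(lra)) as [x' [y' [H1 [H2 H3]]]]. apply Rabs_def2 in H3; lra.
  - destruct (H (y - 0) ltac:(lra)) as [x' [y' [H1 [H2 H3]]]]. apply Rabs_def2 in H3; lra. }
{ intros x y [_ Hy]. apply continuity_2d_pt_mult; [apply (C2_c _ _ _ _ _ _ (dv_C2 W l))|].
  apply continuity_2d_pt_inv.
  - apply (C2_c _ _ _ _ _ _ (ps_C2 W)).
  - apply Rgt_not_eq, pos, Hy. }
{ split; lra. }
set (k := dv W l q p * / ps W p) in *.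
assert (Hk : k <= k0) by (apply (Hmin q1 p1); split; lra).
assert (Hpp := pos p Hp).
assert (E : dv W l q p = k * ps W p) by (unfold k; field; lra).
exists q, p, k. repeat split; try lra.
- destruct (Req_dec q l) as [->|]; [|lra]. rewrite dv_axis in E. nra.
- destruct (Req_dec p (-1)) as [->|]; [|lra]. rewrite dv_bottom in E. nra.
- intros q' p' Hq' Hp'. destruct (Bps p' Hp') as [P0 _].
  destruct (Rle_lt_dec a q') as [Haq|Haq].
  + specialize (Hmin q' p' (conj (conj Haq Hq') Hp')).
    apply Rmult_le_compat_r with (r := ps W p') in Hmin; [|lra].
    rewrite Rmult_assoc, Rinv_l in Hmin by lra. lra.
  + destruct (HQ q' p' ltac:(lra) Hp') as [D _]. apply Rabs_def2 in D.
    assert (N := wv_nonneg W (2 * l - q') p' Hp'). unfold dv.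
    assert (k * ps W p' <= k * ps0) by nra.
    assert (k * ps0 <= k0 * ps0) by (apply Rmult_le_compat_r; lra).
    lra.
Qed.

(** * Admissible positions of the plane *)

Definition plane_ok (W : solitary) (l : R) : Prop :=
  forall q p, q <= l -> -1 <= p <= 0 -> 0 <= dv W l q p.

Lemma plane_ok_far_left (W : solitary) : exists N, forall l, l < N -> plane_ok W l.
Proof.
destruct (no_negative_min_far_left W) as [N HN]. exists N. intros l Hl q p Hq Hp.
apply Rnot_lt_le; intros Hneg.
destruct (negative_min_exists W l q p Hq Hp Hneg) as [q' [p' [k Hmin]]].
apply (HN l q' p' k); [destruct Hmin; lra|exact Hmin].
Qed.

Lemma lipschitz_of_derive_bound (f f' : R -> R) (a b M : R) :
  (forall t, is_derive f t (f' t)) ->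
  (forall t, Rmin a b <= t <= Rmax a b -> Rabs (f' t) <= M) ->
  Rabs (f b - f a) <= M * Rabs (b - a).
Proof.
intros D B. destruct (MVT_gen f a b f') as [c [Hc E]].
- intros; apply D.
- intros; apply (is_derive_continuity_pt _ _ _ (D _)).
- rewrite E, Rabs_mult. apply Rmult_le_compat_r; [apply Rabs_pos|apply B, Hc].
Qed.

Lemma supersolution_weaken c0 K A A' vq vp vqq vqp vpp :
  A <= A' -> supersolution c0 K A vq vp vqq vqp vpp -> supersolution c0 K A' vq vp vqq vqp vpp.
Proof.
intros HA [a11 [a12 [a22 [b1 [b2 H]]]]]. exists a11, a12, a22, b1, b2.
repeat split; try tauto. apply Rle_trans with A; tauto.
Qed.

Lemma is_derive_cont_along (f fq fp fqq fqp fpp : R -> R -> R) :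
  is_C2 f fq fp fqq fqp fpp ->
  (forall q p, continuity_pt (fun x => f x p) q) /\ (forall q p, continuity_pt (fun y => f q y) p).
Proof.
intros H; split; intros q p.
- exact (is_derive_continuity_pt _ _ _ (C2_q _ _ _ _ _ _ H q p)).
- exact (is_derive_continuity_pt _ _ _ (C2_p _ _ _ _ _ _ H q p)).
Qed.

(** The function is the left side of the surface condition multiplied by [2 g^2 (g + fp)^2], so that
    no quotient has to be differentiated. *)
Lemma top_condition_derivative (f fq fp : R -> R) (g m q l0 l1 l2 : R) :
  is_derive f q l0 -> is_derive fq q l1 -> is_derive fp q l2 ->
  is_derive (fun x => g ^ 2 * (1 + fq x ^ 2) - (1 - 2 * g ^ 2 * m * f x) * (g + fp x) ^ 2) q
   (g ^ 2 * (2 * fq q * l1)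
    - ((- (2 * g ^ 2 * m * l0)) * (g + fp q) ^ 2
       + (1 - 2 * g ^ 2 * m * f q) * (2 * (g + fp q) * l2))).
Proof.
intros D0 D1 D2. auto_derive; [repeat split; eexists; eassumption|].
replace (Derive (fun x : R => f x) q) with l0 by (symmetry; apply (is_derive_unique f q l0 D0)).
replace (Derive (fun x : R => fq x) q) with l1 by (symmetry; apply (is_derive_unique fq q l1 D1)).
replace (Derive (fun x : R => fp x) q) with l2 by (symmetry; apply (is_derive_unique fp q l2 D2)).
ring.
Qed.

(* Differentiating the top condition along the boundary, at a critical point of w. *)
Lemma wv_qp_top (W : solitary) (q : R) : wv_q W q 0 = 0 -> wv_qp W q 0 = 0.
Proof.
intros Hq.
assert (HP : 0 < bg W 0 + wv_p W q 0) by (apply Rlt_le_trans with (1 := lo_pos W), wv_lo; lra).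
assert (Hg : 0 < bg W 0) by (apply bg_pos; lra).
assert (T : forall x, bg W 0 ^ 2 * (1 + wv_q W x 0 ^ 2)
   - (1 - 2 * bg W 0 ^ 2 * (fr W * st W) * wv W x 0) * (bg W 0 + wv_p W x 0) ^ 2 = 0).
{ intros x. assert (HPx : 0 < bg W 0 + wv_p W x 0) by (apply Rlt_le_trans with (1 := lo_pos W), wv_lo; lra).
  assert (Tx := wv_top W x).
  apply Rmult_eq_reg_l with (/ (2 * bg W 0 ^ 2 * (bg W 0 + wv_p W x 0) ^ 2)).
  - rewrite Rmult_0_r. apply eq_trans with (2 := Tx). field. lra.
  - apply Rinv_neq_0_compat. apply Rgt_not_eq. repeat apply Rmult_lt_0_compat; try apply pow_lt; lra. }
assert (Dq := C2_qq _ _ _ _ _ _ (wv_C2 W) q 0).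
assert (Dp := C2_pq _ _ _ _ _ _ (wv_C2 W) q 0).
assert (D0 := C2_q _ _ _ _ _ _ (wv_C2 W) q 0).
set (f := fun x => wv W x 0) in *. set (fq := fun x => wv_q W x 0) in *. set (fp := fun x => wv_p W x 0) in *.
set (g := bg W 0) in *. set (m := fr W * st W) in *.
assert (D := top_condition_derivative f fq fp g m q _ _ _ D0 Dq Dp).
assert (Z := is_derive_unique _ _ _ D).
rewrite (Derive_ext _ (fun _ => 0)) in Z by (intros t; apply T). rewrite Derive_const in Z.
assert (Tq := T q).
change (fq q) with (wv_q W q 0) in Z. rewrite Hq in Z.
change (fp q) with (wv_p W q 0) in Z. change (f q) with (wv W q 0) in Z.
rewrite Hq in Tq.
(* At a zero of w_q the differentiated condition reduces to [A (g + w_p) w_qp = 0], and the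
   condition itself, [A (g + w_p)^2 = g^2], keeps the first two factors from vanishing. *)
set (A := 1 - 2 * g ^ 2 * m * wv W q 0) in *.
assert (HA : A * (g + wv_p W q 0) ^ 2 = g ^ 2) by lra.
assert (HA' : A * (g + wv_p W q 0) <> 0).
{ intros E. replace (A * (g + wv_p W q 0) ^ 2) with (A * (g + wv_p W q 0) * (g + wv_p W q 0)) in HA by ring.
  rewrite E in HA. assert (0 < g ^ 2) by (apply pow_lt; exact Hg). lra. }
apply Rmult_eq_reg_l with (A * (g + wv_p W q 0)); [lra|exact HA'].
Qed.

(** One clause for each place where negative minima for nearby planes could accumulate: the interior
    or the surface, the bottom, the axis, and the lower end of the axis, where v and its gradient
    vanish. *)
Record plane_strict (W : solitary) (l : R) : Prop := {
  pl_int : forall q p, q < l -> -1 < p <= 0 -> 0 < dv W l q p;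
  pl_bot : forall q, q < l -> 0 < dv_p W l q (-1);
  pl_axis : forall p, -1 < p <= 0 -> dv_q W l l p < 0;
  pl_corner : dv_qp W l l (-1) < 0 }.

(** The strong minimum principle gives the interior, Hopf's lemma the surface, the bottom and the
    open axis, and the corner lemma the two ends of the axis. *)
Lemma plane_ok_strict (W : solitary) (l q0 p0 : R) :
  plane_ok W l -> q0 <= l -> -1 <= p0 <= 0 -> dv W l q0 p0 <> 0 -> plane_strict W l.
Proof.
intros Hok Hq0 Hp0 Hne.
destruct (dv_supersolution W) as [c1 [K [Hc1 [HK Hsup]]]].
assert (HC := dv_C2 W l).
assert (Hsup' : forall q p, q <= l -> -1 <= p <= 0 ->
   supersolution c1 K (K * Rabs (wv_q W (2 * l - q) p))
      (dv_q W l q p) (dv_p W l q p) (dv_qq W l q p) (dv_qp W l q p) (dv_pp W l q p)).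
{ intros q p Hq Hp. apply Hsup; [exact Hp|apply Hok; assumption]. }
assert (Hpos0 : 0 < dv W l q0 p0) by (specialize (Hok q0 p0 Hq0 Hp0); lra).
assert (interior : forall q p, q < l -> -1 < p < 0 -> 0 < dv W l q p).
{ apply (strong_minimum_half_strip c1 K l (fun q p => K * Rabs (wv_q W (2 * l - q) p)) _ _ _ _ _ _ Hc1 HK HC).
  - intros q p Hq Hp. split; [apply Hok|apply Hsup']; lra.
  - destruct (C2_c _ _ _ _ _ _ HC q0 p0 (mkposreal _ Hpos0)) as [e He]; simpl in He.
    set (h := Rmin (e / 2) (/ 4)).
    assert (Hh : 0 < h) by (apply Rmin_glb_lt; [generalize (cond_pos e)|]; lra).
    assert (h1 : h <= e / 2) by apply Rmin_l. assert (h2 : h <= / 4) by apply Rmin_r.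
    assert (Hee := cond_pos e).
    (* The given point may lie on the boundary; it is moved to the left and towards the middle of
       the strip. *)
    set (p' := if Rle_dec p0 (-1/2) then p0 + h else p0 - h).
    exists (q0 - h), p'.
    assert (Rabs (q0 - h - q0) < e) by (apply Rabs_def1; lra).
    assert (Rabs (p' - p0) < e) by (unfold p'; destruct (Rle_dec p0 (-1/2)); apply Rabs_def1; lra).
    specialize (He (q0 - h) p' H H0). apply Rabs_def2 in He.
    split; [lra|split; [unfold p'; destruct (Rle_dec p0 (-1/2)); lra|lra]]. }
assert (mem : forall q1 p1 r q p, 0 <= r -> dist2 q1 p1 q p <= r ^ 2 ->
   q1 - r <= q <= q1 + r /\ p1 - r <= p <= p1 + r).
{ intros q1 p1 r q p Hr Hd. destruct (dist2_bound q1 p1 q p r Hr Hd) as [A1 A2].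
  apply Rabs_le_between in A1, A2. lra. }
assert (hopf : forall q1 p1 r n1 n2, 0 < r -> q1 + r <= l -> -1 <= p1 - r -> p1 + r <= 0 ->
   n1 ^ 2 + n2 ^ 2 = 1 -> dv W l (q1 + r * n1) (p1 + r * n2) = 0 ->
   dv_q W l (q1 + r * n1) (p1 + r * n2) * n1 + dv_p W l (q1 + r * n1) (p1 + r * n2) * n2 < 0).
{ intros q1 p1 r n1 n2 Hr H1 H2 H3 Hn Hz.
  apply (hopf_ball c1 K q1 p1 r n1 n2 (fun q p => K * Rabs (wv_q W (2 * l - q) p)) _ _ _ _ _ _ Hc1 HK Hr HC); auto.
  - intros q p Hd. destruct (mem q1 p1 r q p ltac:(lra) Hd). apply Hok; lra.
  - apply interior; lra.
  - intros q p Hd. destruct (mem q1 p1 r q p ltac:(lra) (Rlt_le _ _ Hd)). apply Hsup'; lra. }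
(* At a zero on the surface, w and its mirror image have equal values and equal squares of the
   q-derivative, so the surface condition forces equal slopes h_p, whereas Hopf's lemma makes the
   mirror slope smaller. *)
assert (top : forall q, q < l -> 0 < dv W l q 0).
{ intros q Hq. destruct (Req_dec (dv W l q 0) 0) as [Hz|Hz].
  2: { assert (0 <= dv W l q 0) by (apply Hok; lra). lra. }
  exfalso.
  set (r := Rmin (/ 4) (l - q)).
  assert (Hr : 0 < r) by (apply Rmin_glb_lt; lra).
  assert (r1 : r <= / 4) by apply Rmin_l. assert (r2 : r <= l - q) by apply Rmin_r.
  assert (Hh := hopf q (- r) r 0 1 Hr ltac:(lra) ltac:(lra) ltac:(lra) ltac:(ring)).
  replace (q + r * 0) with q in Hh by ring. replace (- r + r * 1) with 0 in Hh by ring.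
  specialize (Hh Hz).
  assert (Gq : dv_q W l q 0 = 0).
  { apply (is_derive_local_min (fun x => dv W l x 0) q _ (l - q)); [apply HC|lra|].
    intros h Hh'. apply Rabs_def2 in Hh'. rewrite Hz. apply Hok; lra. }
  assert (L1 := wv_lo W (2 * l - q) 0 ltac:(lra)). assert (L2 := wv_lo W q 0 ltac:(lra)).
  assert (T1 := wv_top W (2 * l - q)). assert (T2 := wv_top W q). assert (Hlo := lo_pos W).
  unfold dv_q in Gq. unfold dv in Hz. unfold dv_p in Hh.
  replace (wv_q W (2 * l - q) 0) with (- wv_q W q 0) in T1 by lra.
  replace (wv W (2 * l - q) 0) with (wv W q 0) in T1 by lra.
  set (P' := bg W 0 + wv_p W (2 * l - q) 0) in *. set (P := bg W 0 + wv_p W q 0) in *.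
  assert (HPP : P' < P) by (unfold P, P'; lra).
  assert (HP2 : P' ^ 2 < P ^ 2) by nra.
  assert (Hs2 : 0 <= wv_q W q 0 ^ 2) by apply pow2_ge_0.
  assert (HP0 : 0 < P' ^ 2) by (apply pow_lt; lra).
  assert (HI : / P ^ 2 < / P' ^ 2) by (apply Rinv_lt_contravar; [apply Rmult_lt_0_compat; lra|exact HP2]).
  assert ((1 + wv_q W q 0 ^ 2) / 2 * / P ^ 2 < (1 + wv_q W q 0 ^ 2) / 2 * / P' ^ 2)
    by (apply Rmult_lt_compat_l; lra).
  replace ((1 + (- wv_q W q 0) ^ 2) / (2 * P' ^ 2)) with ((1 + wv_q W q 0 ^ 2) / 2 * / P' ^ 2) in T1
    by (field; lra).
  replace ((1 + wv_q W q 0 ^ 2) / (2 * P ^ 2)) with ((1 + wv_q W q 0 ^ 2) / 2 * / P ^ 2) in T2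
    by (field; lra).
  lra. }
assert (inside : forall q p, q < l -> -1 < p <= 0 -> 0 < dv W l q p).
{ intros q p Hq Hp. destruct (Req_dec p 0) as [->|]; [apply top; exact Hq|apply interior; lra]. }
assert (bottom : forall q, q < l -> 0 < dv_p W l q (-1)).
{ intros q Hq.
  set (r := Rmin (/ 4) (l - q)).
  assert (Hr : 0 < r) by (apply Rmin_glb_lt; lra).
  assert (r1 : r <= / 4) by apply Rmin_l. assert (r2 : r <= l - q) by apply Rmin_r.
  assert (Hh := hopf q (-1 + r) r 0 (-1) Hr ltac:(lra) ltac:(lra) ltac:(lra) ltac:(ring)).
  replace (q + r * 0) with q in Hh by ring. replace (-1 + r + r * -1) with (-1) in Hh by ring.
  specialize (Hh (dv_bottom W l q)). lra. }
assert (side : forall p, -1 < p < 0 -> dv_q W l l p < 0).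
{ intros p Hp.
  set (r := Rmin (p + 1) (- p)).
  assert (Hr : 0 < r) by (apply Rmin_glb_lt; lra).
  assert (r1 : r <= p + 1) by apply Rmin_l. assert (r2 : r <= - p) by apply Rmin_r.
  assert (Hh := hopf (l - r) p r 1 0 Hr ltac:(lra) ltac:(lra) ltac:(lra) ltac:(ring)).
  replace (l - r + r * 1) with l in Hh by ring. replace (p + r * 0) with p in Hh by ring.
  specialize (Hh (dv_axis W l p)). lra. }
destruct (is_derive_cont_along _ _ _ _ _ _ HC) as [Cq Cp].
assert (Hhi := hi_ge1 W).
(* At a corner where [wv_q] is zero the mixed coefficient vanishes linearly, as the corner lemma
   requires. *)
assert (lipq : forall q p pc, q <= l -> -1 <= p <= 0 -> -1 <= pc <= 0 -> wv_q W l pc = 0 ->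
   Rabs (wv_q W (2 * l - q) p) <= hi W * ((l - q) + Rabs (p - pc))).
{ intros q p pc Hq Hp Hpc Hz.
  assert (A1 := lipschitz_of_derive_bound (fun x => wv_q W x p) (fun x => wv_qq W x p) l (2 * l - q) (hi W)
    (fun t => C2_qq _ _ _ _ _ _ (wv_C2 W) t p) (fun t _ => proj1 (proj2 (proj2 (proj2 (wv_bound W t p Hp)))))).
  assert (A2 := lipschitz_of_derive_bound (fun y => wv_q W l y) (fun y => wv_qp W l y) pc p (hi W)
    (fun t => C2_qp _ _ _ _ _ _ (wv_C2 W) l t)).
  specialize (A2 ltac:(intros t Ht; apply wv_bound; unfold Rmin, Rmax in Ht; destruct (Rle_dec pc p); lra)).
  simpl in A1, A2. rewrite Hz in A2. rewrite (Rabs_pos_eq (2 * l - q - l)) in A1 by lra.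
  replace (wv_q W (2 * l - q) p) with ((wv_q W (2 * l - q) p - wv_q W l p) + (wv_q W l p - 0)) by ring.
  apply Rle_trans with (1 := Rabs_triang _ _). lra. }
assert (side_bound : forall p r, 0 < r -> -1 < p < 0 -> exists k, 0 < k /\
   forall q, l - r <= q <= l -> k * (l - q) <= dv W l q p).
{ intros p r Hr Hp.
  destruct (lower_linear_bound (fun x => dv W l (l - x) p) r (- dv_q W l l p) Hr) as [k [Hk Hb]].
  - replace (- dv_q W l l p) with (-1 * dv_q W l l p) by ring.
    apply (is_derive_comp (fun x => dv W l x p) (fun x => l - x)).
    + rewrite Rminus_0_r. apply HC.
    + auto_derive; [exact I|ring].
  - intros x. apply (continuity_pt_comp (fun x => l - x) (fun x => dv W l x p)); [|apply Cq].
    apply (is_derive_continuity_pt _ _ (-1)); auto_derive; [exact I|ring].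
  - intros x Hx. apply inside; lra.
  - right. rewrite Rminus_0_r, dv_axis. specialize (side p Hp). lra.
  - exists k. split; [exact Hk|]. intros q Hq. specialize (Hb (l - q) ltac:(lra)).
    replace (l - (l - q)) with q in Hb by ring. exact Hb. }
split; [exact inside|exact bottom| |].
- intros p Hp. destruct (Req_dec p 0) as [->|]; [|apply side; lra].
  assert (Hle : dv_q W l l 0 <= 0).
  { apply (is_derive_left_min (fun x => dv W l x 0) l _ 1); [apply HC|lra|].
    intros h Hh. rewrite dv_axis. apply Hok; lra. }
  (* If v_q vanished at the surface corner, so would w_q, and [wv_qp_top] would make v_qp zero
     there, against the strict sign given by the corner lemma. *)
  destruct (Req_dec (dv_q W l l 0) 0) as [Hz|]; [exfalso|lra].
  assert (Hwq : wv_q W l 0 = 0).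
  { unfold dv_q in Hz. replace (2 * l - l) with l in Hz by ring. lra. }
  assert (Hwqp := wv_qp_top W l Hwq).
  assert (Hc := corner_mixed_derivative c1 K (K * hi W) l 0 (-1) (/ 2) (dv W l) (dv_q W l) (dv_p W l)
    (dv_qq W l) (dv_qp W l) (dv_pp W l) Hc1 HK ltac:(apply Rmult_le_pos; lra) ltac:(lra) ltac:(right; reflexivity) HC).
  assert (-1 * dv_qp W l l 0 < 0).
  { apply Hc; [| | | | |exact Hz].
    - intros q p' Hq Hp'. apply Hok; lra.
    - intros q p' Hq Hp'. apply supersolution_weaken with (2 := Hsup' q p' ltac:(lra) ltac:(lra)).
      rewrite Rmult_assoc. apply Rmult_le_compat_l; [lra|].
      apply Rle_trans with (1 := lipq q p' 0 ltac:(lra) ltac:(lra) ltac:(lra) Hwq).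
      rewrite (Rabs_left (p' - 0)) by lra. right; ring.
    - intros r Hr.
      destruct (lower_linear_bound (fun y => dv W l (l - r) (- y)) (/ 2) (- dv_p W l (l - r) 0)) as [k [Hk Hb]].
      + lra.
      + replace (- dv_p W l (l - r) 0) with (-1 * dv_p W l (l - r) (- 0)) by (rewrite Ropp_0; ring).
        apply (is_derive_comp (fun y => dv W l (l - r) y) Ropp); [apply HC|auto_derive; [exact I|ring]].
      + intros x. apply (continuity_pt_comp Ropp (fun x => dv W l (l - r) x)); [|apply Cp].
        apply (is_derive_continuity_pt _ _ (-1)); auto_derive; [exact I|ring].
      + intros x Hx. apply inside; lra.
      + left. rewrite Ropp_0. apply inside; lra.
      + exists k. split; [exact Hk|]. intros p' Hp'. specialize (Hb (- p') ltac:(lra)).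
        rewrite Ropp_involutive in Hb. replace (-1 * (p' - 0)) with (- p') by ring. exact Hb.
    - intros r Hr. apply (side_bound (0 + -1 * r) r); lra.
    - intros p' _. apply dv_axis. }
  unfold dv_qp in H. replace (2 * l - l) with l in H by ring. lra.
- assert (Hwq : wv_q W l (-1) = 0) by apply wv_q_bottom.
  assert (Hz : dv_q W l l (-1) = 0) by (unfold dv_q; rewrite !wv_q_bottom; ring).
  assert (Hc := corner_mixed_derivative c1 K (K * hi W) l (-1) 1 (/ 2) (dv W l) (dv_q W l) (dv_p W l)
    (dv_qq W l) (dv_qp W l) (dv_pp W l) Hc1 HK ltac:(apply Rmult_le_pos; lra) ltac:(lra) ltac:(left; reflexivity) HC).
  assert (1 * dv_qp W l l (-1) < 0); [|lra].
  apply Hc; [| | | | |exact Hz].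
  + intros q p' Hq Hp'. apply Hok; lra.
  + intros q p' Hq Hp'. apply supersolution_weaken with (2 := Hsup' q p' ltac:(lra) ltac:(lra)).
    rewrite Rmult_assoc. apply Rmult_le_compat_l; [lra|].
    apply Rle_trans with (1 := lipq q p' (-1) ltac:(lra) ltac:(lra) ltac:(lra) Hwq).
    rewrite (Rabs_pos_eq (p' - -1)) by lra. right; ring.
  + intros r Hr.
    destruct (lower_linear_bound (fun y => dv W l (l - r) (-1 + y)) (/ 2) (dv_p W l (l - r) (-1))) as [k [Hk Hb]].
    * lra.
    * replace (dv_p W l (l - r) (-1)) with (1 * dv_p W l (l - r) (-1 + 0)) by (rewrite Rplus_0_r; ring).
      apply (is_derive_comp (fun y => dv W l (l - r) y) (fun y => -1 + y)); [apply HC|auto_derive; [exact I|ring]].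
    * intros x. apply (continuity_pt_comp (fun y => -1 + y) (fun x => dv W l (l - r) x)); [|apply Cp].
      apply (is_derive_continuity_pt _ _ 1); auto_derive; [exact I|ring].
    * intros x Hx. apply inside; lra.
    * right. rewrite Rplus_0_r. split; [apply dv_bottom|apply bottom; lra].
    * exists k. split; [exact Hk|]. intros p' Hp'. specialize (Hb (p' + 1) ltac:(lra)).
      replace (-1 + (p' + 1)) with p' in Hb by ring. replace (1 * (p' - -1)) with (p' + 1) by ring. exact Hb.
  + intros r Hr. apply (side_bound (-1 + 1 * r) r); lra.
  + intros p' _. apply dv_axis.
Qed.

Lemma mirror_continuity (f : R -> R -> R) (l q p e : R) :
  (forall x y, continuity_2d_pt f x y) -> 0 < e ->
  exists d, 0 < d /\ forall l' q' p', Rabs (l' - l) < d -> Rabs (q' - q) < d -> Rabs (p' - p) < d ->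
    Rabs (f (2 * l' - q') p' - f (2 * l - q) p) < e /\ Rabs (f q' p' - f q p) < e.
Proof.
intros Cf He.
destruct (Cf (2 * l - q) p (mkposreal e He)) as [d1 H1].
destruct (Cf q p (mkposreal e He)) as [d2 H2]. simpl in H1, H2.
assert (P1 := cond_pos d1). assert (P2 := cond_pos d2).
exists (Rmin (d1 / 3) d2). split; [apply Rmin_glb_lt; lra|].
intros l' q' p' Hl Hq Hp.
assert (M1 : Rmin (d1 / 3) d2 <= d1 / 3) by apply Rmin_l.
assert (M2 : Rmin (d1 / 3) d2 <= d2) by apply Rmin_r.
split; [apply H1|apply H2]; try lra.
apply Rabs_def2 in Hl, Hq. apply Rabs_def1; lra.
Qed.

Lemma squeeze_zero (x : R) : (forall e, 0 < e -> Rabs x < e) -> x = 0.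
Proof.
intros H. destruct (Req_dec x 0) as [|E]; [assumption|].
assert (P := Rabs_pos_lt x E). specialize (H _ P); lra.
Qed.

Lemma plane_ok_closed (W : solitary) (l : R) :
  (forall e, 0 < e -> exists l', Rabs (l' - l) < e /\ l' <= l /\ plane_ok W l') -> plane_ok W l.
Proof.
intros H q p Hq Hp. apply Rnot_lt_le; intros Hneg.
destruct (mirror_continuity (wv W) l q p (- dv W l q p / 4)) as [d [Hd HD]]; [apply (C2_c _ _ _ _ _ _ (wv_C2 W))|lra|].
destruct (H d Hd) as [l' [H1 [H2 H3]]].
specialize (H3 (q + (l' - l)) p ltac:(lra) Hp).
destruct (HD l' (q + (l' - l)) p H1) as [A1 A2].
{ replace (q + (l' - l) - q) with (l' - l) by ring. exact H1. }
{ rewrite Rminus_diag, Rabs_R0. exact Hd. }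
apply Rabs_def2 in A1, A2. unfold dv in *. lra.
Qed.

(** Otherwise planes arbitrarily close on the right have negative minima of v / ps. These stay to
    the right of a bound independent of the plane, so they accumulate at a point where v <= 0 and
    v_q = 0. Each clause of [plane_strict] excludes this in its own region. *)
Lemma plane_strict_open (W : solitary) (l : R) :
  plane_strict W l -> exists e, 0 < e /\ forall l', l < l' < l + e -> plane_ok W l'.
Proof.
intros HS. apply NNPP; intros no.
destruct (no_negative_min_far_left W) as [N HN].
destruct (ps_bounds W) as [B [ps0 [HB [_ [Hps0 Bps]]]]].
assert (HC := wv_C2 W).
destruct (cluster_point_2d (Rmin N l) (l + 1) (-1) 0
  (fun e q p => exists l' k, l < l' < l + e /\ negative_min W l' q p k)) as [q [p [Hq [Hp Hcl]]]].
{ intros e e' x y He Hee [l' [k [H1 H2]]]. exists l', k. split; [lra|exact H2]. }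
{ intros e He. apply NNPP; intros H. apply no.
  exists (Rmin e 1). split; [apply Rmin_glb_lt; lra|].
  assert (M1 := Rmin_l e 1). assert (M2 := Rmin_r e 1).
  intros l' Hl' q p Hq Hp. apply Rnot_lt_le; intros Hneg. apply H.
  destruct (negative_min_exists W l' q p Hq Hp Hneg) as [x [y [k Hmin]]].
  exists x, y. split; [split|split].
  - apply Rnot_lt_le; intros Hlt. apply (HN l' x y k); [|exact Hmin].
    apply Rlt_le_trans with (1 := Hlt), Rmin_l.
  - destruct Hmin; lra.
  - destruct Hmin as [_ [Hy _]]; lra.
  - exists l', k. split; [lra|exact Hmin]. }
assert (Hql : q <= l).
{ apply Rnot_lt_le; intros Hlt. destruct (Hcl ((q - l) / 2) ltac:(lra)) as [x [y [_ [_ [H1 [_ [l' [k [H2 Hmin]]]]]]]]].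
  destruct Hmin as [Hx _]. apply Rabs_def2 in H1. lra. }
assert (near : forall e, 0 < e -> forall (f : R -> R -> R), (forall x y, continuity_2d_pt f x y) ->
   exists l' x y k, negative_min W l' x y k /\ Rabs (y - p) < e /\
     Rabs (f (2 * l' - x) y - f (2 * l - q) p) < e /\ Rabs (f x y - f q p) < e /\
     Rabs (dv W l' x y - dv W l q p) < e).
{ intros e He f Cf.
  destruct (mirror_continuity f l q p e Cf He) as [d1 [Hd1 H1]].
  destruct (mirror_continuity (wv W) l q p (e / 2) (C2_c _ _ _ _ _ _ HC) ltac:(lra)) as [d2 [Hd2 H2]].
  set (d := Rmin e (Rmin d1 d2)).
  assert (Hd : 0 < d) by (repeat apply Rmin_glb_lt; assumption).
  assert (M0 : d <= e) by apply Rmin_l.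
  assert (M1 : d <= d1) by (apply Rle_trans with (1 := Rmin_r _ _), Rmin_l).
  assert (M2 : d <= d2) by (apply Rle_trans with (1 := Rmin_r _ _), Rmin_r).
  destruct (Hcl d Hd) as [x [y [_ [_ [Hx [Hy [l' [k [Hl' Hmin]]]]]]]]].
  assert (Hl2 : Rabs (l' - l) < d) by (apply Rabs_def1; lra).
  exists l', x, y, k. split; [exact Hmin|split; [lra|]].
  destruct (H1 l' x y ltac:(lra) ltac:(lra) ltac:(lra)) as [A1 A2].
  destruct (H2 l' x y ltac:(lra) ltac:(lra) ltac:(lra)) as [A3 A4].
  split; [exact A1|split; [exact A2|]].
  unfold dv. apply Rabs_def2 in A3, A4. apply Rabs_def1; lra. }
assert (Hv : dv W l q p <= 0).
{ apply Rnot_lt_le; intros Hlt.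
  destruct (near (dv W l q p) Hlt (wv W) (C2_c _ _ _ _ _ _ HC)) as [l' [x [y [k [Hmin [_ [_ [_ A]]]]]]]].
  destruct Hmin as [_ [Hy [Hk [E _]]]].
  assert (0 < ps W y) by (destruct (Bps y ltac:(lra)); lra).
  apply Rabs_def2 in A. nra. }
assert (Hgq : dv_q W l q p = 0).
{ apply squeeze_zero. intros e He.
  destruct (near (e / 2) ltac:(lra) (wv_q W) (C2_cq _ _ _ _ _ _ HC)) as [l' [x [y [k [Hmin [_ [A1 [A2 _]]]]]]]].
  destruct (negative_min_gradient _ _ _ _ _ Hmin) as [G _].
  unfold dv_q in *. apply Rabs_def2 in A1, A2. apply Rabs_def1; lra. }
destruct (Req_dec p (-1)) as [->|Hp1].
- destruct (Req_dec q l) as [->|Hql'].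
  + assert (Hc := pl_corner W l HS).
    set (m := - dv_qp W l l (-1)). assert (Hm : 0 < m) by (unfold m; lra).
    destruct (mirror_continuity (wv_qp W) l l (-1) (m / 2)) as [d [Hd HD]]; [apply HC|lra|].
    destruct (Hcl d Hd) as [x [y [_ [Hy0 [Hx [Hy [l' [k [Hl' Hmin]]]]]]]]].
    destruct (negative_min_gradient _ _ _ _ _ Hmin) as [G _].
    destruct Hmin as [_ [Hy1 _]].
    (* v_q is zero at the minimum and on the bottom below it, so v_qp has a zero in between. These
       zeros tend to the corner, where v_qp is negative. *)
    destruct (MVT_gen (fun t => dv_q W l' x t) (-1) y (fun t => dv_qp W l' x t)) as [c [Hc1 Hc2]].
    * intros; apply dv_C2.
    * intros. apply (is_derive_continuity_pt _ _ _ (C2_qp _ _ _ _ _ _ (dv_C2 W l') x _)).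
    * rewrite Rmin_left, Rmax_right in Hc1 by lra.
      rewrite G in Hc2. unfold dv_q in Hc2 at 1. rewrite !wv_q_bottom in Hc2.
      assert (Z : dv_qp W l' x c = 0).
      { assert (dv_qp W l' x c * (y - -1) = 0) by lra. apply Rmult_integral in H. lra. }
      apply Rabs_def2 in Hy.
      destruct (HD l' x c) as [A1 A2]; [apply Rabs_def1; lra|exact Hx|apply Rabs_def1; lra|].
      unfold dv_qp in *. apply Rabs_def2 in A1, A2. unfold m in *. lra.
  + assert (Hb := pl_bot W l HS q ltac:(lra)).
    set (m := dv_p W l q (-1)) in *.
    (* At a minimum below the surface v_p equals [k * ps1], and [k] is small because v is; the
       constants bring [k * ps1] below a quarter of the positive limit [m] of v_p. The bound 1 keeps
       the minimum below the surface. *)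
    set (e := Rmin 1 (Rmin (m / 4) (m * ps0 / (4 * B)))).
    assert (He : 0 < e).
    { repeat apply Rmin_glb_lt; try lra. apply Rdiv_lt_0_compat; [apply Rmult_lt_0_compat; assumption|lra]. }
    assert (M0 : e <= 1) by apply Rmin_l.
    assert (M1 : e <= m / 4) by (apply Rle_trans with (1 := Rmin_r _ _), Rmin_l).
    assert (M2 : e <= m * ps0 / (4 * B)) by (apply Rle_trans with (1 := Rmin_r _ _), Rmin_r).
    destruct (near e He (wv_p W) (C2_cp _ _ _ _ _ _ HC)) as [l' [x [y [k [Hmin [Hy [A1 [A2 A3]]]]]]]].
    destruct (negative_min_gradient _ _ _ _ _ Hmin) as [_ [_ G]].
    destruct Hmin as [_ [Hy1 [Hk [E _]]]].
    apply Rabs_def2 in Hy. destruct (G ltac:(lra)) as [G' _].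
    destruct (Bps y ltac:(lra)) as [P0 [_ [P1 _]]].
    rewrite dv_bottom, Rminus_0_r, E in A3.
    assert (D : - k * ps0 < m * ps0 / (4 * B)).
    { apply Rle_lt_trans with (Rabs (k * ps W y)); [|lra].
      rewrite Rabs_mult, (Rabs_left k), (Rabs_pos_eq (ps W y)) by lra.
      apply Rmult_le_compat_l; lra. }
    assert (D' : - k * B < m / 4).
    { apply Rmult_lt_reg_r with (ps0 / B); [apply Rdiv_lt_0_compat; lra|].
      replace (- k * B * (ps0 / B)) with (- k * ps0) by (field; lra).
      replace (m / 4 * (ps0 / B)) with (m * ps0 / (4 * B)) by (field; lra). exact D. }
    assert (D2 : Rabs (k * ps1 W y) <= - k * B).
    { rewrite Rabs_mult, (Rabs_left k) by lra. apply Rmult_le_compat_l; lra. }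
    apply Rabs_le_between in D2. apply Rabs_def2 in A1, A2.
    unfold m, dv_p in *. lra.
- destruct (Req_dec q l) as [->|Hql'].
  + assert (Ha := pl_axis W l HS p ltac:(lra)). lra.
  + assert (Hi := pl_int W l HS q p ltac:(lra) ltac:(lra)). lra.
Qed.

Lemma moving_plane (W : solitary) :
  (forall l, plane_ok W l) \/
  exists ls, (forall l, l <= ls -> plane_ok W l) /\
    forall q p, q <= ls -> -1 <= p <= 0 -> dv W ls q p = 0.
Proof.
destruct (classic (forall l, plane_ok W l)) as [|H]; [left; assumption|right].
apply not_all_ex_not in H. destruct H as [l1 Hl1].
destruct (plane_ok_far_left W) as [N HN].
set (E := fun l => forall l', l' <= l -> plane_ok W l').
destruct (completeness E) as [s [Hs1 Hs2]].
{ exists l1. intros l El. apply Rnot_lt_le; intros Hlt. apply Hl1, El. lra. }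
{ exists (N - 1). intros l' Hl'. apply HN. lra. }
assert (below : forall l, l < s -> plane_ok W l).
{ intros l Hl. apply NNPP; intros Hn. assert (s <= l); [|lra].
  apply Hs2. intros l' El'. apply Rnot_lt_le; intros Hlt. apply Hn, El'. lra. }
assert (Es : E s).
{ intros l Hl. destruct (Req_dec l s) as [->|]; [|apply below; lra].
  apply plane_ok_closed. intros e He. exists (s - e / 2).
  split; [apply Rabs_def1; lra|split; [lra|apply below; lra]]. }
exists s. split; [exact Es|].
intros q p Hq Hp. apply NNPP; intros Hne.
assert (HS := plane_ok_strict W s q p (Es s (Rle_refl s)) Hq Hp Hne).
destruct (plane_strict_open W s HS) as [e [He Ho]].
assert (s + e / 2 <= s); [|lra].
apply Hs1. intros l' Hl'. destruct (Rle_lt_dec l' s) as [H|H]; [apply Es; exact H|apply Ho; lra].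
Qed.

Lemma symmetric_of_plane (W : solitary) (ls : R) :
  (forall l, l <= ls -> plane_ok W l) ->
  (forall q p, q <= ls -> -1 <= p <= 0 -> dv W ls q p = 0) ->
  (forall q p, -1 <= p <= 0 -> wv W (ls + q) p = wv W (ls - q) p) /\
  (forall q p, -1 < p <= 0 -> q < ls -> 0 < wv_q W q p) /\
  (forall q p, -1 < p <= 0 -> ls < q -> wv_q W q p < 0).
Proof.
intros Hok Hz.
assert (even : forall q p, -1 <= p <= 0 -> wv W (ls + q) p = wv W (ls - q) p).
{ assert (half : forall q p, 0 <= q -> -1 <= p <= 0 -> wv W (ls + q) p = wv W (ls - q) p).
  { intros q p Hq Hp. specialize (Hz (ls - q) p ltac:(lra) Hp). unfold dv in Hz.
    replace (2 * ls - (ls - q)) with (ls + q) in Hz by ring. lra. }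
  intros q p Hp. destruct (Rle_lt_dec 0 q) as [H|H]; [apply half; assumption|].
  specialize (half (- q) p ltac:(lra) Hp).
  replace (ls + - q) with (ls - q) in half by ring. replace (ls - - q) with (ls + q) in half by ring.
  symmetry; exact half. }
assert (incr : forall q p, -1 < p <= 0 -> q < ls -> 0 < wv_q W q p).
{ intros l p Hp Hl.
  assert (Hne : exists q0, q0 <= l /\ dv W l q0 0 <> 0).
  { apply NNPP; intros no.
    assert (Hl0 : forall q, q <= l -> wv W (2 * l - q) 0 = wv W q 0).
    { intros q Hq. apply NNPP; intros Hne. apply no. exists q. split; [exact Hq|]. unfold dv. lra. }
    (* the two symmetries make w(., 0) periodic, against its decay *)
    assert (per : forall q, q <= l -> wv W q 0 = wv W (q - 2 * (ls - l)) 0).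
    { intros q Hq. rewrite <- (Hl0 (q - 2 * (ls - l)) ltac:(lra)).
      replace (2 * l - (q - 2 * (ls - l))) with (ls + (ls - q)) by ring. rewrite even by lra. f_equal. ring. }
    assert (pern : forall n, wv W l 0 = wv W (l - INR n * (2 * (ls - l))) 0).
    { induction n as [|n IH]; [simpl; f_equal; ring|].
      rewrite IH, per, S_INR.
      - f_equal. ring.
      - assert (0 <= INR n) by apply pos_INR. nra. }
    assert (Hpos : 0 < wv W l 0) by (apply wv_pos; lra).
    destruct (wv_decay W _ Hpos) as [Q HQ].
    destruct (INR_unbounded ((l - Q) / (2 * (ls - l)))) as [n Hn].
    assert (Hn' : l - Q < INR n * (2 * (ls - l))).
    { apply Rmult_lt_compat_r with (r := 2 * (ls - l)) in Hn; [|lra].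
      unfold Rdiv in Hn. rewrite Rmult_assoc, Rinv_l in Hn by lra. lra. }
    destruct (HQ (l - INR n * (2 * (ls - l))) 0 ltac:(lra) ltac:(lra)) as [A _].
    rewrite <- pern in A. rewrite Rabs_pos_eq in A by lra. lra. }
  destruct Hne as [q0 [Hq0 Hne]].
  assert (HS := plane_ok_strict W l q0 0 (Hok l ltac:(lra)) Hq0 ltac:(lra) Hne).
  assert (A := pl_axis W l HS p Hp). unfold dv_q in A. replace (2 * l - l) with l in A by ring. lra. }
split; [exact even|split; [exact incr|]].
intros q p Hp Hq.
assert (D : wv_q W q p = - wv_q W (2 * ls - q) p).
{ assert (D1 := C2_q _ _ _ _ _ _ (C2_reflect ls _ _ _ _ _ _ (wv_C2 W)) q p).
  assert (D2 := C2_q _ _ _ _ _ _ (wv_C2 W) q p).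
  rewrite <- (is_derive_unique _ _ _ D1), <- (is_derive_unique _ _ _ D2).
  apply Derive_ext. intros t.
  replace (2 * ls - t) with (ls - (t - ls)) by ring. rewrite <- even by lra. f_equal; ring. }
rewrite D. assert (0 < wv_q W (2 * ls - q) p) by (apply incr; lra). lra.
Qed.

(** * Nonexistence of fronts *)

Lemma continuity_2d_slice (F : R -> R -> R) (q p : R) :
  continuity_2d_pt F q p -> continuous (fun y => F q y) p.
Proof.
intros H. apply continuity_pt_filterlim. intros e He.
destruct (H (mkposreal e He)) as [d Hd]; simpl in Hd.
exists d. split; [apply cond_pos|]. intros y [_ Hy]. simpl in *. unfold Rdist in *.
apply Hd; [rewrite Rminus_diag, Rabs_R0; apply cond_pos|exact Hy].
Qed.

Lemma ex_RInt_slice (F : R -> R -> R) (a b q : R) : a <= b ->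
  (forall p, a <= p <= b -> continuity_2d_pt F q p) -> ex_RInt (fun p => F q p) a b.
Proof.
intros Hab H. apply (ex_RInt_continuous (fun p => F q p)).
rewrite Rmin_left, Rmax_right by exact Hab. intros z Hz. apply continuity_2d_slice, H, Hz.
Qed.

Lemma is_derive_RInt_strip (F Fq : R -> R -> R) (a b : R) : a <= b ->
  (forall q p, a <= p <= b -> locally_2d (fun u v => is_derive (fun x => F x v) u (Fq u v)) q p) ->
  (forall q p, a <= p <= b -> continuity_2d_pt F q p) ->
  (forall q p, a <= p <= b -> continuity_2d_pt Fq q p) ->
  forall q, is_derive (fun x => RInt (fun p => F x p) a b) q (RInt (fun p => Fq q p) a b).
Proof.
intros Hab D C Cq q.
assert (Dp : forall q p, a <= p <= b -> is_derive (fun x => F x p) q (Fq q p)).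
{ intros x p Hp. exact (locally_2d_singleton _ _ _ (D x p Hp)). }
replace (RInt (fun p => Fq q p) a b) with (RInt (fun t => Derive (fun u => F u t) q) a b).
- apply (is_derive_RInt_param F a b q).
  + apply filter_forall. intros x t Ht. rewrite Rmin_left, Rmax_right in Ht by exact Hab.
    exists (Fq x t). apply Dp, Ht.
  + intros t Ht. rewrite Rmin_left, Rmax_right in Ht by exact Hab.
    apply continuity_2d_pt_ext_loc with (2 := Cq q t Ht).
    apply locally_2d_impl with (2 := D q t Ht). apply locally_2d_forall.
    intros u v Huv. symmetry. apply is_derive_unique, Huv.
  + apply filter_forall. intros x. apply ex_RInt_slice; auto.
- apply RInt_ext. rewrite Rmin_left, Rmax_right by exact Hab.
  intros x Hx. apply is_derive_unique, Dp. lra.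
Qed.

Lemma RInt_of_derive (f f' : R -> R) (a b : R) : a <= b ->
  (forall p, a <= p <= b -> is_derive f p (f' p)) ->
  (forall p, a <= p <= b -> continuous f' p) -> RInt f' a b = f b - f a.
Proof.
intros Hab D C. apply is_RInt_unique. apply (is_RInt_derive f f').
- rewrite Rmin_left, Rmax_right by exact Hab. exact D.
- rewrite Rmin_left, Rmax_right by exact Hab. exact C.
Qed.

Lemma bounded_not_steadily_decreasing (f f' : R -> R) (Q c K : R) :
  0 < c -> (forall q, is_derive f q (f' q)) -> (forall q, Q <= q -> f' q <= - c) ->
  (forall q, Rabs (f q) <= K) -> False.
Proof.
intros Hc D Hf HK.
set (q := Q + (2 * K + 1) / c).
assert (K0 : 0 <= K) by (apply Rle_trans with (1 := Rabs_pos (f 0)), HK).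
assert (Hq : 0 < (2 * K + 1) / c) by (apply Rdiv_lt_0_compat; lra).
assert (A := increasing_of_derive (fun t => - f t) (fun t => - f' t) Q q c ltac:(unfold q; lra)
  (fun t _ => is_derive_opp _ _ _ (D t)) ltac:(intros t Ht; specialize (Hf t ltac:(lra)); lra)).
simpl in A. replace (c * (q - Q)) with (2 * K + 1) in A by (unfold q; field; lra).
assert (B1 := HK Q). assert (B2 := HK q). apply Rabs_le_between in B1, B2. lra.
Qed.

(** * Flux and flow force *)

Definition slope (W : solitary) (q p : R) : R := bg W p + wv_p W q p.
(** [flux_q] and [flux_p] are the components of the flux in the divergence form of the height
    equation; a doubled letter marks the derivative of a component in its own direction. Inverses
    and products, in place of quotients and powers, let [cont2d] prove continuity. *)
Definition flux_q (W : solitary) (q p : R) : R := wv_q W q p * / slope W q p.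
Definition flux_qq (W : solitary) (q p : R) : R :=
  wv_qq W q p * / slope W q p - wv_q W q p * wv_qp W q p * (/ slope W q p * / slope W q p).
Definition flux_p (W : solitary) (q p : R) : R :=
  / 2 * (/ bg W p * / bg W p)
  - / 2 * (1 + wv_q W q p * wv_q W q p) * (/ slope W q p * / slope W q p).
Definition flux_pp (W : solitary) (q p : R) : R :=
  - (bg1 W p * (/ bg W p * / bg W p * / bg W p))
  - wv_q W q p * wv_qp W q p * (/ slope W q p * / slope W q p)
  + (1 + wv_q W q p * wv_q W q p) * (bg1 W p + wv_pp W q p)
     * (/ slope W q p * / slope W q p * / slope W q p).
(* Density of the flow force; the term with [sd] is the potential energy. *)
Definition force (W : solitary) (q p : R) : R :=
  / 2 * (1 - wv_q W q p * wv_q W q p) * / slope W q p + / 2 * slope W q p * (/ bg W p * / bg W p)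
  - / bg W p + / 2 * (fr W * sd W p) * (wv W q p * wv W q p).
Definition force_q (W : solitary) (q p : R) : R :=
  - (wv_q W q p * wv_qq W q p * / slope W q p)
  - / 2 * (1 - wv_q W q p * wv_q W q p) * wv_qp W q p * (/ slope W q p * / slope W q p)
  + / 2 * wv_qp W q p * (/ bg W p * / bg W p) + fr W * sd W p * (wv W q p * wv_q W q p).

Lemma slope_pos (W : solitary) (q p : R) : -1 <= p <= 0 -> 0 < slope W q p.
Proof. intros Hp. apply Rlt_le_trans with (1 := lo_pos W), wv_lo, Hp. Qed.

Lemma flux_divergence (W : solitary) (q p : R) : -1 <= p <= 0 ->
  flux_pp W q p + flux_qq W q p = fr W * sd W p * wv W q p.
Proof.
intros Hp. assert (E := wv_eq W q p Hp). assert (Hs := slope_pos W q p Hp).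
assert (Hg := bg_pos W p Hp). fold (slope W q p) in E.
unfold flux_pp, flux_qq.
apply Rmult_eq_reg_l with (slope W q p ^ 3); [|apply pow_nonzero; lra].
apply Rminus_diag_uniq. apply eq_trans with (2 := E). field. lra.
Qed.

Lemma flux_top (W : solitary) (q : R) : flux_p W q 0 = fr W * st W * wv W q 0.
Proof.
assert (T := wv_top W q). fold (slope W q 0) in T.
assert (Hs := slope_pos W q 0 ltac:(lra)). assert (Hg := bg_pos W 0 ltac:(lra)).
unfold flux_p. apply Rminus_diag_uniq_sym. apply eq_trans with (2 := T). field. lra.
Qed.

(** The right side is the p-derivative of [flux_p * wv_q], so the integral of the density changes
    only through boundary terms: the conservation law attached to translations in q. *)
Lemma force_q_divergence (W : solitary) (q p : R) : -1 <= p <= 0 ->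
  force_q W q p = flux_pp W q p * wv_q W q p + flux_p W q p * wv_qp W q p.
Proof.
intros Hp. assert (Hs := slope_pos W q p Hp). assert (Hg := bg_pos W p Hp).
replace (flux_pp W q p) with (fr W * sd W p * wv W q p - flux_qq W q p)
  by (generalize (flux_divergence W q p Hp); lra).
unfold force_q, flux_qq, flux_p. field. lra.
Qed.

Lemma is_derive_quotient (s P : R -> R) (x s1 P1 : R) :
  is_derive s x s1 -> is_derive P x P1 -> P x <> 0 ->
  is_derive (fun t => s t * / P t) x (s1 * / P x - s x * P1 * (/ P x * / P x)).
Proof.
intros Ds DP HP.
replace (s1 * / P x - s x * P1 * (/ P x * / P x)) with (s1 * / P x + s x * (- P1 / P x ^ 2))
  by (field; exact HP).
apply (is_derive_mult s (fun t => / P t)); [exact Ds| |intros; apply Rmult_comm].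
apply is_derive_inv; assumption.
Qed.

Lemma slope_derive (W : solitary) (q p : R) :
  is_derive (fun x => slope W x p) q (wv_qp W q p) /\
  is_derive (fun y => slope W q y) p (bg1 W p + wv_pp W q p).
Proof.
split.
- replace (wv_qp W q p) with (0 + wv_qp W q p) by ring.
  apply (is_derive_plus (fun _ => bg W p) (fun x => wv_p W x p)); [|apply (wv_C2 W)].
  apply (is_derive_cst (bg W p) q).
- apply (is_derive_plus (bg W) (fun y => wv_p W q y)); [apply bg_derive|apply (wv_C2 W)].
Qed.

Lemma flux_q_derive (W : solitary) (q p : R) : slope W q p <> 0 ->
  is_derive (fun x => flux_q W x p) q (flux_qq W q p).
Proof.
intros H. apply (is_derive_quotient (fun x => wv_q W x p) (fun x => slope W x p)).
- apply (wv_C2 W).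
- apply slope_derive.
- exact H.
Qed.

Lemma is_derive_sq (f : R -> R) (x l : R) : is_derive f x l ->
  is_derive (fun t => f t * f t) x (2 * f x * l).
Proof.
intros D. replace (2 * f x * l) with (l * f x + f x * l) by ring.
apply (is_derive_mult f f); [exact D|exact D|intros; apply Rmult_comm].
Qed.

Lemma is_derive_inv_sq (f : R -> R) (x l : R) : is_derive f x l -> f x <> 0 ->
  is_derive (fun t => / f t * / f t) x (- 2 * l * (/ f x * / f x * / f x)).
Proof.
intros D H. replace (- 2 * l * (/ f x * / f x * / f x)) with (2 * / f x * (- l / f x ^ 2)) by (field; exact H).
apply (is_derive_sq (fun t => / f t)), is_derive_inv; assumption.
Qed.

Lemma flux_p_derive (W : solitary) (q p : R) : -1 <= p <= 0 ->
  is_derive (fun y => flux_p W q y) p (flux_pp W q p).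
Proof.
intros Hp. assert (Hs := slope_pos W q p Hp). assert (Hg := bg_pos W p Hp).
replace (flux_pp W q p) with
 (/ 2 * (- 2 * bg1 W p * (/ bg W p * / bg W p * / bg W p))
  - / 2 * ((0 + 2 * wv_q W q p * wv_qp W q p) * (/ slope W q p * / slope W q p)
     + (1 + wv_q W q p * wv_q W q p) *
       (- 2 * (bg1 W p + wv_pp W q p) * (/ slope W q p * / slope W q p * / slope W q p))))
  by (unfold flux_pp; field; lra).
apply (is_derive_minus (fun y => / 2 * (/ bg W y * / bg W y))
  (fun y => / 2 * (1 + wv_q W q y * wv_q W q y) * (/ slope W q y * / slope W q y))).
- apply (is_derive_scal (fun y => / bg W y * / bg W y) p (/ 2)).
  apply is_derive_inv_sq; [apply bg_derive|lra].
- apply is_derive_ext with (fun y => / 2 * ((1 + wv_q W q y * wv_q W q y) * (/ slope W q y * / slope W q y))).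
  { intros t. symmetry. apply Rmult_assoc. }
  apply (is_derive_scal (fun y => (1 + wv_q W q y * wv_q W q y) * (/ slope W q y * / slope W q y)) p (/ 2)).
  apply (is_derive_mult (fun y => 1 + wv_q W q y * wv_q W q y) (fun y => / slope W q y * / slope W q y)).
  + apply (is_derive_plus (fun _ => 1) (fun y => wv_q W q y * wv_q W q y)).
    * apply (is_derive_cst 1 p).
    * apply (is_derive_sq (fun y => wv_q W q y)), (wv_C2 W).
  + apply (is_derive_inv_sq (fun y => slope W q y)); [apply slope_derive|lra].
  + intros; apply Rmult_comm.
Qed.

Lemma force_derive (W : solitary) (q p : R) : slope W q p <> 0 ->
  is_derive (fun x => force W x p) q (force_q W q p).
Proof.
intros H.
assert (Dw := C2_q _ _ _ _ _ _ (wv_C2 W) q p).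
assert (Dwq := C2_qq _ _ _ _ _ _ (wv_C2 W) q p).
assert (Ds := proj1 (slope_derive W q p)).
set (ig := / bg W p).
assert (D1 : is_derive (fun x => / 2 * (1 - wv_q W x p * wv_q W x p) * / slope W x p) q
   (/ 2 * (0 - 2 * wv_q W q p * wv_qq W q p) * / slope W q p
     - / 2 * (1 - wv_q W q p * wv_q W q p) * wv_qp W q p * (/ slope W q p * / slope W q p))).
{ apply (is_derive_quotient (fun x => / 2 * (1 - wv_q W x p * wv_q W x p)) (fun x => slope W x p)); auto.
  apply (is_derive_scal (fun x => 1 - wv_q W x p * wv_q W x p) q (/ 2)).
  apply (is_derive_minus (fun _ => 1) (fun x => wv_q W x p * wv_q W x p)); [apply is_derive_cst|].
  apply (is_derive_sq (fun x => wv_q W x p)), Dwq. }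
assert (D2 : is_derive (fun x => / 2 * slope W x p * (ig * ig)) q (/ 2 * wv_qp W q p * (ig * ig))).
{ replace (/ 2 * wv_qp W q p * (ig * ig)) with (/ 2 * (ig * ig) * wv_qp W q p) by ring.
  apply is_derive_ext with (fun x => / 2 * (ig * ig) * slope W x p).
  - intros t. change (/ 2 * (ig * ig) * slope W t p = / 2 * slope W t p * (ig * ig)). ring.
  - apply (is_derive_scal (fun x => slope W x p) q (/ 2 * (ig * ig))), Ds. }
assert (D4 : is_derive (fun x => / 2 * (fr W * sd W p) * (wv W x p * wv W x p)) q
    (/ 2 * (fr W * sd W p) * (2 * wv W q p * wv_q W q p))).
{ apply (is_derive_scal (fun x => wv W x p * wv W x p) q (/ 2 * (fr W * sd W p))).
  apply (is_derive_sq (fun x => wv W x p)), Dw. }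
assert (D := is_derive_plus _ _ _ _ _ (is_derive_minus _ _ _ _ _ (is_derive_plus _ _ _ _ _ D1 D2) (is_derive_cst ig q)) D4).
unfold plus, minus, opp in D; simpl in D.
replace (force_q W q p) with
 (/ 2 * (0 - 2 * wv_q W q p * wv_qq W q p) * / slope W q p -
  / 2 * (1 - wv_q W q p * wv_q W q p) * wv_qp W q p * (/ slope W q p * / slope W q p) +
  / 2 * wv_qp W q p * (ig * ig) + - 0 + / 2 * (fr W * sd W p) * (2 * wv W q p * wv_q W q p)).
- exact D.
- unfold force_q. fold ig. set (is := / slope W q p). clearbody ig is. field.
Qed.

Ltac cont2d :=
  repeat first
   [ assumption
   | apply continuity_2d_pt_const
   | apply continuity_2d_pt_plus | apply continuity_2d_pt_minus
   | apply continuity_2d_pt_mult | apply continuity_2d_pt_opp ].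

Lemma field_continuity (W : solitary) (q p : R) : -1 <= p <= 0 ->
  continuity_2d_pt (flux_q W) q p /\ continuity_2d_pt (flux_qq W) q p /\
  continuity_2d_pt (flux_p W) q p /\ continuity_2d_pt (flux_pp W) q p /\
  continuity_2d_pt (force W) q p /\ continuity_2d_pt (force_q W) q p /\
  continuity_2d_pt (slope W) q p.
Proof.
intros Hp. assert (Hs := slope_pos W q p Hp). assert (Hg := bg_pos W p Hp).
assert (HC := wv_C2 W).
assert (c0 : continuity_2d_pt (fun x y => wv W x y) q p) by apply (C2_c _ _ _ _ _ _ HC).
assert (c1 : continuity_2d_pt (fun x y => wv_q W x y) q p) by apply (C2_cq _ _ _ _ _ _ HC).
assert (c2 : continuity_2d_pt (fun x y => wv_p W x y) q p) by apply (C2_cp _ _ _ _ _ _ HC).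
assert (c3 : continuity_2d_pt (fun x y => wv_qq W x y) q p) by apply HC.
assert (c4 : continuity_2d_pt (fun x y => wv_qp W x y) q p) by apply HC.
assert (c5 : continuity_2d_pt (fun x y => wv_pp W x y) q p) by apply HC.
assert (lift : forall f : R -> R, continuity_pt f p -> continuity_2d_pt (fun _ y => f y) q p).
{ intros f Hf. apply (continuity_1d_2d_pt_comp f (fun _ y => y)); [exact Hf|apply continuity_2d_pt_id2]. }
assert (c6 : continuity_2d_pt (fun _ y => bg W y) q p).
{ apply lift, (is_derive_continuity_pt _ _ _ (bg_derive W p)). }
assert (c7 : continuity_2d_pt (fun _ y => bg1 W y) q p) by apply lift, bg1_cont.
assert (c8 : continuity_2d_pt (fun _ y => sd W y) q p) by apply lift, sd_cont.
assert (c9 : continuity_2d_pt (fun x y => slope W x y) q p) by (unfold slope; cont2d).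
assert (c10 : continuity_2d_pt (fun _ y => / bg W y) q p) by (apply (continuity_2d_pt_inv (fun _ y => bg W y)); [exact c6|lra]).
assert (c11 : continuity_2d_pt (fun x y => / slope W x y) q p) by (apply continuity_2d_pt_inv; [exact c9|lra]).
unfold flux_q, flux_qq, flux_p, flux_pp, force, force_q.
repeat split; try exact c9; cont2d.
Qed.

Lemma slope_neq0_locally (W : solitary) (q p : R) : -1 <= p <= 0 ->
  locally_2d (fun u v => slope W u v <> 0) q p.
Proof.
intros Hp. apply continuity_2d_pt_neq_0; [apply field_continuity, Hp|].
apply Rgt_not_eq, slope_pos, Hp.
Qed.

Lemma flux_q_bound (W : solitary) (q p : R) : -1 <= p <= 0 ->
  Rabs (flux_q W q p) <= hi W * / lo W.
Proof.
intros Hp. apply Rabs_mult_le; [apply wv_bound, Hp|].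
assert (L := wv_lo W q p Hp). assert (Hl := lo_pos W).
rewrite Rabs_pos_eq by (left; apply Rinv_0_lt_compat, slope_pos, Hp).
apply Rinv_le_contravar; [exact Hl|exact L].
Qed.

(** The divergence form integrated over the column above [p1], the surface condition giving the flux
    at the top. *)
Lemma flux_integral_derive (W : solitary) (p1 q : R) : -1 <= p1 <= 0 ->
  is_derive (fun x => RInt (fun p => flux_q W x p) p1 0) q
    (RInt (fun p => fr W * sd W p * wv W q p) p1 0 - fr W * st W * wv W q 0 + flux_p W q p1).
Proof.
intros Hp1.
assert (FC : forall q p, p1 <= p <= 0 -> _) by (intros x p Hp; apply (field_continuity W x p); lra).
assert (C0 : forall q p, p1 <= p <= 0 -> continuity_2d_pt (fun x y => fr W * sd W y * wv W x y) q p).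
{ intros x p Hp. apply continuity_2d_pt_mult; [|apply (C2_c _ _ _ _ _ _ (wv_C2 W))].
  apply continuity_2d_pt_mult; [apply continuity_2d_pt_const|].
  apply (continuity_1d_2d_pt_comp (sd W) (fun _ y => y)); [apply sd_cont|apply continuity_2d_pt_id2]. }
replace (RInt (fun p => fr W * sd W p * wv W q p) p1 0 - fr W * st W * wv W q 0 + flux_p W q p1)
  with (RInt (fun p => flux_qq W q p) p1 0).
- apply is_derive_RInt_strip; [lra| | |].
  + intros x p Hp. apply locally_2d_impl with (2 := slope_neq0_locally W x p ltac:(lra)).
    apply locally_2d_forall. intros u v Huv. apply flux_q_derive, Huv.
  + intros; apply FC; assumption.
  + intros; apply FC; assumption.
- assert (E : RInt (fun p => flux_pp W q p) p1 0 = flux_p W q 0 - flux_p W q p1).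
  { apply (RInt_of_derive (fun p => flux_p W q p) (fun p => flux_pp W q p)); [lra| |].
    - intros p Hp. apply flux_p_derive. lra.
    - intros p Hp. apply (continuity_2d_slice (flux_pp W)), FC, Hp. }
  rewrite flux_top in E.
  rewrite (RInt_ext (fun p => flux_qq W q p) (fun p => minus (fr W * sd W p * wv W q p) (flux_pp W q p))).
  + rewrite (RInt_minus (V := R_CompleteNormedModule) (fun p => fr W * sd W p * wv W q p) (fun p => flux_pp W q p)).
    * unfold minus, plus, opp; simpl. rewrite E. ring.
    * apply (ex_RInt_slice (fun x p => fr W * sd W p * wv W x p)); [lra|intros; apply C0; assumption].
    * apply (ex_RInt_slice (flux_pp W)); [lra|intros; apply FC; assumption].
  + rewrite Rmin_left, Rmax_right by lra. intros p Hp.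
    generalize (flux_divergence W q p ltac:(lra)). unfold minus, plus, opp; simpl. lra.
Qed.

(** * Behaviour of a front at its far end *)

Lemma wv_increasing (W : solitary) (q q' p : R) :
  (forall l, plane_ok W l) -> q <= q' -> -1 <= p <= 0 -> wv W q p <= wv W q' p.
Proof.
intros Hok Hq Hp. specialize (Hok ((q + q') / 2) q p ltac:(lra) Hp). unfold dv in Hok.
replace (2 * ((q + q') / 2) - q) with q' in Hok by field. lra.
Qed.

Lemma wv_cauchy (W : solitary) (p e : R) :
  (forall l, plane_ok W l) -> -1 <= p <= 0 -> 0 < e ->
  exists Q, forall q q', Q <= q -> Q <= q' -> Rabs (wv W q p - wv W q' p) < e.
Proof.
intros Hok Hp He.
destruct (completeness (fun z => exists q, z = wv W q p)) as [s [Hs1 Hs2]].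
{ exists (hi W). intros z [q ->]. apply Rle_trans with (1 := Rle_abs _). apply wv_bound, Hp. }
{ exists (wv W 0 p), 0. reflexivity. }
assert (HQ : exists Q, s - e < wv W Q p).
{ apply NNPP; intros H. assert (s <= s - e); [|lra].
  apply Hs2. intros z [q ->]. apply Rnot_lt_le; intros Hlt. apply H. exists q; exact Hlt. }
destruct HQ as [Q HQ]. exists Q. intros q q' H H'.
assert (A := wv_increasing W Q q p Hok H Hp). assert (A' := wv_increasing W Q q' p Hok H' Hp).
assert (wv W q p <= s) by (apply Hs1; exists q; reflexivity).
assert (wv W q' p <= s) by (apply Hs1; exists q'; reflexivity).
apply Rabs_def1; lra.
Qed.

Lemma difference_quotient (f f' f'' : R -> R) (x h M : R) :
  (forall t, is_derive f t (f' t)) -> (forall t, is_derive f' t (f'' t)) ->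
  (forall t, Rmin x (x + h) <= t <= Rmax x (x + h) -> Rabs (f'' t) <= M) ->
  Rabs (f (x + h) - f x - h * f' x) <= M * (h * h).
Proof.
intros D D' B.
destruct (MVT_gen f x (x + h) f') as [c [Hc E]].
- intros; apply D.
- intros; apply (is_derive_continuity_pt _ _ _ (D _)).
- assert (A := lipschitz_of_derive_bound f' f'' x c M D').
  assert (Hxc : Rabs (c - x) <= Rabs h).
  { unfold Rmin, Rmax in Hc. destruct (Rle_dec x (x + h)).
    - rewrite !Rabs_pos_eq; lra.
    - rewrite !Rabs_left1; lra. }
  specialize (A ltac:(intros t Ht; apply B; unfold Rmin, Rmax in *; destruct (Rle_dec x c), (Rle_dec x (x + h)); lra)).
  replace (f (x + h) - f x - h * f' x) with ((f' c - f' x) * h) by (rewrite E; ring).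
  replace (M * (h * h)) with (M * Rabs h * Rabs h) by (rewrite Rmult_assoc, <- Rabs_mult, (Rabs_pos_eq (h * h)) by apply Rle_0_sqr; reflexivity).
  rewrite Rabs_mult. apply Rmult_le_compat_r; [apply Rabs_pos|].
  apply Rle_trans with (1 := A). apply Rmult_le_compat_l; [|exact Hxc].
  apply Rle_trans with (1 := Rabs_pos (f'' x)), B.
  split; [apply Rmin_l|apply Rmax_l].
Qed.

(** Interpolation: a function that varies little and has a bounded second derivative has a small
    first derivative. The step [h] balances the variation [e / 4 * h] against the Taylor error
    [M * (h * h)]. *)
Lemma wv_q_vanishes (W : solitary) (p e : R) :
  (forall l, plane_ok W l) -> -1 <= p <= 0 -> 0 < e ->
  exists Q, forall q, Q <= q -> Rabs (wv_q W q p) < e.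
Proof.
intros Hok Hp He.
assert (HM := hi_ge1 W). set (M := hi W) in *.
set (h := e / (4 * M)).
assert (Hh : 0 < h) by (apply Rdiv_lt_0_compat; lra).
assert (EM : M * h = e / 4) by (unfold h; field; lra).
destruct (wv_cauchy W p (e / 4 * h) Hok Hp) as [Q HQ]; [apply Rmult_lt_0_compat; lra|].
exists Q. intros q Hq.
assert (A := difference_quotient (fun x => wv W x p) (fun x => wv_q W x p) (fun x => wv_qq W x p) q h M
  (fun t => C2_q _ _ _ _ _ _ (wv_C2 W) t p) (fun t => C2_qq _ _ _ _ _ _ (wv_C2 W) t p)
  ltac:(intros; apply wv_bound, Hp)).
simpl in A.
specialize (HQ (q + h) q ltac:(lra) Hq).
assert (B : Rabs (h * wv_q W q p) < (e / 2) * h).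
{ replace (h * wv_q W q p) with ((wv W (q + h) p - wv W q p) - (wv W (q + h) p - wv W q p - h * wv_q W q p)) by ring.
  apply Rle_lt_trans with (1 := Rabs_triang _ _). rewrite Rabs_Ropp.
  replace (M * (h * h)) with (e / 4 * h) in A by (rewrite <- EM; ring). lra. }
rewrite Rabs_mult, Rabs_pos_eq in B by lra.
apply Rmult_lt_reg_l with h; [exact Hh|]. nra.
Qed.

(** The same interpolation in p, applied to the difference of the columns at [q] and [q']. *)
Lemma wv_p_cauchy (W : solitary) (p e : R) :
  (forall l, plane_ok W l) -> -1 <= p <= 0 -> 0 < e ->
  exists Q, forall q q', Q <= q -> Q <= q' -> Rabs (wv_p W q p - wv_p W q' p) < e.
Proof.
intros Hok Hp He.
assert (HM := hi_ge1 W). set (M := hi W) in *.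
set (h0 := Rmin (/ 2) (e / (8 * M))).
assert (Hh0 : 0 < h0) by (apply Rmin_glb_lt; [lra|apply Rdiv_lt_0_compat; lra]).
assert (Hh1 : h0 <= / 2) by apply Rmin_l.
assert (EM : M * h0 <= e / 8).
{ replace (e / 8) with (M * (e / (8 * M))) by (field; lra). apply Rmult_le_compat_l; [lra|apply Rmin_r]. }
clearbody h0.
(* The increment points into the strip, where the bounds hold. *)
set (h := if Rle_dec p (- / 2) then h0 else - h0).
assert (Hh : Rabs h = h0).
{ unfold h; destruct (Rle_dec p (- / 2)); [|rewrite Rabs_Ropp]; apply Rabs_pos_eq; lra. }
assert (Hph : -1 <= p + h <= 0) by (unfold h; destruct (Rle_dec p (- / 2)); lra).
assert (Hhh : h * h = h0 * h0) by (unfold h; destruct (Rle_dec p (- / 2)); ring).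
clearbody h.
destruct (wv_cauchy W p (e / 8 * h0) Hok Hp) as [Q1 HQ1]; [apply Rmult_lt_0_compat; lra|].
destruct (wv_cauchy W (p + h) (e / 8 * h0) Hok Hph) as [Q2 HQ2]; [apply Rmult_lt_0_compat; lra|].
exists (Rmax Q1 Q2). intros q q' Hq Hq'.
assert (M1 := Rmax_l Q1 Q2). assert (M2 := Rmax_r Q1 Q2).
assert (A : forall q, Rabs (wv W q (p + h) - wv W q p - h * wv_p W q p) <= e / 8 * h0).
{ intros x.
  assert (A := difference_quotient (fun y => wv W x y) (fun y => wv_p W x y) (fun y => wv_pp W x y) p h M
    (fun t => C2_p _ _ _ _ _ _ (wv_C2 W) x t) (fun t => C2_pp _ _ _ _ _ _ (wv_C2 W) x t)).
  simpl in A. apply Rle_trans with (M * (h * h)).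
  - apply A. intros t Ht. apply wv_bound. unfold Rmin, Rmax in Ht. destruct (Rle_dec p (p + h)); lra.
  - rewrite Hhh. rewrite <- Rmult_assoc. apply Rmult_le_compat_r; lra. }
assert (A1 := A q). assert (A2 := A q').
specialize (HQ1 q q' ltac:(lra) ltac:(lra)). specialize (HQ2 q q' ltac:(lra) ltac:(lra)).
assert (B : Rabs (h * (wv_p W q p - wv_p W q' p)) < e * h0).
{ replace (h * (wv_p W q p - wv_p W q' p)) with
   ((wv W q (p + h) - wv W q' (p + h)) - (wv W q p - wv W q' p)
    - (wv W q (p + h) - wv W q p - h * wv_p W q p)
    + (wv W q' (p + h) - wv W q' p - h * wv_p W q' p)) by ring.
  apply Rabs_le_between in A1, A2. apply Rabs_def2 in HQ1, HQ2.
  assert (0 < e * h0) by (apply Rmult_lt_0_compat; lra).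
  apply Rabs_def1; lra. }
rewrite Rabs_mult, Hh, (Rmult_comm e) in B. apply Rmult_lt_reg_l with h0; assumption.
Qed.

(** A Lipschitz constant common to all [q] and the compactness of [-1, 0] make the pointwise bounds
    uniform, at the price of the gap between [c] and [c']. *)
Lemma eventually_uniform (f : R -> R -> R) (M c c' : R) : 0 < M -> c' < c ->
  (forall q p p', -1 <= p <= 0 -> -1 <= p' <= 0 -> Rabs (f q p - f q p') <= M * Rabs (p - p')) ->
  (forall p, -1 <= p <= 0 -> exists Q, forall q, Q <= q -> c < f q p) ->
  exists Q, forall q p, Q <= q -> -1 <= p <= 0 -> c' < f q p.
Proof.
intros HM Hc Lip H. apply NNPP; intros no.
(* [/ e <= q] encodes arbitrarily large [q] in the parameter of [cluster_point]. *)
destruct (cluster_point (-1) 0 (fun e p => exists q, / e <= q /\ f q p <= c')) as [p [Hp Hcl]].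
- intros e e' x He Hee [q [Hq Hf]]. exists q. split; [|exact Hf].
  apply Rle_trans with (2 := Hq). apply Rinv_le_contravar; assumption.
- intros e He. apply NNPP; intros H'. apply no. exists (/ e). intros q p Hq Hp.
  apply Rnot_le_lt; intros Hle. apply H'. exists p. split; [exact Hp|]. exists q. split; assumption.
- destruct (H p Hp) as [Q HQ].
  set (Q' := Rmax Q 1). assert (1 <= Q') by apply Rmax_r. assert (Q <= Q') by apply Rmax_l.
  set (e := Rmin (/ Q') ((c - c') / M)).
  assert (He : 0 < e).
  { apply Rmin_glb_lt; [apply Rinv_0_lt_compat; lra|apply Rdiv_lt_0_compat; lra]. }
  destruct (Hcl e He) as [y [Hy [Hyp [q [Hq Hf]]]]].
  assert (Hq' : Q' <= q).
  { apply Rle_trans with (2 := Hq). rewrite <- (Rinv_inv Q').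
    apply Rinv_le_contravar; [exact He|apply Rmin_l]. }
  specialize (HQ q ltac:(lra)). specialize (Lip q p y Hp Hy).
  assert (M * Rabs (p - y) < c - c').
  { rewrite Rabs_minus_sym. apply Rlt_le_trans with (M * e); [apply Rmult_lt_compat_l; assumption|].
    replace (c - c') with (M * ((c - c') / M)) by (field; lra).
    apply Rmult_le_compat_l; [lra|apply Rmin_r]. }
  apply Rabs_le_between in Lip. lra.
Qed.

(** The lower bound of the slope passes to the limit at the decaying end, where the slope tends to
    [bg]. *)
Lemma bg_lo (W : solitary) (p : R) : -1 <= p <= 0 -> lo W <= bg W p.
Proof.
intros Hp. apply Rnot_lt_le; intros Hlt.
destruct (wv_decay W (lo W - bg W p)) as [Q HQ]; [lra|].
destruct (HQ (Q - 1) p ltac:(lra) Hp) as [_ [_ [A _]]].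
assert (L := wv_lo W (Q - 1) p Hp). apply Rabs_def2 in A. lra.
Qed.

(* If w_p became small at some level, the flux there would be too weak to balance the
   surface pressure fr rho(0) w and the horizontal flux would decrease forever. *)
Lemma wv_p_eventually_positive (W : solitary) :
  (forall l, plane_ok W l) ->
  exists c Q, 0 < c /\ forall q p, Q <= q -> -1 <= p <= 0 -> c < wv_p W q p.
Proof.
intros Hok.
assert (HM := hi_ge1 W). assert (Hl := lo_pos W). set (M := hi W) in *. set (L := lo W) in *.
assert (Hw0 : 0 < wv W 0 0) by (apply wv_pos; lra).
assert (Hf := fr_pos W). assert (Hst := st_pos W).
set (m := fr W * st W * wv W 0 0).
assert (Hm : 0 < m) by (repeat apply Rmult_lt_0_compat; assumption).
(* [m] is a lower bound of the surface pressure for q >= 0. When w_p is below [2 * c], the flux is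
   at most [2 * c * (4 * M) / (2 * L ^ 4)], which is [m / 2]. *)
set (c := m * L ^ 4 / (8 * M)).
assert (HL4 : 0 < L ^ 4) by (apply pow_lt; exact Hl).
assert (Hc : 0 < c) by (apply Rdiv_lt_0_compat; [apply Rmult_lt_0_compat|]; lra).
assert (Ec : 8 * M * c = m * L ^ 4) by (unfold c; field; lra).
clearbody c.
assert (ptw : forall p, -1 <= p <= 0 -> exists Q, forall q, Q <= q -> c < wv_p W q p).
{ intros p1 Hp1. apply NNPP; intros no.
  destruct (wv_p_cauchy W p1 c Hok Hp1 Hc) as [Q HQ].
  (* A value at most [c] recurs at some [q1 >= Q], and the Cauchy property then keeps every value
     beyond [Q] below [2 * c]. *)
  assert (small : forall q, Q <= q -> wv_p W q p1 < 2 * c).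
  { intros q Hq. assert (Hex : exists q1, Q <= q1 /\ wv_p W q1 p1 <= c).
    { apply NNPP; intros H. apply no. exists Q. intros q1 Hq1. apply Rnot_le_lt; intros Hle.
      apply H. exists q1. split; assumption. }
    destruct Hex as [q1 [Hq1 H1]]. specialize (HQ q q1 Hq Hq1). apply Rabs_def2 in HQ. lra. }
  assert (flux_small : forall q, Q <= q -> flux_p W q p1 <= m / 2).
  { intros q Hq. specialize (small q Hq).
    assert (Hs := wv_lo W q p1 Hp1). fold L in Hs. assert (Hg := bg_lo W p1 Hp1). fold L in Hg.
    destruct (coef_bound W p1 Hp1) as [BG _]. fold M in BG. rewrite Rabs_pos_eq in BG by lra.
    destruct (wv_bound W q p1 Hp1) as [_ [_ [Bp _]]]. fold M in Bp. apply Rabs_le_between in Bp.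
    set (u := wv_p W q p1) in *. set (g := bg W p1) in *.
    assert (E : flux_p W q p1 <= u * (2 * g + u) / (2 * (g ^ 2 * (g + u) ^ 2))).
    { unfold flux_p, slope. fold g u. set (s := wv_q W q p1).
      assert (0 <= s * s) by apply Rle_0_sqr.
      assert (0 <= / (g + u) * / (g + u)) by apply Rle_0_sqr.
      assert (0 <= s * s * (/ (g + u) * / (g + u))) by (apply Rmult_le_pos; assumption).
      replace (u * (2 * g + u) / (2 * (g ^ 2 * (g + u) ^ 2)))
        with (/ 2 * (/ g * / g) - / 2 * (/ (g + u) * / (g + u))) by (field; lra).
      lra. }
    apply Rle_trans with (1 := E).
    destruct (Rle_lt_dec u 0) as [Hu|Hu].
    - apply Rle_trans with 0; [|lra].
      assert (0 <= (- u) * (2 * g + u) / (2 * (g ^ 2 * (g + u) ^ 2))).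
      { apply Rdiv_le_0_compat; [apply Rmult_le_pos; lra|].
        repeat apply Rmult_lt_0_compat; try apply pow_lt; lra. }
      unfold Rdiv in *. lra.
    - assert (D : L ^ 4 <= g ^ 2 * (g + u) ^ 2).
      { replace (L ^ 4) with (L ^ 2 * L ^ 2) by ring.
        apply Rmult_le_compat; try apply pow2_ge_0; apply pow_incr; lra. }
      apply Rmult_le_reg_r with (2 * (g ^ 2 * (g + u) ^ 2)); [lra|].
      unfold Rdiv. rewrite Rmult_assoc, Rinv_l, Rmult_1_r by lra.
      apply Rle_trans with (2 * c * (2 * M + 2 * M)).
      + apply Rmult_le_compat; lra.
      + assert (m * L ^ 4 <= m * (g ^ 2 * (g + u) ^ 2)) by (apply Rmult_le_compat_l; lra). lra. }
  apply (bounded_not_steadily_decreasing _ _ (Rmax Q 0) (m / 2) ((0 - p1) * (M * / L)) ltac:(lra)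
    (fun q => flux_integral_derive W p1 q Hp1)).
  - intros q Hq. assert (Q <= q) by (apply Rle_trans with (2 := Hq), Rmax_l).
    assert (0 <= q) by (apply Rle_trans with (2 := Hq), Rmax_r).
    specialize (flux_small q H).
    assert (Hmw : m <= fr W * st W * wv W q 0).
    { apply Rmult_le_compat_l; [apply Rmult_le_pos; lra|]. apply wv_increasing; [assumption|lra|lra]. }
    assert (RInt (fun p => fr W * sd W p * wv W q p) p1 0 <= 0); [|lra].
    apply Rle_trans with (RInt (fun _ => 0) p1 0).
    + apply RInt_le; [lra| |apply (ex_RInt_const (V := R_NormedModule))|].
      * apply (ex_RInt_slice (fun x p => fr W * sd W p * wv W x p)); [lra|]. intros p Hp.
        apply continuity_2d_pt_mult; [|apply (C2_c _ _ _ _ _ _ (wv_C2 W))].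
        apply continuity_2d_pt_mult; [apply continuity_2d_pt_const|].
        apply (continuity_1d_2d_pt_comp (sd W) (fun _ y => y)); [apply sd_cont|apply continuity_2d_pt_id2].
      * intros p Hp. assert (Hsd := sd_neg W p ltac:(lra)). assert (Hw := wv_nonneg W q p ltac:(lra)).
        assert (0 <= fr W * (- sd W p) * wv W q p) by (repeat apply Rmult_le_pos; lra). lra.
    + right. rewrite RInt_const. unfold scal; simpl; unfold mult; simpl. ring.
  - intros q. apply abs_RInt_le_const; [lra| |].
    + apply (ex_RInt_slice (flux_q W)); [lra|]. intros p Hp. apply field_continuity. lra.
    + intros p Hp. apply flux_q_bound. lra. }
destruct (eventually_uniform (wv_p W) M c (c / 2) ltac:(lra) ltac:(lra)) as [Q HQ].
- intros q p p' Hp Hp'.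
  rewrite Rabs_minus_sym, (Rabs_minus_sym p).
  apply (lipschitz_of_derive_bound (fun y => wv_p W q y) (fun y => wv_pp W q y)).
  + intros t. apply (wv_C2 W).
  + intros t Ht. apply wv_bound. unfold Rmin, Rmax in Ht. destruct (Rle_dec p p'); lra.
- exact ptw.
- exists (c / 2), Q. split; [lra|exact HQ].
Qed.

Lemma wv_q_vanishes_uniformly (W : solitary) (e : R) :
  (forall l, plane_ok W l) -> 0 < e ->
  exists Q, forall q p, Q <= q -> -1 <= p <= 0 -> Rabs (wv_q W q p) < e.
Proof.
intros Hok He. assert (HM := hi_ge1 W).
destruct (eventually_uniform (fun q p => - Rabs (wv_q W q p)) (hi W) (- e / 2) (- e) ltac:(lra) ltac:(lra)) as [Q HQ].
- intros q p p' Hp Hp'.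
  replace (- Rabs (wv_q W q p) - - Rabs (wv_q W q p')) with (Rabs (wv_q W q p') - Rabs (wv_q W q p)) by ring.
  apply Rle_trans with (1 := Rabs_triang_inv2 _ _). rewrite (Rabs_minus_sym p).
  apply (lipschitz_of_derive_bound (fun y => wv_q W q y) (fun y => wv_qp W q y)).
  + intros t. apply (wv_C2 W).
  + intros t Ht. apply wv_bound. unfold Rmin, Rmax in Ht. destruct (Rle_dec p p'); lra.
- intros p Hp. destruct (wv_q_vanishes W p (e / 2) Hok Hp ltac:(lra)) as [Q HQ].
  exists Q. intros q Hq. specialize (HQ q Hq). lra.
- exists Q. intros q p Hq Hp. specialize (HQ q p Hq Hp). lra.
Qed.

Lemma ex_RInt_field (W : solitary) (F : solitary -> R -> R -> R) (q : R) :
  (forall q p, -1 <= p <= 0 -> continuity_2d_pt (F W) q p) -> ex_RInt (fun p => F W q p) (-1) 0.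
Proof. intros C. apply (ex_RInt_slice (F W)); [lra|intros; apply C; assumption]. Qed.

(** * Conservation of the flow force and the contradiction for fronts *)

Definition flow_force (W : solitary) (q : R) : R :=
  RInt (fun p => force W q p) (-1) 0 - / 2 * (fr W * st W) * (wv W q 0 * wv W q 0).

Lemma flow_force_constant (W : solitary) (q : R) : is_derive (flow_force W) q 0.
Proof.
assert (FC : forall q p, -1 <= p <= 0 -> _) by (intros x p Hp; apply (field_continuity W x p); lra).
assert (E : RInt (fun p => force_q W q p) (-1) 0 = fr W * st W * wv W q 0 * wv_q W q 0).
{ rewrite (RInt_ext (fun p => force_q W q p)
    (fun p => flux_pp W q p * wv_q W q p + flux_p W q p * wv_qp W q p)).
  - rewrite (RInt_of_derive (fun p => flux_p W q p * wv_q W q p)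
      (fun p => flux_pp W q p * wv_q W q p + flux_p W q p * wv_qp W q p)); [|lra| |].
    + rewrite flux_top, wv_q_bottom. apply Rminus_diag_uniq. ring.
    + intros p Hp. apply (is_derive_mult (fun y => flux_p W q y) (fun y => wv_q W q y)).
      * apply flux_p_derive, Hp.
      * apply (wv_C2 W).
      * intros; apply Rmult_comm.
    + intros p Hp.
      apply (continuity_2d_slice (fun q p => flux_pp W q p * wv_q W q p + flux_p W q p * wv_qp W q p)).
      apply continuity_2d_pt_plus; apply continuity_2d_pt_mult; try (apply FC; exact Hp).
      * apply (C2_cq _ _ _ _ _ _ (wv_C2 W)).
      * apply (wv_C2 W).
  - rewrite Rmin_left, Rmax_right by lra. intros p Hp. apply force_q_divergence. lra. }
replace 0 with (RInt (fun p => force_q W q p) (-1) 0 - / 2 * (fr W * st W) * (2 * wv W q 0 * wv_q W q 0))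
  by (rewrite E; field).
apply (is_derive_minus (fun x => RInt (fun p => force W x p) (-1) 0)
   (fun x => / 2 * (fr W * st W) * (wv W x 0 * wv W x 0))).
- apply is_derive_RInt_strip; [lra| | |].
  + intros x p Hp. apply locally_2d_impl with (2 := slope_neq0_locally W x p Hp).
    apply locally_2d_forall. intros u v Huv. apply force_derive, Huv.
  + intros; apply FC; assumption.
  + intros; apply FC; assumption.
- apply (is_derive_scal (fun x => wv W x 0 * wv W x 0) q (/ 2 * (fr W * st W))).
  apply (is_derive_sq (fun x => wv W x 0)), (wv_C2 W).
Qed.

Lemma flow_force_zero (W : solitary) (q : R) : flow_force W q = 0.
Proof.
assert (cst : forall x y, x <= y -> flow_force W x = flow_force W y).
{ intros x y Hxy.
  assert (A1 := increasing_of_derive (flow_force W) (fun _ => 0) x y 0 Hxy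
    (fun t _ => flow_force_constant W t) (fun t _ => Rle_refl 0)).
  assert (A2 := increasing_of_derive (fun t => - flow_force W t) (fun _ => - 0) x y 0 Hxy
     (fun t _ => is_derive_opp _ _ _ (flow_force_constant W t)) ltac:(intros; lra)).
  simpl in A2. lra. }
assert (HM := hi_ge1 W). assert (Hl := lo_pos W). set (M := hi W) in *. set (L := lo W) in *.
assert (Hf := fr_pos W). assert (Hst := st_pos W).
assert (HfS : 0 < fr W * st W) by (apply Rmult_lt_0_compat; assumption).
assert (HiL : 0 < / L) by (apply Rinv_0_lt_compat; exact Hl).
set (K := / L * / L * / L + / L + M + fr W * st W).
assert (HK : 0 < K).
{ unfold K. assert (0 < / L * / L * / L) by (repeat apply Rmult_lt_0_compat; exact HiL). lra. }
apply squeeze_zero. intros e He.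
set (d := Rmin 1 (e / (2 * K))).
assert (Hd : 0 < d) by (apply Rmin_glb_lt; [lra|apply Rdiv_lt_0_compat; lra]).
assert (Hd1 : d <= 1) by apply Rmin_l.
assert (Hd2 : K * d <= e / 2).
{ replace (e / 2) with (K * (e / (2 * K))) by (field; lra). apply Rmult_le_compat_l; [lra|apply Rmin_r]. }
clearbody d.
destruct (wv_decay W d Hd) as [Q HQ].
set (x := Rmin q (Q - 1)).
rewrite <- (cst x q) by apply Rmin_l.
assert (Hx : x < Q) by (apply Rle_lt_trans with (1 := Rmin_r _ _); lra).
clearbody x.
assert (sq : forall z, Rabs z < d -> Rabs (z * z) <= d).
{ intros z Hz. replace d with (d * 1) by ring. apply Rabs_mult_le; lra. }
assert (B1 : Rabs (RInt (fun p => force W x p) (-1) 0) <= (0 - -1) * ((/ L * / L * / L + / L + M) * d)).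
{ apply abs_RInt_le_const; [lra| |].
  - apply (ex_RInt_field W force). intros; apply field_continuity; assumption.
  - intros p Hp. destruct (HQ x p Hx Hp) as [S0 [S1 [S2 _]]].
    assert (Hs := wv_lo W x p Hp). fold L in Hs. assert (Hg := bg_lo W p Hp). fold L in Hg.
    destruct (coef_bound W p Hp) as [_ [_ [_ Cd]]]. fold M in Cd.
    (* Completing the square in the slope shows that the density is quadratic in w, w_q and w_p, up
       to bounded factors, hence small at the decaying end. *)
    assert (E : force W x p = / 2 * (wv_p W x p * wv_p W x p) * (/ bg W p * / bg W p * / slope W x p)
       - / 2 * (wv_q W x p * wv_q W x p) * / slope W x p + / 2 * (fr W * sd W p) * (wv W x p * wv W x p)).
    { unfold force, slope. field. lra. }
    rewrite E. fold (slope W x p) in Hs.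
    assert (I1 : Rabs (/ bg W p) <= / L).
    { rewrite Rabs_pos_eq; [|left; apply Rinv_0_lt_compat; lra]. apply Rinv_le_contravar; assumption. }
    assert (I2 : Rabs (/ slope W x p) <= / L).
    { rewrite Rabs_pos_eq; [|left; apply Rinv_0_lt_compat; lra]. apply Rinv_le_contravar; assumption. }
    assert (H2 : Rabs (/ 2) <= 1) by (rewrite Rabs_pos_eq; lra).
    replace ((/ L * / L * / L + / L + M) * d) with
      (1 * d * (/ L * / L * / L) + 1 * d * / L + 1 * M * d) by ring.
    apply Rabs_plus_le; [apply Rabs_minus_le|]; repeat apply Rabs_mult_le; auto; lra. }
assert (B2 : Rabs (/ 2 * (fr W * st W) * (wv W x 0 * wv W x 0)) <= 1 * (fr W * st W) * d).
{ destruct (HQ x 0 Hx ltac:(lra)) as [S0 _].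
  apply Rabs_mult_le; [apply Rabs_mult_le|apply sq, S0]; rewrite Rabs_pos_eq; lra. }
unfold flow_force.
apply Rle_lt_trans with (1 := Rabs_minus_le _ _ _ _ B1 B2).
apply Rle_lt_trans with (K * d); [unfold K; lra|lra].
Qed.

(** The integrand of the derivative is compared with [2 * force - D - c4], where [D] is the
    p-derivative of [flux_p * wv]. The integral of this function is exactly [- c4], because the flow
    force is zero and the surface terms cancel. Pointwise, the integrand minus [2 * force - D] is
    [- u^3 / (2 g^2 (g + u)^2)] plus terms in w_q^2. *)
Lemma no_front (W : solitary) : ~ (forall l, plane_ok W l).
Proof.
intros Hok.
destruct (wv_p_eventually_positive W Hok) as [c [Q1 [Hc HQ1]]].
assert (HM := hi_ge1 W). assert (Hl := lo_pos W). set (M := hi W) in *. set (L := lo W) in *.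
(* Since [g <= M] and [g + u <= 2 * M], the cubic term is at least [c ^ 3 / (8 * M ^ 4)], that is
   [2 * c4]; the [e] below keeps the positive term in w_q^2 under [c4]. *)
set (c4 := c ^ 3 / (16 * M ^ 4)).
assert (HM4 : 0 < M ^ 4) by (apply pow_lt; lra).
assert (Hc3 : 0 < c ^ 3) by (apply pow_lt; exact Hc).
assert (Hc4 : 0 < c4) by (apply Rdiv_lt_0_compat; lra).
assert (Ec4 : c4 * (16 * M ^ 4) = c ^ 3) by (unfold c4; field; lra).
clearbody c4.
set (e := Rmin 1 (c4 * L / 4)).
assert (He : 0 < e).
{ apply Rmin_glb_lt; [lra|]. apply Rdiv_lt_0_compat; [apply Rmult_lt_0_compat; assumption|lra]. }
assert (He1 : e <= 1) by apply Rmin_l. assert (He2 : e <= c4 * L / 4) by apply Rmin_r.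
destruct (wv_q_vanishes_uniformly W e Hok He) as [Q2 HQ2].
assert (FC : forall q p, -1 <= p <= 0 -> _) by (intros x p Hp; apply (field_continuity W x p); lra).
assert (Cw : forall q p, continuity_2d_pt (wv W) q p) by apply (C2_c _ _ _ _ _ _ (wv_C2 W)).
assert (Cwq : forall q p, continuity_2d_pt (wv_q W) q p) by apply (C2_cq _ _ _ _ _ _ (wv_C2 W)).
assert (Cwp : forall q p, continuity_2d_pt (wv_p W) q p) by apply (C2_cp _ _ _ _ _ _ (wv_C2 W)).
assert (C1 : forall q p, -1 <= p <= 0 -> continuity_2d_pt (fun q p => flux_q W q p * wv W q p) q p).
{ intros q p Hp. apply continuity_2d_pt_mult; [apply FC, Hp|apply Cw]. }
assert (C2 : forall q p, -1 <= p <= 0 ->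
   continuity_2d_pt (fun q p => flux_qq W q p * wv W q p + flux_q W q p * wv_q W q p) q p).
{ intros q p Hp. apply continuity_2d_pt_plus; apply continuity_2d_pt_mult; try (apply FC, Hp); auto. }
assert (C3 : forall q p, -1 <= p <= 0 ->
   continuity_2d_pt (fun q p => flux_pp W q p * wv W q p + flux_p W q p * wv_p W q p) q p).
{ intros q p Hp. apply continuity_2d_pt_plus; apply continuity_2d_pt_mult; try (apply FC, Hp); auto. }
apply (bounded_not_steadily_decreasing (fun q => RInt (fun p => flux_q W q p * wv W q p) (-1) 0)
  (fun q => RInt (fun p => flux_qq W q p * wv W q p + flux_q W q p * wv_q W q p) (-1) 0)
  (Rmax Q1 Q2) c4 ((0 - -1) * (M * / L * M)) Hc4).
- apply (is_derive_RInt_strip (fun q p => flux_q W q p * wv W q p)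
   (fun q p => flux_qq W q p * wv W q p + flux_q W q p * wv_q W q p)); [lra| | |].
  + intros x p Hp. apply locally_2d_impl with (2 := slope_neq0_locally W x p Hp).
    apply locally_2d_forall. intros u v Huv.
    apply (is_derive_mult (fun x => flux_q W x v) (fun x => wv W x v)).
    * apply flux_q_derive, Huv.
    * apply (wv_C2 W).
    * intros; apply Rmult_comm.
  + exact C1.
  + exact C2.
- intros q Hq.
  assert (q1 : Q1 <= q) by (apply Rle_trans with (2 := Hq), Rmax_l).
  assert (q2 : Q2 <= q) by (apply Rle_trans with (2 := Hq), Rmax_r).
  set (D := fun p => flux_pp W q p * wv W q p + flux_p W q p * wv_p W q p).
  assert (ID : is_RInt D (-1) 0 (flux_p W q 0 * wv W q 0 - flux_p W q (-1) * wv W q (-1))).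
  { apply (is_RInt_derive (fun p => flux_p W q p * wv W q p) D).
    - rewrite Rmin_left, Rmax_right by lra. intros p Hp.
      apply (is_derive_mult (fun y => flux_p W q y) (fun y => wv W q y)).
      + apply flux_p_derive, Hp.
      + apply (wv_C2 W).
      + intros; apply Rmult_comm.
    - rewrite Rmin_left, Rmax_right by lra. intros p Hp.
      apply (continuity_2d_slice (fun q p => flux_pp W q p * wv W q p + flux_p W q p * wv_p W q p)).
      apply C3, Hp. }
  assert (IF : is_RInt (fun p => force W q p) (-1) 0 (/ 2 * (fr W * st W) * (wv W q 0 * wv W q 0))).
  { replace (/ 2 * (fr W * st W) * (wv W q 0 * wv W q 0)) with (RInt (fun p => force W q p) (-1) 0)
      by (generalize (flow_force_zero W q); unfold flow_force; lra).
    apply (RInt_correct (fun p => force W q p)).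
    apply (ex_RInt_field W force). intros; apply FC; assumption. }
  assert (IT := is_RInt_minus _ _ _ _ _ _
     (is_RInt_minus _ _ _ _ _ _ (is_RInt_scal _ _ _ 2 _ IF) ID) (is_RInt_const (V := R_NormedModule) (-1) 0 c4)).
  assert (V : RInt (fun p => minus (minus (scal 2 (force W q p)) (D p)) c4) (-1) 0 = - c4).
  { apply eq_trans with (1 := is_RInt_unique _ _ _ _ IT). rewrite flux_top, wv_bot.
    unfold minus, plus, opp, scal; simpl; unfold mult; simpl. field. }
  rewrite <- V.
  apply RInt_le; [lra| |eexists; exact IT|].
  + apply (ex_RInt_slice (fun q p => flux_qq W q p * wv W q p + flux_q W q p * wv_q W q p)); [lra|].
    intros; apply C2; assumption.
  + intros p Hp0. assert (Hp : -1 <= p <= 0) by lra.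
    unfold minus, plus, opp, scal; simpl; unfold mult; simpl. unfold D.
    specialize (HQ1 q p q1 Hp). specialize (HQ2 q p q2 Hp).
    assert (Hs := wv_lo W q p Hp). fold L in Hs. assert (Hg := bg_lo W p Hp). fold L in Hg.
    destruct (coef_bound W p Hp) as [Cg _]. fold M in Cg. rewrite Rabs_pos_eq in Cg by lra.
    destruct (wv_bound W q p Hp) as [_ [_ [Bp _]]]. fold M in Bp. rewrite Rabs_pos_eq in Bp by lra.
    assert (Div := flux_divergence W q p Hp).
    replace (flux_qq W q p) with (fr W * sd W p * wv W q p - flux_pp W q p) by lra.
    set (u := wv_p W q p) in *. set (g := bg W p) in *. set (s := wv_q W q p) in *.
    assert (key : flux_p W q p * u + flux_q W q p * s
       - 2 * (force W q p - / 2 * (fr W * sd W p) * (wv W q p * wv W q p)) <= - c4).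
    { replace (flux_p W q p * u + flux_q W q p * s
       - 2 * (force W q p - / 2 * (fr W * sd W p) * (wv W q p * wv W q p)))
      with (- (u ^ 3 * / (2 * (g ^ 2 * (g + u) ^ 2))) + s * s * (2 * / (g + u))
            - s * s * (u * / (2 * (g + u) ^ 2)))
        by (unfold flux_p, flux_q, force, slope; fold g u s; field; lra).
      assert (K1 : 2 * c4 <= u ^ 3 * / (2 * (g ^ 2 * (g + u) ^ 2))).
      { apply Rmult_le_reg_r with (2 * (g ^ 2 * (g + u) ^ 2)).
        - repeat apply Rmult_lt_0_compat; try apply pow_lt; lra.
        - replace (u ^ 3 * / (2 * (g ^ 2 * (g + u) ^ 2)) * (2 * (g ^ 2 * (g + u) ^ 2))) with (u ^ 3)
            by (field; lra).
          apply Rle_trans with (c4 * (16 * M ^ 4)).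
          + replace (c4 * (16 * M ^ 4)) with (2 * c4 * (2 * (M ^ 2 * (2 * M) ^ 2))) by ring.
            apply Rmult_le_compat_l; [lra|]. apply Rmult_le_compat_l; [lra|].
            apply Rmult_le_compat; try apply pow2_ge_0; apply pow_incr; lra.
          + rewrite Ec4. apply pow_incr. lra. }
      assert (Hss : 0 <= s * s) by apply Rle_0_sqr.
      assert (K2 : s * s * (2 * / (g + u)) <= c4).
      { assert (Hs2 : s * s <= c4 * L / 4).
        { apply Rle_trans with (2 := He2). apply Rle_trans with (1 := Rle_abs _).
          replace e with (e * 1) by ring. apply Rabs_mult_le; lra. }
        assert (HI : / (g + u) <= / L) by (apply Rinv_le_contravar; assumption).
        apply Rle_trans with (c4 * L / 4 * (2 * / L)).
        - apply Rmult_le_compat; try lra.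
          assert (0 < / (g + u)) by (apply Rinv_0_lt_compat; lra). lra.
        - replace (c4 * L / 4 * (2 * / L)) with (c4 / 2) by (field; lra). lra. }
      assert (K3 : 0 <= s * s * (u * / (2 * (g + u) ^ 2))).
      { apply Rmult_le_pos; [exact Hss|]. apply Rmult_le_pos; [lra|].
        left. apply Rinv_0_lt_compat. apply Rmult_lt_0_compat; [lra|apply pow_lt; lra]. }
      lra. }
    lra.
- intros q. apply abs_RInt_le_const; [lra| |].
  + apply (ex_RInt_slice (fun q p => flux_q W q p * wv W q p)); [lra|]. intros; apply C1; assumption.
  + intros p Hp. apply Rabs_mult_le; [apply flux_q_bound, Hp|apply wv_bound, Hp].
Qed.

Lemma solitary_symmetric (W : solitary) : exists qs : R,
  (forall q p, -1 <= p <= 0 -> wv W (qs + q) p = wv W (qs - q) p) /\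
  (forall q p, -1 < p <= 0 -> q < qs -> 0 < wv_q W q p) /\
  (forall q p, -1 < p <= 0 -> qs < q -> wv_q W q p < 0).
Proof.
destruct (moving_plane W) as [H|[ls [H1 H2]]].
- destruct (no_front W H).
- exists ls. apply symmetric_of_plane; assumption.
Qed.

(** * The height equation *)

Lemma closed_strip_le (f : R -> R) (c : R) : (forall p, continuity_pt f p) ->
  (forall p, -1 < p < 0 -> c <= f p) -> forall p, -1 <= p <= 0 -> c <= f p.
Proof.
intros Cf H p Hp. apply Rnot_lt_le; intros Hlt.
destruct (Cf p (c - f p) ltac:(lra)) as [d [Hd HD]]. simpl in HD. unfold Rdist in HD.
set (h := Rmin (/ 4) (d / 2)).
assert (Hh : 0 < h) by (apply Rmin_glb_lt; lra).
assert (h1 : h <= / 4) by apply Rmin_l. assert (h2 : h <= d / 2) by apply Rmin_r.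
set (y := if Rle_dec p (- / 2) then p + h else p - h).
assert (Hy : -1 < y < 0 /\ y <> p /\ Rabs (y - p) < d).
{ unfold y; destruct (Rle_dec p (- / 2)); repeat split; try lra; apply Rabs_def1; lra. }
destruct Hy as [Hy1 [Hy2 Hy3]].
specialize (HD y (conj (conj I (not_eq_sym Hy2)) Hy3)). specialize (H y Hy1).
apply Rabs_def2 in HD. lra.
Qed.

Lemma closed_strip_zero (f : R -> R) : (forall p, continuity_pt f p) ->
  (forall p, -1 < p < 0 -> f p = 0) -> forall p, -1 <= p <= 0 -> f p = 0.
Proof.
intros Cf H p Hp. apply Rle_antisym.
- assert (0 <= - f p); [|lra].
  apply (closed_strip_le (fun p => - f p)); [|intros x Hx; rewrite H; lra|exact Hp].
  intros x. apply (continuity_pt_opp f), Cf.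
- apply (closed_strip_le f); [exact Cf|intros x Hx; rewrite H; lra|exact Hp].
Qed.

Lemma C2_of_plane (w : R -> R -> R) : C2_plane w ->
  is_C2 w (Dq w) (Dp w) (Dq (Dq w)) (Dp (Dq w)) (Dp (Dp w)).
Proof.
intros [D C].
split; intros q p; destruct (D q p) as [D1 [D2 [D3 [D4 [D5 D6]]]]];
  destruct (C q p) as [_ [_ [_ [C3 [C4 [_ C6]]]]]].
- exact (Derive_correct (fun x => w x p) q D1).
- exact (Derive_correct (fun y => w q y) p D2).
- exact (Derive_correct (fun x => Dq w x p) q D3).
- exact (Derive_correct (fun y => Dq w q y) p D4).
- replace (Dp (Dq w) q p) with (Dq (Dp w) q p).
  + exact (Derive_correct (fun x => Dp w x p) q D5).
  + destruct (C q p) as [_ [_ [_ [_ [K1 [K2 _]]]]]].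
    apply (Schwarz w q p); [|exact K2|exact K1].
    apply locally_2d_forall. intros u v. destruct (D u v) as [E1 [E2 [E3 [E4 [E5 E6]]]]].
    split; [exact E1|split; [exact E2|split; [exact E5|exact E4]]].
- exact (Derive_correct (fun y => Dp w q y) p D6).
- exact C3.
- exact C4.
- exact C6.
Qed.

Lemma flux_raw_derive (s P G : R -> R) (x s1 P1 G1 : R) :
  is_derive s x s1 -> is_derive P x P1 -> is_derive G x G1 -> P x <> 0 -> G x <> 0 ->
  is_derive (fun y => - (1 + s y ^ 2) / (2 * P y ^ 2) + 1 / (2 * G y ^ 2)) x
    (- s x * s1 / P x ^ 2 + (1 + s x ^ 2) * P1 / P x ^ 3 - G1 / G x ^ 3).
Proof.
intros Ds DP DG HP HG.
auto_derive.
- repeat split; try (eexists; eassumption); apply Rmult_integral_contrapositive; (split; [lra|]);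
  rewrite Rmult_1_r; apply Rmult_integral_contrapositive; split; assumption.
- replace (Derive (fun x : R => s x) x) with s1 by (symmetry; apply (is_derive_unique s x s1 Ds)).
  replace (Derive (fun x : R => P x) x) with P1 by (symmetry; apply (is_derive_unique P x P1 DP)).
  replace (Derive (fun x : R => G x) x) with G1 by (symmetry; apply (is_derive_unique G x G1 DG)).
  field. split; assumption.
Qed.

(** [height_equation] gives the equation and the slope bound in the open strip only; the fields of
    [solitary] need them up to the boundary, which continuity provides. *)
Lemma height_equation_unfold (rho H : R -> R) (w : R -> R -> R) (F : R) :
  (forall t, ex_derive H t) -> (forall t, ex_derive (Derive H) t) ->
  (forall t, continuity_pt (Derive (Derive H)) t) -> (forall t, continuity_pt (Derive rho) t) ->
  (forall p, -1 <= p <= 0 -> 0 < Derive H p) -> H (-1) = 0 -> H 0 = 1 ->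
  C2_plane w -> height_equation rho H w F ->
  0 < F /\ (forall q, w q (-1) = 0) /\
  (forall q, (1 + Dq w q 0 ^ 2) / (2 * (Derive H 0 + Dp w q 0) ^ 2) - 1 / (2 * Derive H 0 ^ 2)
      + 1 / F ^ 2 * rho 0 * w q 0 = 0) /\
  exists c, 0 < c /\ (forall q p, -1 <= p <= 0 -> c <= Derive H p + Dp w q p) /\
  forall q p, -1 <= p <= 0 ->
    (1 + Dq w q p ^ 2) * (Derive (Derive H) p + Dp (Dp w) q p)
      - 2 * Dq w q p * (Derive H p + Dp w q p) * Dp (Dq w) q p
      + (Derive H p + Dp w q p) ^ 2 * Dq (Dq w) q p
      - (Derive H p + Dp w q p) ^ 3
        * (Derive (Derive H) p / Derive H p ^ 3 + 1 / F ^ 2 * Derive rho p * w q p) = 0.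
Proof.
intros DH DG CG1 Cd HG H1 H0 Hw [HF [Heq [Htop [Hbot [c [Hc Hlo]]]]]].
assert (HC := C2_of_plane w Hw).
assert (Eq : Dq (height_h H w) = Dq w).
{ apply functional_extensionality; intros q; apply functional_extensionality; intros p.
  unfold Dq at 1, height_h. apply is_derive_unique.
  replace (Dq w q p) with (0 + Dq w q p) by ring.
  exact (is_derive_plus (fun _ => H p) (fun x => w x p) q 0 _
    (is_derive_cst (H p) q)
    (C2_q _ _ _ _ _ _ HC q p)). }
assert (Ep : Dp (height_h H w) = fun q p => Derive H p + Dp w q p).
{ apply functional_extensionality; intros q; apply functional_extensionality; intros p.
  unfold Dp at 1, height_h. apply is_derive_unique.
  exact (is_derive_plus H (fun y => w q y) p _ _ (Derive_correct _ _ (DH p)) (C2_p _ _ _ _ _ _ HC q p)). }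
cbv zeta in Heq, Htop, Hbot. rewrite Eq, Ep in Heq. rewrite Eq, Ep in Htop.
split; [exact HF|split; [|split]].
- intros q. specialize (Hbot q). unfold height_h in Hbot. lra.
- intros q. specialize (Htop q). unfold height_h in Htop. rewrite H0 in Htop.
  replace (1 + w q 0 - 1) with (w q 0) in Htop by ring. exact Htop.
- destruct (is_derive_cont_along _ _ _ _ _ _ HC) as [_ Cw].
  assert (CG : forall t, continuity_pt (Derive H) t).
  { intros t. apply (is_derive_continuity_pt _ _ _ (Derive_correct _ _ (DG t))). }
  assert (Cq : forall q p, continuity_pt (fun y => Dq w q y) p).
  { intros q p. apply (is_derive_continuity_pt _ _ _ (C2_qp _ _ _ _ _ _ HC q p)). }
  assert (Cp : forall q p, continuity_pt (fun y => Dp w q y) p).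
  { intros q p. apply (is_derive_continuity_pt _ _ _ (C2_pp _ _ _ _ _ _ HC q p)). }
  assert (lo : forall q p, -1 <= p <= 0 -> c <= Derive H p + Dp w q p).
  { intros q. apply closed_strip_le; [|intros; apply Hlo; assumption].
    intros p. apply (continuity_pt_plus (Derive H) (fun y => Dp w q y)); auto. }
  exists c. split; [exact Hc|split; [exact lo|]].
  intros q p Hp.
  assert (Hg := HG p Hp).
  (* Multiplied by H_p^3, the equation is a polynomial in continuous functions. [closed_strip_zero]
     asks for continuity at every [p], also outside the strip, where H_p may vanish. *)
  set (E := fun q p => (1 + Dq w q p * Dq w q p) * (Derive (Derive H) p + Dp (Dp w) q p)
        * (Derive H p * (Derive H p * Derive H p))
      - 2 * Dq w q p * (Derive H p + Dp w q p) * Dp (Dq w) q p * (Derive H p * (Derive H p * Derive H p))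
      + (Derive H p + Dp w q p) * (Derive H p + Dp w q p) * Dq (Dq w) q p
         * (Derive H p * (Derive H p * Derive H p))
      - (Derive H p + Dp w q p) * ((Derive H p + Dp w q p) * (Derive H p + Dp w q p))
        * (Derive (Derive H) p
           + 1 / F ^ 2 * Derive rho p * w q p * (Derive H p * (Derive H p * Derive H p)))).
  cut (E q p = 0).
  { intros HE. apply Rmult_eq_reg_r with (Derive H p ^ 3); [|apply pow_nonzero; lra].
    rewrite Rmult_0_l. apply eq_trans with (2 := HE). unfold E. field. lra. }
  revert p Hp Hg.
  assert (Z : forall p, -1 <= p <= 0 -> E q p = 0); [|intros; apply Z; assumption].
  apply (closed_strip_zero (fun p => E q p)).
  + intros p. apply continuity_pt_filterlim.
    assert (lift : forall f : R -> R, continuity_pt f p -> continuity_2d_pt (fun _ y => f y) q p).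
    { intros f Hf. apply (continuity_1d_2d_pt_comp f (fun _ y => y)); [exact Hf|apply continuity_2d_pt_id2]. }
    apply (continuity_2d_slice E).
    assert (c0 : continuity_2d_pt (fun x y => w x y) q p) by apply (C2_c _ _ _ _ _ _ HC).
    assert (c1 : continuity_2d_pt (fun x y => Dq w x y) q p) by apply (C2_cq _ _ _ _ _ _ HC).
    assert (c2 : continuity_2d_pt (fun x y => Dp w x y) q p) by apply (C2_cp _ _ _ _ _ _ HC).
    assert (c3 : continuity_2d_pt (fun x y => Dq (Dq w) x y) q p) by exact (C2_cqq _ _ _ _ _ _ HC q p).
    assert (c4 : continuity_2d_pt (fun x y => Dp (Dq w) x y) q p) by exact (C2_cqp _ _ _ _ _ _ HC q p).
    assert (c5 : continuity_2d_pt (fun x y => Dp (Dp w) x y) q p) by exact (C2_cpp _ _ _ _ _ _ HC q p).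
    assert (c6 : continuity_2d_pt (fun _ y => Derive H y) q p) by apply lift, CG.
    assert (c7 : continuity_2d_pt (fun _ y => Derive (Derive H) y) q p) by apply lift, CG1.
    assert (c8 : continuity_2d_pt (fun _ y => Derive rho y) q p) by apply lift, Cd.
    unfold E. cont2d.
  + intros p Hp. assert (Hp' : -1 <= p <= 0) by lra.
    assert (HP := lo q p Hp'). assert (Hg := HG p Hp'). specialize (Heq q p Hp).
    assert (DA := flux_raw_derive (fun y => Dq w q y) (fun y => Derive H y + Dp w q y)
       (Derive H) p (Dp (Dq w) q p) (Derive (Derive H) p + Dp (Dp w) q p) (Derive (Derive H) p)
       (C2_qp _ _ _ _ _ _ HC q p)
       (is_derive_plus _ _ _ _ _ (Derive_correct _ _ (DG p)) (C2_pp _ _ _ _ _ _ HC q p))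
       (Derive_correct _ _ (DG p)) ltac:(lra) ltac:(lra)).
    assert (DP : is_derive (fun x => Derive H p + Dp w x p) q (0 + Dp (Dq w) q p)).
    { exact (is_derive_plus (fun _ => Derive H p) (fun x => Dp w x p) q 0 _
        (is_derive_cst (Derive H p) q)
        (C2_pq _ _ _ _ _ _ HC q p)). }
    assert (DB := is_derive_quotient (fun x => Dq w x p) (fun x => Derive H p + Dp w x p) q _ _
       (C2_qq _ _ _ _ _ _ HC q p) DP ltac:(lra)).
    match type of Heq with ?X + ?Y - _ = 0 =>
      assert (EX : X = _) by exact (is_derive_unique _ _ _ DA);
      assert (EY : Y = _) by exact (is_derive_unique _ _ _ DB); rewrite EX, EY in Heq end.
    unfold height_h in Heq.
    apply Rmult_eq_reg_l with (/ ((Derive H p + Dp w q p) ^ 3 * Derive H p ^ 3)).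
    2: { apply Rinv_neq_0_compat, Rmult_integral_contrapositive; split; apply pow_nonzero; lra. }
    rewrite Rmult_0_r. apply eq_trans with (2 := Heq). unfold E. field. lra.
Qed.

Lemma coefficient_bound (G G1 d : R -> R) (mu : R) :
  (forall t, continuity_pt G t) -> (forall t, continuity_pt G1 t) -> (forall t, continuity_pt d t) ->
  (forall p, -1 <= p <= 0 -> 0 < G p) ->
  exists K, 0 <= K /\ forall p, -1 <= p <= 0 ->
    Rabs (G p) <= K /\ Rabs (G1 p) <= K /\ Rabs (G1 p / G p ^ 3) <= K /\ Rabs (mu * d p) <= K.
Proof.
intros CG CG1 Cd HG.
destruct (continuous_bounded G (-1) 0 ltac:(lra) CG) as [K1 [P1 B1]].
destruct (continuous_bounded G1 (-1) 0 ltac:(lra) CG1) as [K2 [P2 B2]].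
destruct (continuous_bounded d (-1) 0 ltac:(lra) Cd) as [K3 [P3 B3]].
destruct (continuity_ab_min G (-1) 0 ltac:(lra)) as [m [Hm Hm']]; [intros; apply CG|].
assert (Hg : 0 < G m ^ 3) by (apply pow_lt, HG, Hm').
assert (Hi : 0 < / G m ^ 3) by (apply Rinv_0_lt_compat, Hg).
assert (P4 : 0 <= K2 * / G m ^ 3) by (apply Rmult_le_pos; lra).
assert (P5 : 0 <= Rabs mu * K3) by (apply Rmult_le_pos; [apply Rabs_pos|lra]).
exists (K1 + K2 + K2 * / G m ^ 3 + Rabs mu * K3). split; [lra|].
intros p Hp. specialize (B1 p Hp). specialize (B2 p Hp). specialize (B3 p Hp).
assert (I : Rabs (/ G p ^ 3) <= / G m ^ 3).
{ assert (0 < G p ^ 3) by (apply pow_lt, HG, Hp).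
  rewrite Rabs_pos_eq by (left; apply Rinv_0_lt_compat; assumption).
  apply Rinv_le_contravar; [exact Hg|]. apply pow_incr. split; [left; apply HG, Hm'|apply Hm, Hp]. }
assert (T1 := Rabs_mult_le _ _ _ _ B2 I). assert (T2 := Rabs_mult_le _ _ _ _ (Rle_refl (Rabs mu)) B3).
unfold Rdiv. repeat split; lra.
Qed.

Theorem theorem4p13
  (alpha : R) (rho H : R -> R) (w : R -> R -> R) (F : R)
  (Halpha : 0 < alpha < 1)
  (Hrho_reg : Ckalpha 2 alpha rho)
  (Hrho_pos : forall p, -1 <= p <= 0 -> 0 < rho p)
  (Hrho_dec : forall p, -1 <= p <= 0 -> Derive rho p <= 0)
  (HH_reg : Ckalpha 3 alpha H)
  (HH_m1 : H (-1) = 0) (HH_0 : H 0 = 1)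
  (HH_p : forall p, -1 <= p <= 0 -> 0 < Derive H p)
  (Hw_C2 : C2_plane w)
  (Hw_norm : finite_C2_norm w)
  (Hsol : height_equation rho H w F)
  (Hw_pos : forall q p, -1 < p <= 0 -> 0 < w q p)
  (HF : exists Fcr, is_F_cr rho H Fcr /\ Fcr < F)
  (Hdecay : decays_minus_infty w \/ decays_plus_infty w) :
  exists qs : R,
    (forall q p, -1 <= p <= 0 -> w (qs + q) p = w (qs - q) p) /\
    (forall q p, -1 < p <= 0 -> q < qs -> 0 < Dq w q p) /\
    (forall q p, -1 < p <= 0 -> qs < q -> Dq w q p < 0).
Proof.
destruct Hrho_reg as [[Drho _] _]. destruct HH_reg as [[DHn _] _].
assert (DH : forall t, ex_derive H t) by (intros t; exact (DHn 1%nat t ltac:(lia))).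
assert (DG : forall t, ex_derive (Derive H) t) by (intros t; exact (DHn 2%nat t ltac:(lia))).
assert (CG : forall t, continuity_pt (Derive H) t).
{ intros t. exact (is_derive_continuity_pt _ _ _ (Derive_correct _ _ (DG t))). }
assert (CG1 : forall t, continuity_pt (Derive (Derive H)) t).
{ intros t. exact (is_derive_continuity_pt _ _ _ (Derive_correct _ _ (DHn 3%nat t ltac:(lia)))). }
assert (Cd : forall t, continuity_pt (Derive rho) t).
{ intros t. exact (is_derive_continuity_pt _ _ _ (Derive_correct _ _ (Drho 2%nat t ltac:(lia)))). }
destruct (height_equation_unfold rho H w F DH DG CG1 Cd HH_p HH_m1 HH_0 Hw_C2 Hsol)
  as [HF0 [Hbot [Htop [c [Hc [Hlo Heq]]]]]].
assert (HC := C2_of_plane w Hw_C2).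
set (mu := 1 / F ^ 2) in *.
assert (Hmu : 0 < mu) by (apply Rdiv_lt_0_compat; [lra|apply pow_lt; exact HF0]).
assert (Hr0 : 0 < rho 0) by (apply Hrho_pos; lra).
assert (prof : exists psi psi1 psi2 dl,
   strict_profile (Derive H) (Derive (Derive H)) (Derive rho) (rho 0) mu psi psi1 psi2 dl).
{ destruct HF as [Fcr [[mucr [Hcr ->]] HFcr]].
  assert (Hm0 : 0 < mucr) by apply Hcr.
  apply (subcritical_strict_profile rho H mucr mu); auto.
  split; [exact Hmu|].
  assert (Hs : 0 < sqrt mucr) by (apply sqrt_lt_R0; exact Hm0).
  assert (Hinv : 1 < F * sqrt mucr).
  { apply Rmult_lt_compat_r with (r := sqrt mucr) in HFcr; [|exact Hs]. rewrite Rinv_l in HFcr; lra. }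
  assert (H2 : 1 < F ^ 2 * mucr).
  { rewrite <- (sqrt_sqrt mucr) by lra.
    replace (F ^ 2 * (sqrt mucr * sqrt mucr)) with ((F * sqrt mucr) * (F * sqrt mucr)) by ring. nra. }
  apply Rmult_lt_reg_l with (F ^ 2); [apply pow_lt; exact HF0|].
  unfold mu. replace (F ^ 2 * (1 / F ^ 2)) with 1 by (field; lra). exact H2. }
destruct prof as [psi [psi1 [psi2 [dl prof]]]].
destruct (coefficient_bound (Derive H) (Derive (Derive H)) (Derive rho) mu CG CG1 Cd HH_p) as [K [HK BK]].
destruct Hw_norm as [M HM].
assert (HM0 : 0 <= M).
{ apply Rle_trans with (1 := Rabs_pos (w 0 0)). apply (HM 0 0). lra. }
set (N := 1 + K + M). assert (HN : 1 <= N) by (unfold N; lra).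
assert (BN : forall p, -1 <= p <= 0 -> Rabs (Derive H p) <= N /\ Rabs (Derive (Derive H) p) <= N /\
   Rabs (Derive (Derive H) p / Derive H p ^ 3) <= N /\ Rabs (mu * Derive rho p) <= N).
{ intros p Hp. destruct (BK p Hp) as [B1 [B2 [B3 B4]]]. unfold N. repeat split; lra. }
assert (BM : forall q p, -1 <= p <= 0 ->
   Rabs (w q p) <= N /\ Rabs (Dq w q p) <= N /\ Rabs (Dp w q p) <= N /\
   Rabs (Dq (Dq w) q p) <= N /\ Rabs (Dp (Dq w) q p) <= N /\ Rabs (Dp (Dp w) q p) <= N).
{ intros q p Hp. destruct (HM q p Hp) as [B1 [B2 [B3 [B4 [B5 [_ B6]]]]]]. unfold N. repeat split; lra. }
destruct Hdecay as [Hdec|Hdec].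
- assert (Hd : forall e, 0 < e -> exists Q, forall q p, q < Q -> -1 <= p <= 0 ->
    Rabs (w q p) < e /\ Rabs (Dq w q p) < e /\ Rabs (Dp w q p) < e /\
    Rabs (Dq (Dq w) q p) < e /\ Rabs (Dp (Dq w) q p) < e).
  { intros e He. destruct (Hdec e He) as [Q HQ]. exists Q. intros q p Hq Hp.
    destruct (HQ q p Hq Hp) as [B1 [B2 [B3 [B4 [B5 _]]]]]. auto. }
  exact (solitary_symmetric (Solitary (Derive H) (Derive (Derive H)) (Derive rho) (rho 0) mu
    w (Dq w) (Dp w) (Dq (Dq w)) (Dp (Dq w)) (Dp (Dp w)) psi psi1 psi2 dl c N
    (fun t => Derive_correct _ _ (DG t)) CG1 Cd HH_p Hrho_dec Hr0 Hmu Hc HN prof HC BN BM Hlo Heq Htop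
    Hbot Hw_pos Hd)).
(* With decay at plus infinity, the mirror image of w solves the same problem with decay at minus
   infinity. The form [2 * 0 - q] matches [C2_reflect] at [l = 0]. *)
- set (r := fun q => 2 * 0 - q).
  assert (Hrr : forall q, r (r q) = q) by (intros q; unfold r; ring).
  assert (BM' : forall q p, -1 <= p <= 0 ->
   Rabs (w (r q) p) <= N /\ Rabs (- Dq w (r q) p) <= N /\ Rabs (Dp w (r q) p) <= N /\
   Rabs (Dq (Dq w) (r q) p) <= N /\ Rabs (- Dp (Dq w) (r q) p) <= N /\ Rabs (Dp (Dp w) (r q) p) <= N).
  { intros q p Hp. rewrite !Rabs_Ropp. apply BM, Hp. }
  assert (Heq' : forall q p, -1 <= p <= 0 ->
    (1 + (- Dq w (r q) p) ^ 2) * (Derive (Derive H) p + Dp (Dp w) (r q) p)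
      - 2 * (- Dq w (r q) p) * (Derive H p + Dp w (r q) p) * (- Dp (Dq w) (r q) p)
      + (Derive H p + Dp w (r q) p) ^ 2 * Dq (Dq w) (r q) p
      - (Derive H p + Dp w (r q) p) ^ 3
        * (Derive (Derive H) p / Derive H p ^ 3 + mu * Derive rho p * w (r q) p) = 0).
  { intros q p Hp. apply eq_trans with (2 := Heq (r q) p Hp). ring. }
  assert (Htop' : forall q, (1 + (- Dq w (r q) 0) ^ 2) / (2 * (Derive H 0 + Dp w (r q) 0) ^ 2)
      - 1 / (2 * Derive H 0 ^ 2) + mu * rho 0 * w (r q) 0 = 0).
  { intros q. apply eq_trans with (2 := Htop (r q)).
    replace ((- Dq w (r q) 0) ^ 2) with (Dq w (r q) 0 ^ 2) by ring. reflexivity. }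
  assert (Hd : forall e, 0 < e -> exists Q, forall q p, q < Q -> -1 <= p <= 0 ->
    Rabs (w (r q) p) < e /\ Rabs (- Dq w (r q) p) < e /\ Rabs (Dp w (r q) p) < e /\
    Rabs (Dq (Dq w) (r q) p) < e /\ Rabs (- Dp (Dq w) (r q) p) < e).
  { intros e He. destruct (Hdec e He) as [Q HQ]. exists (- Q). intros q p Hq Hp.
    destruct (HQ (r q) p ltac:(unfold r; lra) Hp) as [B1 [B2 [B3 [B4 [B5 _]]]]].
    rewrite !Rabs_Ropp. auto. }
  destruct (solitary_symmetric (Solitary (Derive H) (Derive (Derive H)) (Derive rho) (rho 0) mu
    (fun q p => w (r q) p) (fun q p => - Dq w (r q) p) (fun q p => Dp w (r q) p)
    (fun q p => Dq (Dq w) (r q) p) (fun q p => - Dp (Dq w) (r q) p) (fun q p => Dp (Dp w) (r q) p)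
    psi psi1 psi2 dl c N
    (fun t => Derive_correct _ _ (DG t)) CG1 Cd HH_p Hrho_dec Hr0 Hmu Hc HN prof
    (C2_reflect 0 _ _ _ _ _ _ HC) BN BM' (fun q => Hlo (r q)) Heq' Htop'
    (fun q => Hbot (r q)) (fun q => Hw_pos (r q)) Hd)) as [qs [S1 [S2 S3]]].
  simpl in S1, S2, S3.
  (* Reflection negates the axis and the q-derivative, so the two monotonicity statements change
     places. *)
  exists (- qs). split; [|split].
  + intros q p Hp. specialize (S1 (- q) p Hp). unfold r in S1.
    replace (2 * 0 - (qs + - q)) with (- qs + q) in S1 by ring.
    replace (2 * 0 - (qs - - q)) with (- qs - q) in S1 by ring. exact S1.
  + intros q p Hp Hq. specialize (S3 (r q) p Hp ltac:(unfold r; lra)). rewrite Hrr in S3. lra.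
  + intros q p Hp Hq. specialize (S2 (r q) p Hp ltac:(unfold r; lra)). rewrite Hrr in S2. lra.
Qed.
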